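(* Let $G$ be a bipartite Borel graph on a Polish space whose connected components all have 2 ends. Then $\chi'_B(G)\leq \Delta(G)+1$.
   Context: A Borel graph on a Polish space $X$ is a graph with vertex set $X$ whose edge set is a Borel subset of $X^2$ (symmetric and irreflexive). Bipartite means having no odd cycles. $\Delta(G)$ is the maximum degree. The Borel edge chromatic number $\chi'_B(G)$ is the least cardinal $\kappa$ such that $G$ admits a Borel proper edge coloring (edges sharing a vertex get distinct colors) with $\kappa$ colors. A connected graph has 2 ends if the supremum, over finite vertex sets $F$, of the number of infinite connected components of the graph with $F$ removed equals 2. *)

(* Defs.v *)
From mathcomp Require Import all_boot all_order all_algebra.
From mathcomp Require Import all_classical all_reals all_analysis.
From Stdlib Require Import Relation_Operators.

Set Implicit Arguments.
Unset Strict Implicit.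
Unset Printing Implicit Defensive.

Import Order.TTheory GRing.Theory Num.Theory.
Import numFieldNormedType.Exports.

Local Open Scope classical_set_scope.
Local Open Scope card_scope.
Local Open Scope ring_scope.

(* The library's complete metric structures are pointed and carry a chosen
   uniformity; a Polish space is a (possibly empty) topological space for which
   some compatible complete metric exists. *)
Definition metric_on (R : realType) (X : Type) (d : X -> X -> R) : Prop :=
  [/\ forall x y, 0 <= d x y,
      forall x y, d x y = 0 <-> x = y,
      forall x y, d x y = d y x &
      forall x y z, d x z <= d x y + d y z].

Definition metric_induces (R : realType) (X : topologicalType)
    (d : X -> X -> R) : Prop :=
  forall (x : X) (A : set X),
    nbhs x A <-> exists2 e : R, 0 < e & [set y | d x y < e] `<=` A.

Definition metric_complete (R : realType) (X : topologicalType)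
    (d : X -> X -> R) : Prop :=
  forall u : nat -> X,
    (forall e : R, 0 < e -> exists N : nat, forall m n : nat,
       (N <= m)%N -> (N <= n)%N -> d (u m) (u n) < e) ->
    exists l : X, u @ \oo --> l.

Definition polish (R : realType) (X : topologicalType) : Prop :=
  (exists2 S : set X, countable S & dense S) /\
  (exists d : X -> X -> R,
     [/\ metric_on d, metric_induces d & metric_complete d]).

Definition borel (X : topologicalType) : set (set X) := <<s @open X >>.

Record borelGraph (X : topologicalType) := BorelGraph {
  edge : set (X * X);
  edge_sym : forall x y, edge (x, y) -> edge (y, x);
  edge_irr : forall x, ~ edge (x, x);
  edge_borel : borel edge }.

(* Cardinals are represented by sets or types, compared with [#<=] and [#=].
   [card_sup P A S]: the cardinality of S is the supremum of the cardinalities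
   of the sets A i, for i in P. *)
Definition card_sup (I T U : Type) (P : set I) (A : I -> set T)
    (S : set U) : Prop :=
  (forall i, P i -> A i #<= S) /\
  (forall (V : Type) (S' : set V), (forall i, P i -> A i #<= S') -> S #<= S').

Section graph.
Variables (X : topologicalType) (G : borelGraph X).

Definition neighbors (x : X) : set X := [set y | edge G (x, y)].

(* D is a set whose cardinality, possibly infinite, is Delta(G). *)
Definition is_max_degree (D : Type) : Prop :=
  card_sup [set: X] neighbors [set: D].

(* Degenerate lengths are harmless for odd cycles: n = 1 would be a loop. *)
Definition is_cycle (n : nat) (p : 'I_n -> X) : Prop :=
  injective p /\ forall i : 'I_n, edge G (p i, p (ordS i)).

Definition bipartite : Prop :=
  forall (n : nat) (p : 'I_n -> X), is_cycle p -> ~~ odd n.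

(* The vertex set of the component of x in the subgraph induced on A,
   for x in A. *)
Definition component (A : set X) (x : X) : set X :=
  [set y | clos_refl_trans X (fun u v => [/\ A u, A v & edge G (u, v)]) x y].

Definition infinite_components (A : set X) : set (set X) :=
  [set C | infinite_set C /\ exists2 x, A x & C = component A x].

Definition is_number_of_ends (C : set X) (U : Type) (S : set U) : Prop :=
  card_sup [set F | finite_set F /\ F `<=` C]
           (fun F => infinite_components (C `\` F)) S.

Definition components_two_ended : Prop :=
  forall x : X, is_number_of_ends (component [set: X] x) `I_2.

Definition flip (e : X * X) : X * X := (e.2, e.1).

Definition share_vertex (e f : X * X) : Prop :=
  e.1 = f.1 \/ e.1 = f.2 \/ e.2 = f.1 \/ e.2 = f.2.

(* An undirected edge {x, y} is represented by both (x, y) and (y, x), which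
   must therefore get the same color. *)
Definition proper_edge_coloring (Y : Type) (c : edge G -> Y) : Prop :=
  (forall e f : edge G, val f = flip (val e) -> c e = c f) /\
  (forall e f : edge G, val f <> val e -> val f <> flip (val e) ->
     share_vertex (val e) (val f) -> c e <> c f).

(* Since G is Borel in X * X, this is measurability for the trace on G of the
   Borel sigma-algebra. *)
Definition borel_coloring (Y : topologicalType) (c : edge G -> Y) : Prop :=
  forall B : set Y, borel B -> borel [set val e | e in c @^-1` B].

(* G has a Borel proper edge coloring whose colors form a Polish space of the
   same cardinality as K. *)
Definition borel_edge_colorable (R : realType) (K : Type) : Prop :=
  exists Y : topologicalType,
    [/\ polish R Y, [set: Y] #= [set: K] &
        exists c : edge G -> Y, proper_edge_coloring c /\ borel_coloring c].

Definition is_borel_edge_chromatic_number (R : realType) (K : Type) : Prop :=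
  borel_edge_colorable R K /\
  forall L : Type, borel_edge_colorable R L -> [set: K] #<= [set: L].

End graph.

(* Main.v *)
(* Suppose first that the edge set is not covered by countably many Borel sets with at
   most one point in each vertical section. A Cantor scheme then gives a vertex with
   continuum many neighbors, so Delta is at least the continuum and every edge can be
   its own color. If it is so covered and Delta is infinite, the covering sets and a
   lexicographic order give a coloring with countably many colors.

   If Delta = d is finite, Lusin-Souslin makes the covering sets graphs of Borel maps
   that generate the graph, so quantifying over a component is Borel. In each component
   choose canonically a nonempty family of far apart balls, of the same radius, each
   separating the two ends. Either some ball of the family touches an infinite component
   of the complement of the balls; at most two balls do, so the component has a Borel
   root and gets the leftmost d-coloring, which exists by Koenig's theorem and compactness.
   Or the complement of the balls has finite components. Then color the neighborhoods of
   the balls by Koenig with colors 1, ..., d, and moving away from a ball forget the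
   colors 1, 2, ..., d one after the other. Where the first i colors are forgotten, the
   edges without a color have degree at most i and may use the i + 1 colors 0, ..., i;
   this one extra color makes the finite extension problem solvable. *)

Require Import Defs.
From mathcomp Require Import all_boot all_order all_algebra.
From mathcomp Require Import all_classical all_reals all_analysis.
From mathcomp Require Import zify lra.
From Stdlib Require Import Relation_Operators.

Set Implicit Arguments.
Unset Strict Implicit.
Unset Printing Implicit Defensive.

Local Open Scope classical_set_scope.
Local Open Scope card_scope.

(** * Borel and analytic subsets of the Baire space *)

(** The constants of the finite case fit together. The number of colors released at a vertex is half
    its distance to the balls, so along an edge it changes by at most one, and each value persists
    for two consecutive distances. This slack keeps the color bounds of adjacent vertices within one
    of each other even where a kept color pushes a bound down by one, which is the hypothesis of the
    extension theorem for finite graphs. Colors kept from the balls are raised by one; at each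
    vertex they then lie above all colors of free edges. The family of balls needs no maximal
    independent set: a component uses the first index, coding a radius and a basic neighborhood, for
    which some point is alone within the required distance. The chromatic number is a least
    cardinal, whose existence must be shown. By the perfect set theorem a Polish color space is
    countable or of size continuum, so it suffices to look for a finite, then a countable, then any
    color space. All Borel arguments pass through an injective code into the Baire space with Borel
    range. *)

Section sigma_algebra_comprehension.
Variables (T : Type) (B : set (set T)).
Hypothesis sB : sigma_algebra setT B.

Lemma sal_iff (P Q : T -> Prop) :
  (forall x, P x <-> Q x) -> B [set x | P x] -> B [set x | Q x].
Proof. by move=> PQ; have -> : P = Q by apply/funext => x; apply/propext. Qed.

Lemma sal_not (P : T -> Prop) : B [set x | P x] -> B [set x | ~ P x].
Proof.
case: sB => _ sC _ /sC; rewrite setTD.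
by congr B; apply/seteqP; split.
Qed.

Lemma sal_ex (P : nat -> T -> Prop) :
  (forall n, B [set x | P n x]) -> B [set x | exists n, P n x].
Proof.
case: sB => _ _ sU /sU; congr B.
by apply/seteqP; split => x [n]; [move=> _ ?; exists n | move=> ?; exists n].
Qed.

Lemma sal_all (P : nat -> T -> Prop) :
  (forall n, B [set x | P n x]) -> B [set x | forall n, P n x].
Proof.
move=> BP; apply: (@sal_iff (fun x => ~ exists n, ~ P n x)); last first.
  by apply: sal_not; apply: sal_ex => n; apply: sal_not.
by move=> x; split=> [/forallNP H n|H [n]]; [apply: contrapT; exact: H|].
Qed.

Lemma sal_cst (P : Prop) : B [set _ | P].
Proof.
have B0 : B set0 by case: sB.
have [p|np] := pselect P.
  by apply: (@sal_iff (fun=> ~ False)); [by move=> _; split=> // _ | exact: sal_not].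
by apply: (@sal_iff (fun=> False)) => // _; split.
Qed.

Lemma sal_or (P Q : T -> Prop) :
  B [set x | P x] -> B [set x | Q x] -> B [set x | P x \/ Q x].
Proof.
move=> BP BQ.
apply: (@sal_iff (fun x => exists n, (if n is 0 then P else Q) x)).
  by move=> x; split=> [[[|n]]|[]]; [left|right|exists 0|exists 1].
by apply: sal_ex => -[|n].
Qed.

Lemma sal_and (P Q : T -> Prop) :
  B [set x | P x] -> B [set x | Q x] -> B [set x | P x /\ Q x].
Proof.
move=> BP BQ.
apply: (@sal_iff (fun x => forall n, (if n is 0 then P else Q) x)).
  by move=> x; split=> [H|[p q] [|n]//]; split; [exact: (H 0)|exact: (H 1)].
by apply: sal_all => -[|n].
Qed.

Lemma sal_imp (P Q : T -> Prop) :
  B [set x | P x] -> B [set x | Q x] -> B [set x | P x -> Q x].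
Proof.
move=> BP BQ; apply: (@sal_iff (fun x => ~ P x \/ Q x)).
  by move=> x; split=> [[]//|H]; have [/H|] := pselect (P x); [right|left].
by apply: sal_or => //; apply: sal_not.
Qed.

Lemma sal_equiv (P Q : T -> Prop) :
  B [set x | P x] -> B [set x | Q x] -> B [set x | P x <-> Q x].
Proof. by move=> BP BQ; apply: sal_and; apply: sal_imp. Qed.

Lemma sal_exc (I : countType) (P : I -> T -> Prop) :
  (forall i, B [set x | P i x]) -> B [set x | exists i, P i x].
Proof.
move=> BP.
apply: (@sal_iff (fun x => exists n, if unpickle n is Some i then P i x else False)).
  move=> x; split=> [[n]|[i Pi]].
    by case: unpickle => // i Pi; exists i.
  by exists (pickle i); rewrite pickleK.
apply: sal_ex => n; case: unpickle => [i|]; [exact: BP | exact: sal_cst].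
Qed.

Lemma sal_allc (I : countType) (P : I -> T -> Prop) :
  (forall i, B [set x | P i x]) -> B [set x | forall i, P i x].
Proof.
move=> BP; apply: (@sal_iff (fun x => ~ exists n, ~ P n x)); last first.
  by apply: sal_not; apply: sal_exc => n; apply: sal_not.
by move=> x; split=> [/forallNP H n|H [n]]; [apply: contrapT; exact: H|].
Qed.

End sigma_algebra_comprehension.

Definition baire := nat -> nat.

Definition agree n (p q : baire) := forall i, i < n -> p i = q i.

Definition bclosed (C : set baire) :=
  forall p, (forall n, exists2 q, C q & agree n p q) -> C p.

Definition bcont (f : baire -> baire) :=
  forall p n, exists m, forall q, agree m p q -> agree n (f p) (f q).

Definition BN : set (set baire) := <<s [set A | exists k a, A = [set p | p k = a]] >>.

Lemma sBN : sigma_algebra setT BN.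
Proof. exact: smallest_sigma_algebra. Qed.

Lemma BN_coord k a : BN [set p | p k = a].
Proof. by apply: sub_sigma_algebra; exists k, a. Qed.

Lemma agree_le m n p q : m <= n -> agree n p q -> agree m p q.
Proof. by move=> mn H i im; apply: H; apply: leq_trans mn. Qed.

Lemma agree_sym n p q : agree n p q -> agree n q p.
Proof. by move=> H i /H. Qed.

Lemma agree_trans n p q r : agree n p q -> agree n q r -> agree n p r.
Proof. by move=> H K i i_n; rewrite H ?K. Qed.

Lemma eq_agree (p q : baire) : (forall n, agree n p q) -> p = q.
Proof. by move=> H; apply/funext => i; apply: (H i.+1). Qed.

Lemma bcont_comp f g : bcont f -> bcont g -> bcont (f \o g).
Proof.
move=> cf cg p n; have [m Hm] := cf (g p) n; have [k Hk] := cg p m.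
by exists k => q /Hk/Hm.
Qed.

Lemma bcont_id : bcont id.
Proof. by move=> p n; exists n. Qed.

Definition reidx (c : nat -> nat) (p : baire) : baire := fun k => p (c k).

Lemma bcont_reidx c : bcont (reidx c).
Proof.
move=> p n; exists (\max_(i < n) c i).+1 => q H i i_n; apply: H.
by rewrite ltnS (bigmax_sup (Ordinal i_n)).
Qed.

Lemma bclosed_preimage f C : bcont f -> bclosed C -> bclosed (f @^-1` C).
Proof.
move=> cf cC p H; apply: cC => n; have [m Hm] := cf p n.
by have [q Cq /Hm] := H m; exists (f q).
Qed.

Lemma bclosed_eq f g : bcont f -> bcont g -> bclosed [set p | f p = g p].
Proof.
move=> cf cg p H; apply: eq_agree => n.
have [m Hm] := cf p n; have [k Hk] := cg p n.
have [q /= fg pq] := H (maxn m k).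
apply: (agree_trans (Hm q (agree_le (leq_maxl _ _) pq))).
by rewrite fg; apply: agree_sym; apply: Hk; apply: agree_le pq; exact: leq_maxr.
Qed.

Lemma bclosed_and (C D : set baire) : bclosed C -> bclosed D -> bclosed (C `&` D).
Proof.
move=> cC cD p H; split; [apply: cC|apply: cD] => n;
by have [q [Cq Dq] pq] := H n; exists q.
Qed.

Lemma bclosed_all (C : nat -> set baire) :
  (forall n, bclosed (C n)) -> bclosed [set p | forall n, C n p].
Proof. by move=> cC p H n; apply: cC => m; have [q Cq pq] := H m; exists q. Qed.

Lemma bclosed_coord k a : bclosed [set p | p k = a].
Proof. by move=> p /(_ k.+1)[q /= <-]; apply. Qed.

Lemma bclosedN_coord k a : bclosed [set p | p k <> a].
Proof. by move=> p /(_ k.+1)[q /= H pq]; rewrite pq. Qed.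

Lemma nat2_bij : exists (f : nat * nat -> nat) (g : nat -> nat * nat), cancel f g /\ cancel g f.
Proof.
have /card_set_bijP[f [_ finj fsurj]] := card_nat2.
have /choice[g fg] : forall n, exists x, f x = n.
  by move=> n; have [x _ <-] := fsurj n I; exists x.
exists f, g; split=> // x; apply: finj; rewrite ?inE //.
Qed.

Definition code2 := projT1 (cid nat2_bij).
Definition decode2 := projT1 (cid (projT2 (cid nat2_bij))).

Lemma code2K : cancel code2 decode2.
Proof. by have [] := projT2 (cid (projT2 (cid nat2_bij))). Qed.

Lemma decode2K : cancel decode2 code2.
Proof. by have [] := projT2 (cid (projT2 (cid nat2_bij))). Qed.

Definition row n : baire -> baire := reidx (fun j => code2 (n, j)).

Definition of_rows (x : nat -> baire) : baire :=
  fun k => x (decode2 k).1 (decode2 k).2.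

Lemma of_rowsK x n : row n (of_rows x) = x n.
Proof. by apply/funext => j; rewrite /row /reidx /of_rows code2K. Qed.

Lemma eq_rows p q : (forall n, row n p = row n q) -> p = q.
Proof.
move=> H; apply/funext => k; rewrite -(decode2K k); case: (decode2 k) => n j.
exact: (congr1 (@^~ j) (H n)).
Qed.

(** Continuous images of closed sets, injective ones when the flag is set. The flag lets closure
    properties be proved once for analytic sets and for the injective presentations of Borel sets
    that Lusin-Souslin needs. *)
Definition param (inj : bool) (A : set baire) := exists C f,
  [/\ bclosed C, bcont f, A = f @` C & inj -> forall p q, C p -> C q -> f p = f q -> p = q].

Definition analytic := param false.

Lemma param_analytic b A : param b A -> analytic A.
Proof. by move=> [C [f [cC cf -> _]]]; exists C, f. Qed.

Lemma param_closed b C : bclosed C -> param b C.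
Proof. by move=> cC; exists C, id; split=> //; [exact: bcont_id | by rewrite image_id]. Qed.

(** A point of the intersection is presented by a sequence of parameters, one per row, all with the
    same image. This fibre product is closed, and injectivity is inherited row by row. *)
Lemma param_bigcap b (A : nat -> set baire) :
  (forall n, param b (A n)) -> param b [set p | forall n, A n p].
Proof.
move=> pA; have [C HC] := choice pA; have [f H] := choice HC.
exists [set p | forall n, C n (row n p) /\ f n (row n p) = f 0 (row 0 p)].
exists (f 0 \o row 0); split.
- apply: bclosed_all => n; apply: bclosed_and.
    by apply: bclosed_preimage; [exact: bcont_reidx | case: (H n)].
  by apply: bclosed_eq; apply: bcont_comp; [case: (H n)|exact: bcont_reidx|
    case: (H 0)|exact: bcont_reidx].
- by apply: bcont_comp; [case: (H 0)|exact: bcont_reidx].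
- apply/seteqP; split=> [y Ay|_ [p Hp <-] n] /=.
    have /choice[x Hx] : forall n, exists x, C n x /\ f n x = y.
      by move=> n; have := Ay n; case: (H n) => _ _ -> _ [x ? ?]; exists x.
    exists (of_rows x); last by rewrite /= of_rowsK; case: (Hx 0).
    by move=> n; rewrite !of_rowsK; have [? ->] := Hx n; have [_ ->] := Hx 0.
  case: (H n) => _ _ -> _; have [? <-] := Hp n; by exists (row n p).
- move=> bT p q Hp Hq /= pq; apply: eq_rows => n.
  case: (H n) => _ _ _ /(_ bT); apply; [by case: (Hp n)|by case: (Hq n)|].
  by have [_ ->] := Hp n; have [_ ->] := Hq n.
Qed.

(** Coordinate 0 names the piece and the shifted sequence is the parameter in it. Disjointness lets
    the image determine coordinate 0, hence injectivity. *)
Lemma param_bigcup (b : bool) (A : nat -> set baire) :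
  (b -> forall m n p, A m p -> A n p -> m = n) ->
  (forall n, param b (A n)) -> param b [set p | exists n, A n p].
Proof.
move=> disj pA; have [C HC] := choice pA; have [f H] := choice HC.
exists [set p | C (p 0) (reidx S p)].
exists (fun p => f (p 0) (reidx S p)); split.
- move=> p Hp; case: (H (p 0)) => cC _ _ _; apply: cC => n.
  have [q Cq pq] := Hp n.+1; exists (reidx S q).
    by rewrite (pq 0).
  by move=> i i_n; rewrite /reidx pq.
- move=> p n; case: (H (p 0)) => _ cf _ _.
  have [m Hm] := cf (reidx S p) n; exists m.+1 => q pq.
  by rewrite -(pq 0)//; apply: Hm => i im; rewrite /reidx pq.
- apply/seteqP; split=> [y [n]|_ [p Hp <-]] /=.
    case: (H n) => _ _ -> _ [x Cx <-].
    by exists (fun k => if k is k'.+1 then x k' else n).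
  by exists (p 0); case: (H (p 0)) => _ _ -> _; exists (reidx S p).
- move=> bT p q Hp Hq fpq.
  have im r : C (r 0) (reidx S r) -> A (r 0) (f (r 0) (reidx S r)).
    by move=> Cr; case: (H (r 0)) => _ _ -> _; exists (reidx S r).
  have e0 : p 0 = q 0.
    by apply: (disj bT) (im _ Hp) _; rewrite fpq; exact: im.
  have e1 : reidx S p = reidx S q.
    case: (H (p 0)) => _ _ _ /(_ bT); apply=> //; first by rewrite e0.
    by rewrite fpq e0.
  apply/funext => -[//|k]; exact: (congr1 (@^~ k) e1).
Qed.

Lemma param_setI b A A' : param b A -> param b A' -> param b (A `&` A').
Proof.
move=> pA pA'; have := @param_bigcap b (fun n => if n is 0 then A else A').
have -> : [set p | forall n : nat, (if n is 0 then A else A') p] = A `&` A'.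
  by apply/seteqP; split=> [p H|p [H K] [|n]//]; split; [exact: (H 0)|exact: (H 1)].
by apply; case.
Qed.

(** Complements of injective images are not visibly such images, so the induction carries [A] and
    its complement together. *)
Lemma BN_param A : BN A -> param true A.
Proof.
suff : BN `<=` [set A | param true A /\ param true (~` A)] by move=> H /H[].
apply: smallest_sub => [|_ [k [a ->]]]; last first.
  by split; apply: param_closed; [exact: bclosed_coord|exact: bclosedN_coord].
have cl0 : bclosed set0 by move=> p /(_ 0)[].
split=> [|B [pB pCB]|F HF].
- by split; [exact: param_closed|rewrite setC0; apply: param_closed => p].
- by rewrite setTD; split=> //; rewrite setCK.
split; last first.
  rewrite setC_bigcup; have := @param_bigcap true (fun n => ~` F n) (fun n => (HF n).2).
  by congr param; apply/seteqP; split=> p H n; [move=> _|]; exact: H.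
(* Selects the points whose least index is [n]; the union becomes disjoint, as an injective
   presentation requires. *)
pose G n m := if m < n then ~` F m else F n.
have := @param_bigcup true (fun n => [set p | forall m, G n m p]).
have -> : [set p | exists n, [set p | forall m, G n m p] p] = \bigcup_k F k.
  apply/seteqP; split=> [p [n /(_ n)]|p [n _ Fn]].
    by rewrite /G ltnn => ?; exists n.
  have ex : exists n, `[< F n p >] by exists n; apply/asboolP.
  exists (ex_minn ex); case: ex_minnP => k /asboolP Fk kmin m.
  rewrite /G; case: ifP => // mk Fm; have /kmin : `[< F m p >] by apply/asboolP.
  by rewrite leqNgt mk.
apply=> [_ m n p Gm Gn|n].
  case: (ltngtP m n) => // mn.
    by have := Gn m; have := Gm m; rewrite /G ltnn mn.
  by have := Gm n; have := Gn n; rewrite /G ltnn mn.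
by apply: param_bigcap => m; rewrite /G; case: ifP => _; case: (HF m); case: (HF n).
Qed.

Lemma BN_analytic A : BN A -> analytic A.
Proof. by move=> /BN_param/param_analytic. Qed.

Lemma analytic_image f A : bcont f -> analytic A -> analytic (f @` A).
Proof.
move=> cf [C [g [cC cg -> _]]]; exists C, (f \o g); split=> //.
  exact: bcont_comp.
by rewrite image_comp.
Qed.

Lemma sal_gen_preimage (T U : Type) (B : set (set T)) (F : set (set U)) (f : T -> U) :
  sigma_algebra setT B -> (forall A, F A -> B (f @^-1` A)) ->
  forall A, <<s F >> A -> B (f @^-1` A).
Proof.
move=> sB BF; suff : <<s F >> `<=` [set A | B (f @^-1` A)] by [].
apply: smallest_sub => [|A]; last exact: BF.
split=> [|A BA|A BA].
- by rewrite /= preimage_set0; case: sB.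
- by rewrite /= setTD; exact: (sal_not sB BA).
- by rewrite /= preimage_bigcup; case: sB => _ _; apply.
Qed.

Lemma sal_preimage (T : Type) (B : set (set T)) (h : T -> baire) :
  sigma_algebra setT B -> (forall k a, B [set x | h x k = a]) ->
  forall A, BN A -> B (h @^-1` A).
Proof. by move=> sB Bh; apply: sal_gen_preimage => // _ [k [a ->]]; exact: Bh. Qed.

Lemma BN_preimage_reidx c A : BN A -> BN (reidx c @^-1` A).
Proof. by apply: sal_preimage; [exact: sBN|move=> k a; exact: BN_coord]. Qed.

Lemma dependent_choice_in (T : Type) (P : T -> Prop) (Q : T -> T -> Prop) :
  (forall x, P x -> exists y, P y /\ Q x y) -> forall x0, P x0 ->
  exists u : nat -> T, u 0 = x0 /\ forall n, P (u n) /\ Q (u n) (u n.+1).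
Proof.
move=> H x0 Px0.
have /choice[f Hf] : forall x, exists y, P x -> P y /\ Q x y.
  move=> x; have [/H[y Hy]|nP] := pselect (P x); first by exists y.
  by exists x.
have Pu n : P (iter n f x0) by elim: n => //= n /Hf[].
by exists (fun n => iter n f x0); split=> // n; split=> //=; case: (Hf _ (Pu n)).
Qed.

Definition cyl (s : seq nat) : set baire :=
  [set p | forall i, i < size s -> p i = nth 0 s i].

Lemma cyl_rcons s a p : cyl (rcons s a) p <-> cyl s p /\ p (size s) = a.
Proof.
split=> [H|[H pa] i].
  split=> [i i_s|]; last by rewrite H ?size_rcons// nth_rcons ltnn eqxx.
  by rewrite H ?size_rcons ?ltnS ?(ltnW i_s)// nth_rcons i_s.
rewrite size_rcons ltnS leq_eqVlt nth_rcons => /predU1P[->|i_s].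
  by rewrite ltnn eqxx.
by rewrite i_s H.
Qed.

Lemma cyl_mkseq n p q : cyl (mkseq p n) q <-> agree n p q.
Proof.
by split=> H i; [move=> i_n; have := H i; rewrite size_mkseq nth_mkseq// => ->
  |rewrite size_mkseq => i_n; rewrite nth_mkseq// H].
Qed.

Lemma cyl_agree s p q : cyl s p -> cyl s q -> agree (size s) p q.
Proof. by move=> Hp Hq i i_s; rewrite Hp ?Hq. Qed.

Lemma BN_cyl s : BN (cyl s).
Proof.
by apply: (sal_all sBN) => i; apply: (sal_imp sBN);
  [exact: (sal_cst sBN)|exact: BN_coord].
Qed.

Lemma cyl_limit (s : nat -> seq nat) :
  (forall n, prefix (s n) (s n.+1)) -> (forall n, n <= size (s n)) ->
  exists p, forall n, cyl (s n) p.
Proof.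
move=> Hp Hs; exists (fun i => nth 0 (s i.+1) i) => n i i_n.
have mono m k : m <= k -> prefix (s m) (s k).
  by move=> /subnK <-; elim: (k - m) => [|j IH]; [exact: prefix_refl|
    exact: prefix_trans IH (Hp _)].
have nthE m k j : m <= k -> j < size (s m) -> nth 0 (s k) j = nth 0 (s m) j.
  by move=> /mono/prefixP[u ->] jm; rewrite nth_cat jm.
have [ni|ni] := leqP n i.+1; first exact: nthE.
by rewrite (nthE _ _ _ (ltnW ni)) ?Hs.
Qed.

Lemma bclosed_limit C (s : nat -> seq nat) p : bclosed C ->
  (forall n, n <= size (s n)) -> (forall n, C `&` cyl (s n) !=set0) ->
  (forall n, cyl (s n) p) -> C p.
Proof.
move=> cC Hs C0 sp; apply: cC => n; have [q [Cq sq]] := C0 n; exists q => //.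
exact: agree_le (Hs n) (cyl_agree (sp n) sq).
Qed.

Definition separated (A A' : set baire) :=
  exists2 B, BN B & A `<=` B /\ (forall p, A' p -> ~ B p).

Lemma separated_bigcup (A A' : nat -> set baire) :
  (forall i j, separated (A i) (A' j)) ->
  separated [set p | exists i, A i p] [set p | exists j, A' j p].
Proof.
move=> H; have /choice[S HS] : forall ij : nat * nat, exists B,
    [/\ BN B, A ij.1 `<=` B & forall p, A' ij.2 p -> ~ B p].
  by move=> [i j]; have [B ? []] := H i j; exists B.
exists [set p | exists i, forall j, S (i, j) p].
  by apply: (sal_ex sBN) => i; apply: (sal_all sBN) => j; case: (HS (i, j)).
split=> [p [i Ap]|p [j A'p] [i /(_ j)]].
  by exists i => j; case: (HS (i, j)) => _ /(_ p Ap).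
by case: (HS (i, j)) => _ _; apply.
Qed.

Lemma separated_sub A A' D D' : A `<=` D -> A' `<=` D' -> separated D D' -> separated A A'.
Proof. by move=> AD AD' [B BB [DB DB']]; exists B => //; split=> p; [move=> /AD/DB|move=> /AD'/DB']. Qed.

Lemma image_cyl (f : baire -> baire) C s :
  f @` (C `&` cyl s) `<=` [set p | exists a, (f @` (C `&` cyl (rcons s a))) p].
Proof.
move=> _ [p [Cp sp] <-]; exists (p (size s)), p => //.
by split=> //; apply/cyl_rcons.
Qed.

Lemma cont_cyl (f : baire -> baire) (s : nat -> seq nat) p k : bcont f ->
  (forall n, n <= size (s n)) -> (forall n, cyl (s n) p) ->
  exists m, forall n, m <= n -> forall q, cyl (s n) q -> agree k (f p) (f q).
Proof.
move=> cf Hs sp; have [m Hm] := cf p k; exists m => n mn q sq.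
by apply: Hm; apply: agree_le (cyl_agree (sp n) sq); apply: leq_trans (Hs n).
Qed.

(** If two images cannot be separated, some pair of their subpieces cannot either, since countably
    many separating sets combine. Iterating gives two branches whose limits have different images;
    by continuity, a coordinate where these differ separates small pieces. *)
Theorem lusin_separation A A' :
  analytic A -> analytic A' -> (forall p, A p -> A' p -> False) -> separated A A'.
Proof.
move=> [C [f [cC cf -> _]]] [C' [f' [cC' cf' -> _]]] disj; apply: contrapT => nsep.
pose P (st : seq nat * seq nat) :=
  ~ separated (f @` (C `&` cyl st.1)) (f' @` (C' `&` cyl st.2)).
pose Q (st st' : seq nat * seq nat) :=
  exists a b, st' = (rcons st.1 a, rcons st.2 b).
have step st : P st -> exists st', P st' /\ Q st st'.
  move=> Pst; apply: contrapT => H; apply: Pst.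
  apply: separated_sub (@image_cyl f C st.1) (@image_cyl f' C' st.2) _.
  apply: separated_bigcup => i j; apply: contrapT => ns; apply: H.
  by exists (rcons st.1 i, rcons st.2 j); split=> //; exists i, j.
have [|u [u0 Hu]] := @dependent_choice_in _ P Q step ([::], [::]).
  apply: contra_not nsep; apply: separated_sub => _ [p Cp <-]; exists p => //;
  by split.
have pre1 n : prefix (u n).1 (u n.+1).1.
  by have [_ [a [b ->]]] := Hu n; rewrite prefix_rcons.
have pre2 n : prefix (u n).2 (u n.+1).2.
  by have [_ [a [b ->]]] := Hu n; rewrite prefix_rcons.
have sz n : size (u n).1 = n /\ size (u n).2 = n.
  elim: n => [|n [IH1 IH2]]; first by rewrite u0.
  by have [_ [a [b ->]]] := Hu n; rewrite !size_rcons IH1 IH2.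
have sz1 n : n <= size (u n).1 by case: (sz n) => ->.
have sz2 n : n <= size (u n).2 by case: (sz n) => _ ->.
have [p Hp] := cyl_limit pre1 sz1; have [q Hq] := cyl_limit pre2 sz2.
have Cp : C p.
  apply: (bclosed_limit cC sz1 _ Hp) => n; apply: contrapT => e.
  case: (Hu n) => Pn _; apply: Pn; exists set0; first by case: sBN.
  by split=> [_ [x Cx <-]|x _ []]; case: e; exists x.
have Cq : C' q.
  apply: (bclosed_limit cC' sz2 _ Hq) => n; apply: contrapT => e.
  case: (Hu n) => Pn _; apply: Pn; exists setT; first exact: (sal_cst sBN True).
  by split=> // _ [x Cx <-]; case: e; exists x.
have /existsNP[k fk] : ~ forall k, f p k = f' q k.
  by move=> /funext e; apply: (disj (f p)); [exists p|rewrite e; exists q].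
have [m Hm] := cont_cyl k.+1 cf sz1 Hp; have [m' Hm'] := cont_cyl k.+1 cf' sz2 Hq.
case: (Hu (maxn m m')) => Pn _; apply: Pn; exists [set y | y k = f p k].
  exact: BN_coord.
split=> [_ [x [_ sx] <-]|_ [x [_ sx] <-]] /=.
  by rewrite -(Hm _ (leq_maxl _ _) _ sx k).
by rewrite -(Hm' _ (leq_maxr _ _) _ sx k)// => /esym.
Qed.

Definition bfst := reidx double.
Definition bsnd := reidx (fun k => k.*2.+1).
Definition bpair (p q : baire) : baire := fun k => if odd k then q k./2 else p k./2.

Lemma bpairK1 p q : bfst (bpair p q) = p.
Proof. by apply/funext => k; rewrite /bfst /reidx /bpair odd_double doubleK. Qed.

Lemma bpairK2 p q : bsnd (bpair p q) = q.
Proof. by apply/funext => k; rewrite /bsnd /reidx /bpair /= odd_double /= uphalf_double. Qed.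

Lemma bpair_surj p : bpair (bfst p) (bsnd p) = p.
Proof.
apply/funext => k; rewrite /bpair /bfst /bsnd /reidx.
by case: ifP => ok; congr p; rewrite -[RHS](odd_double_half k) ok.
Qed.

Definition funlike (B : set baire) :=
  forall p q, B p -> B q -> bfst p = bfst q -> p = q.

(** For each output coordinate [k] and values [a <> b], the sets of first components where
    coordinate [k] is [a] or [b] are disjoint and analytic. [D] collects the pairs that respect
    Borel sets separating them. *)
Lemma funlike_cover W : analytic W -> funlike W ->
  exists D, [/\ BN D, funlike D & W `<=` D].
Proof.
move=> aW fW; pose V k a := bfst @` (W `&` [set p | bsnd p k = a]).
have aV k a : analytic (V k a).
  apply: analytic_image (bcont_reidx _) _; apply: param_setI => //.
  exact: BN_analytic (BN_preimage_reidx _ (BN_coord k a)).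
have /choice[S HS] : forall i : nat * nat * nat, exists B, BN B /\
    (i.1.2 <> i.2 -> V i.1.1 i.1.2 `<=` B /\ forall p, V i.1.1 i.2 p -> ~ B p).
  move=> [[k a] b] /=; have [->|ab] := pselect (a = b).
    by exists set0; split=> //; case: sBN.
  have [||x [p [Wp pa] <-] [q [Wq qb]] qp|B BB H] := @lusin_separation (V k a) (V k b) => //.
    by apply: ab; rewrite -pa -qb (fW _ _ Wq Wp qp).
  by exists B.
exists [set p | forall i, i.1.2 <> i.2 -> (bsnd p i.1.1 = i.1.2 -> S i (bfst p)) /\
    (bsnd p i.1.1 = i.2 -> ~ S i (bfst p))]; split.
- apply: (sal_allc sBN) => i; apply: (sal_imp sBN); first exact: (sal_cst sBN).
  have BS : BN [set p | S i (bfst p)] by apply: BN_preimage_reidx; case: (HS i).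
  have Bk a : BN [set p | bsnd p i.1.1 = a] by exact: BN_preimage_reidx (BN_coord _ a).
  by apply: (sal_and sBN); apply: (sal_imp sBN) => //; apply: (sal_not sBN).
- move=> p q Hp Hq pq; rewrite -(bpair_surj p) -(bpair_surj q) pq; congr bpair.
  apply/funext => k; apply: contrapT => ne.
  have [/= /(_ erefl) Sp _] := Hp (k, bsnd p k, bsnd q k) ne.
  by have [/= _ /(_ erefl)] := Hq (k, bsnd p k, bsnd q k) ne; rewrite -pq.
- move=> p Wp i ne; have [_ /(_ ne)[H K]] := HS i.
  by split=> [pa|pb]; [apply: H|apply: K]; exists p.
Qed.

Lemma BN_closure A : BN [set x | forall n, exists2 y, A y & agree n x y].
Proof.
apply: (@sal_iff _ BN (fun x => forall n, exists u : seq nat,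
    size u = n /\ (exists y, A y /\ cyl u y) /\ cyl u x)).
  move=> x; split=> [H n|H n].
    have [u [<- [[y [Ay uy]] ux]]] := H n; exists y => //; exact: cyl_agree.
  have [y Ay xy] := H n; exists (mkseq x n); rewrite size_mkseq; split=> //.
  by split; [exists y; split=> //|]; apply/cyl_mkseq.
apply: (sal_all sBN) => n; apply: (sal_exc sBN) => u.
apply: (sal_and sBN); first exact: (sal_cst sBN).
by apply: (sal_and sBN); [exact: (sal_cst sBN)|exact: BN_cyl].
Qed.

(** Images of distinct cylinders of one length are disjoint and analytic, so they lie in disjoint
    Borel sets [D s]. A point is in the image exactly when at every length some [s] has it in the
    closure of [V s] and in [D] of all prefixes of [s]. *)
Theorem lusin_souslin C g : bclosed C -> bcont g ->
  (forall p q, C p -> C q -> g p = g q -> p = q) -> BN (g @` C).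
Proof.
move=> cC cg injg; pose V s := g @` (C `&` cyl s).
have aV s : analytic (V s).
  by apply: analytic_image => //; apply: param_setI; [exact: param_closed|
    exact: BN_analytic (BN_cyl s)].
have /choice[S HS] : forall i : seq nat * seq nat, exists B, BN B /\
    (size i.1 = size i.2 -> i.1 <> i.2 -> V i.1 `<=` B /\ forall p, V i.2 p -> ~ B p).
  move=> [s t] /=; have [[sst st]|H] := pselect (size s = size t /\ s <> t); last first.
    by exists set0; split=> [|? ?]; [case: sBN|case: H].
  have [||x [p [Cp sp] <-] [q [Cq tq]] qp|B BB H] := @lusin_separation (V s) (V t) => //.
    apply: st; apply: (@eq_from_nth _ 0) => // i i_s.
    by rewrite -sp// -tq -?sst// (injg _ _ Cq Cp qp).
  by exists B.
pose D s : set baire := [set x | forall t, size t = size s -> t <> s -> S (s, t) x /\ ~ S (t, s) x].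
have BD s : BN (D s).
  apply: (sal_allc sBN) => t; do 2 (apply: (sal_imp sBN); first exact: (sal_cst sBN)).
  by apply: (sal_and sBN); [|apply: (sal_not sBN)]; case: (HS (s, t)); case: (HS (t, s)).
have VD s : V s `<=` D s.
  move=> x Vx t st ts; have [_ /(_ (esym st) (nesym ts))[/(_ x Vx) ? _]] := HS (s, t).
  by have [_ /(_ st ts)[_ /(_ x Vx)]] := HS (t, s).
have DD s t x : D s x -> D t x -> size s = size t -> s = t.
  move=> Dx Dx' st; apply: contrapT => ne.
  by have [? _] := Dx t (esym st) (nesym ne); have [_] := Dx' s st ne.
(* Membership in [D] at every prefix makes the words of different lengths nested; the closure
   condition forces the image of their limit to be [x]. *)
pose K n x (s : seq nat) := size s = n /\ (forall m, m <= n -> D (take m s) x) /\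
    forall k, exists2 y, V s y & agree k x y.
have -> : g @` C = [set x | forall n, exists s, K n x s].
  apply/seteqP; split=> [_ [p Cp <-] n|x /choice[s Hs]].
    have Vp m : V (mkseq p m) (g p) by exists p => //; split=> //; apply/cyl_mkseq.
    exists (mkseq p n); split; first by rewrite size_mkseq.
    split=> [m mn|k]; last by exists (g p).
    suff -> : take m (mkseq p n) = mkseq p m by exact: VD.
    by rewrite /mkseq -map_take take_iota (minn_idPl mn).
  have pre n : prefix (s n) (s n.+1).
    have [sz [Ds _]] := Hs n; have [sz1 [Ds1 _]] := Hs n.+1.
    suff <- : take n (s n.+1) = s n by exact: prefix_take.
    apply: (DD _ _ x); first exact: Ds1.
      by have := Ds n (leqnn n); rewrite -{1}sz take_size.
    by rewrite size_take sz1 ltnSn sz.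
  have sz n : n <= size (s n) by case: (Hs n) => ->.
  have [p Hp] := cyl_limit pre sz; exists p.
    apply: (bclosed_limit cC sz _ Hp) => n.
    by have [_ [_ /(_ 0)[_ [q Cq _] _]]] := Hs n; exists q.
  apply: eq_agree => k; have [m Hm] := cont_cyl k cg sz Hp.
  have [_ [_ /(_ k)[_ [q [_ sq] <-] xq]]] := Hs m.
  by apply: (agree_trans (Hm m (leqnn m) _ sq)); exact: agree_sym.
apply: (sal_all sBN) => n; apply: (sal_exc sBN) => s.
apply: (sal_and sBN); first exact: (sal_cst sBN).
apply: (sal_and sBN); last exact: BN_closure.
by apply: (sal_all sBN) => m; apply: (sal_imp sBN); [exact: (sal_cst sBN)|exact: BD].
Qed.

Corollary BN_proj B : BN B -> funlike B -> BN (bfst @` B).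
Proof.
move=> /BN_param[C [f [cC cf -> /(_ isT) injf]]] fB; rewrite image_comp.
apply: lusin_souslin => //; first exact: (bcont_comp (bcont_reidx _) cf).
by move=> p q Cp Cq pq; apply: injf => //; apply: fB pq; [exists p|exists q].
Qed.

(** * Thin sets of pairs *)

Lemma analytic_preimage h A : bcont h -> analytic A -> analytic (h @^-1` A).
Proof.
move=> ch [C [f [cC cf -> _]]].
exists [set r | C (row 1 r) /\ f (row 1 r) = h (row 0 r)], (row 0); split=> //.
- apply: bclosed_and; first by apply: bclosed_preimage => //; exact: bcont_reidx.
  by apply: bclosed_eq; apply: bcont_comp => //; exact: bcont_reidx.
- exact: bcont_reidx.
apply/seteqP; split=> [x [p Cp fp]|_ [r [Cr fr] <-]]; last by exists (row 1 r).
by exists (of_rows (fun n => if n is 0 then x else p)); rewrite /= !of_rowsK.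
Qed.

Definition thin (Z : set baire) := exists D : nat -> set baire,
  (forall n, BN (D n) /\ funlike (D n)) /\ Z = [set p | exists n, D n p].

Lemma thin_BN Z : thin Z -> BN Z.
Proof. by move=> [D [HD ->]]; apply: (sal_ex sBN) => n; case: (HD n). Qed.

Lemma thin_funlike D : BN D -> funlike D -> thin D.
Proof.
move=> BD fD; exists (fun=> D); split=> //.
by apply/seteqP; split=> [p Dp|p [_]//]; exists 0.
Qed.

Lemma thin0 : thin set0.
Proof. by apply: thin_funlike => [|p q []]; case: sBN. Qed.

Lemma thin_bigcup (Z : nat -> set baire) :
  (forall n, thin (Z n)) -> thin [set p | exists n, Z n p].
Proof.
move=> tZ; have [D HD] := choice tZ.
exists (fun n => D (decode2 n).1 (decode2 n).2); split=> [n|].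
  by case: (HD (decode2 n).1) => H _; exact: H.
apply/seteqP; split=> [p [n]|p [n Dp]].
  by case: (HD n) => _ -> [m Dp]; exists (code2 (n, m)); rewrite code2K.
exists (decode2 n).1; case: (HD (decode2 n).1) => _ ->.
by exists (decode2 n).2.
Qed.

Lemma thin_bigcupc (I : countType) (Z : I -> set baire) :
  (forall n, thin (Z n)) -> thin [set p | exists n, Z n p].
Proof.
move=> tZ; have := @thin_bigcup (fun n => if unpickle n is Some i then Z i else set0).
have -> : [set p | exists n, (if unpickle n is Some i then Z i else set0) p] =
    [set p | exists n, Z n p].
  apply/seteqP; split=> [p [n]|p [i Zp]]; last by exists (pickle i); rewrite pickleK.
  by case: unpickle => [i Zp|//]; exists i.
by apply=> n; case: unpickle => [i|]; [exact: tZ|exact: thin0].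
Qed.

Lemma thin_setU Z Z' : thin Z -> thin Z' -> thin [set p | Z p \/ Z' p].
Proof.
move=> tZ tZ'; have := @thin_bigcup (fun n => if n is 0 then Z else Z').
have -> : [set p | exists n, (if n is 0 then Z else Z') p] = [set p | Z p \/ Z' p].
  apply/seteqP; split=> [p [[|n]]|p []]; [by left|by right|by exists 0|by exists 1].
by apply; case.
Qed.

Section dichotomy.
Variables (C : set baire) (f : baire -> baire).
Hypotheses (cC : bclosed C) (cf : bcont f).

(* The fibre product over the first coordinate of the pieces [f @` (C `&` cyl s)],
   for s in l, cannot be destroyed by removing a thin set from the plane. *)
Definition large (l : seq (seq nat)) := forall Z, thin Z ->
  exists x, forall s, s \in l -> exists p, [/\ C p, cyl s p, bfst (f p) = x & ~ Z (f p)].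

(** Strictly longer words make the scheme converge; coordinate [k] of the second component separates
    the limits of the two branches. *)
Definition splits (s u u' : seq nat) := [/\ prefix s u, prefix s u',
  size s < size u, size s < size u' &
  exists k a b, [/\ a <> b, forall p, C p -> cyl u p -> bsnd (f p) k = a &
                 forall p, C p -> cyl u' p -> bsnd (f p) k = b]].

Lemma large_sub l l' : {subset l' <= l} -> large l -> large l'.
Proof. by move=> sl H Z /H[x Hx]; exists x => s /sl/Hx. Qed.

Lemma separating_cyl s p p' : C p -> C p' -> cyl s p -> cyl s p' ->
  bsnd (f p) <> bsnd (f p') ->
  exists u u', [/\ splits s u u', cyl u p & cyl u' p'].
Proof.
move=> Cp Cp' sp sp' ne.
have /existsNP[k fk] : ~ forall k, bsnd (f p) k = bsnd (f p') k.
  by move=> /funext.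
have cg : bcont (bsnd \o f) by apply: bcont_comp => //; exact: bcont_reidx.
have [m Hm] := cg p k.+1; have [m' Hm'] := cg p' k.+1.
pose n := maxn (size s).+1 (maxn m m').
have sn : size s < n by rewrite /n leq_max leqnn.
have pre r : cyl s r -> prefix s (mkseq r n).
  move=> sr; suff -> : s = take (size s) (mkseq r n) by exact: prefix_take.
  apply: (@eq_from_nth _ 0); first by rewrite size_take size_mkseq sn.
  by move=> i i_s; rewrite nth_take// nth_mkseq ?sr// (ltn_trans i_s).
exists (mkseq p n), (mkseq p' n); split; [|exact/cyl_mkseq|exact/cyl_mkseq].
split; rewrite ?size_mkseq//; [exact: pre|exact: pre|].
exists k, (bsnd (f p) k), (bsnd (f p') k); split=> // q _ /cyl_mkseq pq.
  by rewrite [RHS](Hm q _ k)//; apply: agree_le pq; rewrite /n !leq_max leqnn orbT.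
by rewrite [RHS](Hm' q _ k)//; apply: agree_le pq; rewrite /n !leq_max leqnn !orbT.
Qed.

(* Otherwise a thin set Z0 kills all pairs of separated pieces, so that off Z0 the
   piece of s is function-like above the other pieces, hence thin itself. *)
Lemma large_split s l : large (s :: l) -> exists u u', splits s u u' /\ large (u :: u' :: l).
Proof.
move=> gs; apply: contrapT => H.
have /choice[Zf HZf] : forall uu : seq nat * seq nat, exists Z, thin Z /\
    (splits s uu.1 uu.2 -> ~ exists x, forall t, t \in uu.1 :: uu.2 :: l ->
      exists p, [/\ C p, cyl t p, bfst (f p) = x & ~ Z (f p)]).
  move=> [u u'] /=; have [sp|nsp] := pselect (splits s u u'); last first.
    by exists set0; split=> //; exact: thin0.
  have /existsNP[Z /not_implyP[tZ nx]] : ~ large (u :: u' :: l).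
    by move=> g; apply: H; exists u, u'.
  by exists Z.
pose Z0 : set baire := [set p | exists i, Zf i p].
have tZ0 : thin Z0 by apply: thin_bigcupc => i; case: (HZf i).
have aN : analytic [set y | ~ Z0 y].
  apply: BN_analytic; apply: (sal_not sBN (P := Z0)); exact: thin_BN.
have aP t : analytic (f @` (C `&` cyl t) `&` [set y | ~ Z0 y]).
  apply: param_setI aN; apply: analytic_image => //; apply: param_setI.
    exact: param_closed.
  exact: BN_analytic (BN_cyl t).
pose P t y := exists p, [/\ C p, cyl t p, f p = y & ~ Z0 y].
have PE t : (f @` (C `&` cyl t) `&` [set y | ~ Z0 y]) = P t.
  apply/seteqP; split=> [y [[p [Cp tp] <-] nZ]|y [p [Cp tp <- nZ]]]; first by exists p.
  by split=> //; exists p.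
pose Qn n := if n < size l then bfst @` P (nth [::] l n) else setT.
pose W := P s `&` bfst @^-1` [set x | forall n, Qn n x].
have aW : analytic W.
  apply: param_setI; first by rewrite -PE; exact: aP.
  apply: (@analytic_preimage bfst); first exact: bcont_reidx.
  apply: param_bigcap => n; rewrite /Qn; case: ifP => _.
    by apply: analytic_image; [exact: bcont_reidx|rewrite -PE; exact: aP].
  exact: param_closed.
have QnP x : (forall n, Qn n x) -> forall t, t \in l ->
    exists p, [/\ C p, cyl t p, bfst (f p) = x & ~ Z0 (f p)].
  move=> Qx t tl; have := Qx (index t l); rewrite /Qn index_mem tl nth_index//.
  by move=> [y [p [Cp tp fp nZ]] yx]; exists p; rewrite fp.
have fW : funlike W.
  move=> y y' [[p [Cp sp fpy nZy]] Qy] [[p' [Cp' sp' fpy' nZy']] Qy'] yy'.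
  rewrite -(bpair_surj y) -(bpair_surj y') yy'; congr bpair; apply: contrapT => ne.
  have [|u [u' [spl up up']]] := @separating_cyl s p p' Cp Cp' sp sp'.
    by rewrite fpy fpy'.
  have [_ /(_ spl)] := HZf (u, u'); apply; exists (bfst y) => t.
  have nZ z : ~ Z0 z -> ~ Zf (u, u') z by move=> nZz Zz; apply: nZz; exists (u, u').
  rewrite !inE => /or3P[/eqP ->|/eqP ->|tl].
  - by exists p; rewrite fpy; split=> //; apply: nZ.
  - by exists p'; rewrite fpy'; split=> //; apply: nZ.
  - by have [q [? ? ? /nZ ?]] := QnP _ Qy t tl; exists q.
have [D [BD fD WD]] := funlike_cover aW fW.
have [x Hx] := gs _ (thin_setU tZ0 (thin_funlike BD fD)).
have [p [Cp sp px /not_orP[nZ nD]]] := Hx s (mem_head _ _).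
apply: nD; apply: WD; split; first by exists p.
move=> n; rewrite /Qn; case: ifP => // nl.
have [|q [Cq tq qx /not_orP[nZq _]]] := Hx (nth [::] l n).
  by rewrite inE mem_nth ?orbT.
by exists (f q); [exists q|rewrite qx].
Qed.

Definition doubles (l l' : seq (seq nat)) := size l' = (size l).*2 /\
  forall i, i < size l -> splits (nth [::] l i) (nth [::] l' i.*2) (nth [::] l' i.*2.+1).

(** Words are split one at a time. Largeness is a joint property of a list, so the induction carries
    the words already produced in [l0]. *)
Lemma large_doubles l : large l -> exists l', large l' /\ doubles l l'.
Proof.
suff H l0 : large (l ++ l0) -> exists l', large (l' ++ l0) /\ doubles l l'.
  by have := H [::]; rewrite cats0 => /[apply] -[l' []]; rewrite cats0; exists l'.
elim: l l0 => [|s l IH] l0 gl; first by exists [::].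
have [u [u' [spl /large_sub gu]]] := large_split gl.
have [|l' [/large_sub gl' [sl' Hl']]] := IH (u :: u' :: l0).
  by apply: gu => t; rewrite !(inE, mem_cat); case/orP=> [->|/or3P[]->]; rewrite ?orbT.
exists (u :: u' :: l'); split; last first.
  by split=> [|[|i]]; rewrite /= ?sl'//; exact: Hl'.
apply: gl' => t; rewrite /= !(inE, mem_cat).
by case/or4P=> [->|->|->|->]; rewrite ?orbT.
Qed.

(** If no thin set covers the image, the list consisting of the empty word is large, and repeated
    doubling is a Cantor scheme. The pieces of each level have points above one first component,
    which in the limit is the same for all branches. *)
Theorem thin_or_perfect : (exists2 Z, thin Z & f @` C `<=` Z) \/
  exists x (io : (nat -> bool) -> baire),
    [/\ injective io, forall b, (f @` C) (io b) & forall b, bfst (io b) = x].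
Proof.
have [|nthin] := pselect (exists2 Z, thin Z & f @` C `<=` Z); first by left.
right; have g0 : large [:: [::]].
  move=> Z tZ; apply: contrapT => H; apply: nthin; exists Z => // _ [p Cp <-].
  apply: contrapT => nZ; apply: H; exists (bfst (f p)) => s.
  by rewrite inE => /eqP ->; exists p.
have [u [u0 Hu]] := dependent_choice_in large_doubles g0.
(* Position of branch [b] in level [n], its choices being read as binary digits. *)
pose idx (b : nat -> bool) := fix idx n := if n is m.+1 then b m + (idx m).*2 else 0.
have szu n : size (u n) = 2 ^ n.
  elim: n => [|n IH]; first by rewrite u0.
  by case: (Hu n) => _ [-> _]; rewrite IH expnS mul2n.
have idx_lt b n : idx b n < size (u n).
  rewrite szu; elim: n => //= n IH; rewrite expnS mul2n.
  by case: (b n); rewrite ?add1n ?add0n ?ltn_double// -doubleS leq_double.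
pose s b n := nth [::] (u n) (idx b n).
have spl b n : splits (s b n) (nth [::] (u n.+1) (idx b n).*2) (nth [::] (u n.+1) (idx b n).*2.+1).
  by case: (Hu n) => _ [_]; apply; exact: idx_lt.
have pre b n : prefix (s b n) (s b n.+1).
  by rewrite {2}/s /=; have [] := spl b n; case: (b n).
have sz b n : n <= size (s b n).
  elim: n => // n IH; apply: leq_ltn_trans IH _.
  by rewrite {2}/s /=; have [] := spl b n; case: (b n).
have ne b n : C `&` cyl (s b n) !=set0.
  have [gn _] := Hu n; have [x Hx] := gn _ thin0.
  by have [p [? ? _ _]] := Hx _ (mem_nth [::] (idx_lt b n)); exists p.
have /choice[p Hp] : forall b, exists p, forall n, cyl (s b n) p.
  by move=> b; exact: cyl_limit (pre b) (sz b).
have Cp b : C (p b) := bclosed_limit cC (sz b) (ne b) (Hp b).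
exists (bfst (f (p (fun=> true)))), (fun b => f (p b)); split.
- move=> b b' /= fbb; apply/funext; apply: contrapT => /existsNP ex.
  have {}ex : exists n, b n != b' n by case: ex => n /eqP; exists n.
  case: (ex_minnP ex) => m bm mmin.
  have idxE : idx b m = idx b' m.
    have agr i : i < m -> b i = b' i.
      by apply: contraTeq => /mmin; rewrite -leqNgt.
    elim: m agr {bm mmin} => //= m IH agr; rewrite IH ?agr// => i im.
    by apply: agr; apply: ltnW.
  have [_ _ _ _ [k [a [a' [aa' Ha Ha']]]]] := spl b m.
  have := Hp b m.+1; have := Hp b' m.+1; rewrite /s /= -idxE.
  case: (b m) (b' m) bm => [] [] // _ => [|] h h'.
    by apply: aa'; rewrite -(Ha _ _ h)// -(Ha' _ _ h')// fbb.
  by apply: aa'; rewrite -(Ha' _ _ h)// -(Ha _ _ h')// fbb.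
- by move=> b; exists (p b).
(* Branch [b] and the constant branch [b0] are compared at a level so deep that both images are
   determined up to [k]; there the two pieces have points over one [x]. *)
move=> b; apply: eq_agree => k.
have cg : bcont (bfst \o f) by apply: bcont_comp => //; exact: bcont_reidx.
set b0 := fun=> true.
have [m Hm] := cont_cyl k cg (sz b) (Hp b).
have [m' Hm'] := cont_cyl k cg (sz b0) (Hp b0).
pose n := maxn m m'; have [gn _] := Hu n; have [x Hx] := gn _ thin0.
have [q [_ sq qx _]] := Hx _ (mem_nth [::] (idx_lt b n)).
have [q0 [_ sq0 qx0 _]] := Hx _ (mem_nth [::] (idx_lt b0 n)).
apply: (agree_trans (Hm n (leq_maxl _ _) _ sq)) => /=; rewrite qx -qx0.
exact/agree_sym/(Hm' n (leq_maxr _ _) _ sq0).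
Qed.

End dichotomy.

(** * Edge colorings of finite bipartite graphs *)

Section finite_edge_colorings.
Variable X : eqType.
Implicit Types (K : X -> X -> Prop) (c : X -> X -> nat) (es : seq (X * X)).

Definition adj es (u v : X) : Prop := ((u, v) \in es) || ((v, u) \in es).

Definition deg_le K v m := forall s : seq X, uniq s -> {in s, forall w, K v w} -> size s <= m.

Definition proper_on K c := (forall u v, K u v -> c u v = c v u) /\
  (forall u v w, K u v -> K u w -> c u v = c u w -> v = w).

Lemma adj_sym es u v : adj es u v -> adj es v u.
Proof. by rewrite /adj orbC. Qed.

Lemma adj_cons x y es u v : adj ((x, y) :: es) u v <->
  (u = x /\ v = y) \/ (u = y /\ v = x) \/ adj es u v.
Proof.
rewrite /adj !inE !xpair_eqE orbACA; split.
  case/orP=> [/orP[/andP[/eqP -> /eqP ->]|/andP[/eqP -> /eqP ->]]|->]; [by left| |].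
    by right; left.
  by right; right.
by case=> [[-> ->]|[[-> ->]|->]]; rewrite ?eqxx ?orbT.
Qed.

Lemma deg_le_sub K K' v m : (forall w, K' v w -> K v w) -> deg_le K v m -> deg_le K' v m.
Proof. by move=> KK H s us Hs; apply: H us _ => w /Hs/KK. Qed.

(** Otherwise the neighbors of [v] along all [m] colors, together with [w], would be [m + 1]
    distinct neighbors in [K]. *)
Lemma missing_color K K' c v w m : (forall z, K' v z -> K v z) -> deg_le K v m ->
  K v w -> ~ K' v w -> exists2 a, a < m & forall z, K' v z -> c v z <> a.
Proof.
move=> KK Hm Kvw nK; apply: contrapT => H.
have /choice[nb Hnb] : forall a, exists z, a < m -> K' v z /\ c v z = a.
  move=> a; have [am|nam] := pselect (a < m); last by exists w.
  apply: contrapT => Hz; apply: H; exists a => // z K'z cz; apply: Hz.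
  by exists z.
suff : size (w :: map nb (iota 0 m)) <= m by rewrite /= size_map size_iota ltnn.
apply: Hm => [/=|z].
  apply/andP; split.
    by apply/mapP => -[a]; rewrite mem_iota /= add0n => /Hnb[H1 _] wa; apply: nK; rewrite wa.
  rewrite map_inj_in_uniq ?iota_uniq// => a b.
  by rewrite !mem_iota /= !add0n => /Hnb[_ ea] /Hnb[_ eb] e; rewrite -ea -eb e.
rewrite inE => /predU1P[->//|/mapP[a]]; rewrite mem_iota /= add0n => /Hnb[H1 _] ->.
exact: KK.
Qed.

Section kempe_chain.
Variables (K : X -> X -> Prop) (c : X -> X -> nat) (side : X -> bool) (x : X) (a b : nat).
Hypotheses (Ksym : forall u v, K u v -> K v u) (pc : proper_on K c)
  (bip : forall u v, K u v -> side u <> side v) (xa : forall z, K x z -> c x z <> a).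

(* The a/b-chain starting at x, traversed away from x. *)
Inductive kempe : X -> Prop :=
| kempe_root : kempe x
| kempe_b u v : kempe u -> side u = side x -> K u v -> c u v = b -> kempe v
| kempe_a u v : kempe u -> side u <> side x -> K u v -> c u v = a -> kempe v.

(** The chain alternates, so the side of a vertex other than [x] tells by which color it was
    entered: the other color continues the chain, the same color leads back. At [x] itself color [a]
    is missing. *)
Lemma kempe_closed u v : kempe u -> K u v -> c u v = a \/ c u v = b -> kempe v.
Proof.
have [csym cinj] := pc.
case=> [|z {}u kz sz Kzu czu|z {}u kz sz Kzu czu] Kuv.
- by case=> [/(xa Kuv)//|cb]; apply: kempe_b Kuv cb => //; exact: kempe_root.
- have su : side u <> side x by rewrite -sz => /esym; exact: bip.
  case=> cuv; first by apply: kempe_a cuv => //; apply: kempe_b czu.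
  by rewrite (cinj u v z) //; [exact: Ksym|rewrite cuv -csym].
- have su : side u = side x.
    by have := bip Kzu; move: sz; case: (side u) (side z) (side x) => [] [] [].
  case=> cuv; last by apply: kempe_b cuv => //; apply: kempe_a czu.
  by rewrite (cinj u v z) //; [exact: Ksym|rewrite cuv -csym].
Qed.

(** By parity, the chain enters a vertex on the side opposite to [x] only through an edge of color
    [b]. *)
Lemma kempe_not y : side y <> side x -> (forall z, K y z -> c y z <> b) -> ~ kempe y.
Proof.
have [csym _] := pc => sy yb ky; case: ky sy yb => [|u {}y ku su Kuy cuy|u {}y ku su Kuy cuy] sy yb.
- by case: sy.
- by apply: (yb u); [exact: Ksym|rewrite -csym].
- by have := bip Kuy; move: su sy; case: (side u) (side y) (side x) => [] [] [].
Qed.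

Definition swap_colors i := if i == a then b else if i == b then a else i.

Lemma swap_colors_inj : injective swap_colors.
Proof.
apply: inv_inj => i; rewrite /swap_colors.
by repeat (case: eqP => //; try congruence).
Qed.

Definition kempe_swap u v := if `[< kempe u >] then swap_colors (c u v) else c u v.

Lemma kempe_swap_proper : proper_on K kempe_swap.
Proof.
have [csym cinj] := pc; split=> [u v Kuv|u v w Kuv Kuw]; last first.
  by rewrite /kempe_swap; case: asboolP => _ => [/swap_colors_inj|]; exact: cinj.
have E p q : K p q -> kempe p -> ~ kempe q -> swap_colors (c p q) = c p q.
  move=> Kpq kp nkq; rewrite /swap_colors.
  case: eqP => [ca|_]; first by case: nkq; apply: kempe_closed Kpq _ => //; left.
  by case: eqP => [cb|//]; case: nkq; apply: kempe_closed Kpq _ => //; right.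
rewrite /kempe_swap -(csym _ _ Kuv); case: asboolP => ku; case: asboolP => kv //.
  exact: E.
by rewrite (csym _ _ Kuv) E//; exact: Ksym.
Qed.

End kempe_chain.

(** Edges are added one by one. With [a] missing at [x] and [b] at [y], exchanging the two colors on
    the chain from [x] makes [b] missing at [x]; bipartiteness keeps [y] off the chain, so [b] fits
    the new edge. *)
Theorem konig_edge_coloring (side : X -> bool) m es :
  (forall u v, adj es u v -> side u <> side v) -> (forall v, deg_le (adj es) v m) ->
  exists2 c, proper_on (adj es) c & forall u v, adj es u v -> c u v < m.
Proof.
elim: es => [|[x y] es IH] bip dm; first by exists (fun _ _ => 0).
have sub u v : adj es u v -> adj ((x, y) :: es) u v by move=> ?; apply/adj_cons; right; right.
have [||c pc cm] := IH.
- by move=> u v /sub; exact: bip.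
- by move=> v; apply: deg_le_sub (dm v) => w; exact: sub.
(* The pair may repeat an edge that is already listed, possibly reversed. *)
have [xy|nxy] := pselect (adj es x y).
  have E u v : adj ((x, y) :: es) u v -> adj es u v.
    by move=> /adj_cons[[-> ->]//|[[-> ->]|//]]; exact: adj_sym.
  case: pc => csym cinj; exists c; last by move=> u v /E; exact: cm.
  by split=> [u v /E/csym|u v w /E Kuv /E]; last exact: cinj.
have Kxy : adj ((x, y) :: es) x y by apply/adj_cons; left.
have Kyx : adj ((x, y) :: es) y x by apply/adj_cons; right; left.
have [a am xa] := missing_color c (sub x) (dm x) Kxy nxy.
have nyx : ~ adj es y x by move=> /adj_sym.
have [b bm yb] := missing_color c (sub y) (dm y) Kyx nyx.
have bip' u v : adj es u v -> side u <> side v by move=> /sub; exact: bip.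
pose c1 := kempe_swap (adj es) c side x a b.
have [c1sym c1inj] : proper_on (adj es) c1 := kempe_swap_proper b (@adj_sym es) pc bip' xa.
have c1m u v : adj es u v -> c1 u v < m.
  by move=> /cm cuv; rewrite /c1 /kempe_swap /swap_colors; do 3 case: ifP => // _.
have xb z : adj es x z -> c1 x z <> b.
  move=> Kxz; rewrite /c1 /kempe_swap asboolT; last exact: kempe_root.
  rewrite /swap_colors; case: eqP => [/(xa _ Kxz)//|ca].
  by case: eqP => [cb ab|//]; apply: ca; rewrite cb ab.
have {}yb z : adj es y z -> c1 y z <> b.
  move=> Kyz; rewrite /c1 /kempe_swap asboolF; first exact: yb.
  by apply: kempe_not => //; [exact: adj_sym|exact/nesym/bip].
pose c2 u v := if ((u == x) && (v == y)) || ((u == y) && (v == x)) then b else c1 u v.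
have c2P u v : adj ((x, y) :: es) u v ->
    (u = x /\ v = y \/ u = y /\ v = x) /\ c2 u v = b \/
    adj es u v /\ c2 u v = c1 u v.
  move=> Kuv; rewrite /c2; case: ifP => [H|H].
    left; split=> //; case/orP: H => /andP[/eqP -> /eqP ->]; [by left|by right].
  right; split=> //; move: H; case/adj_cons: Kuv => [[-> ->]|[[-> ->]|//]].
    by rewrite !eqxx.
  by rewrite !eqxx orbT.
exists c2; last by move=> u v /c2P[[_ ->//]|[/c1m + ->]].
split=> [u v Kuv|u v w /c2P[[H ->]|[Kuv ->]] /c2P[[H' ->]|[Kuw ->]]].
- move: (c2P _ _ Kuv) (c2P _ _ (adj_sym Kuv)) => [[H ->]|[Kuv' ->]] [[H' ->]|[Kvu ->]] //.
  + by case: H Kvu => [[-> ->] /nyx|[-> ->] /nxy].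
  + by case: H' Kuv' => [[-> ->] /nyx|[-> ->] /nxy].
  + exact: c1sym.
- case: H H' => [[-> ->]|[-> ->]] [[e ->]|[e ->]] //;
    by have := bip _ _ Kxy; rewrite e => /(_ erefl).
- by move=> e; case: H Kuw e => [[-> _]|[-> _]] => [/xb H /esym|/yb H /esym].
- by move=> e; case: H' Kuv e => [[-> _]|[-> _]] => [/xb H|/yb H].
- exact: c1inj.
Qed.

(* Colors are used from the largest one down: a color class m only needs to reduce
   the vertices of degree m + 1, all of whose neighbors have capacity at least m. *)
Theorem capacity_edge_coloring (side : X -> bool) (kap : X -> nat) m es :
  (forall u v, adj es u v -> side u <> side v) ->
  (forall v, deg_le (adj es) v (kap v)) -> (forall v, deg_le (adj es) v m.+1) ->
  (forall u v, adj es u v -> kap u <= (kap v).+1) ->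
  exists2 c, proper_on (adj es) c &
    forall u v, adj es u v -> [/\ c u v <= kap u, c u v <= kap v & c u v <= m].
Proof.
elim: m es => [|m IH] es bip dk dm lip.
  exists (fun _ _ => 0) => //; split=> // u v w Kuv Kuw _.
  apply/eqP/contraT => vw; suff : size [:: v; w] <= 1 by [].
  apply: (dm u) => [|z]; first by rewrite /= inE vw.
  by rewrite !inE => /orP[/eqP ->|/eqP ->].
have [c0 [c0sym c0inj] c0m] := konig_edge_coloring bip dm.
pose full v := exists s : seq X, [/\ uniq s, size s = m.+2 & {in s, forall w, adj es v w}].
(* The edges of one class of a Koenig coloring with [m + 2] colors that meet a vertex of full degree
   [m + 2]. They receive color [m + 1]. *)
pose M u v := adj es u v /\ c0 u v = 0 /\ (full u \/ full v).
have Msym u v : M u v -> M v u.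
  move=> [Kuv [c0uv H]]; split; first exact: adj_sym.
  by rewrite -c0sym//; split=> //; case: H; [right|left].
pose es' := [seq e <- es | ~~ `[< M e.1 e.2 >]].
have es'P u v : adj es' u v <-> adj es u v /\ ~ M u v.
  rewrite /adj !mem_filter /=; split.
    case/orP=> /andP[/asboolP nM ->]; rewrite ?orbT; split=> //.
    by move=> /Msym.
  case=> /orP[->|->] nM; apply/orP; [left|right]; rewrite andbT; apply/asboolP => //.
  by move=> /Msym.
have sub u v : adj es' u v -> adj es u v by move=> /es'P[].
have [||||c [csym cinj] cm] := IH es'.
- by move=> u v /sub; exact: bip.
- by move=> v; apply: deg_le_sub (dk v) => w; exact: sub.
- move=> v s us Hs; rewrite leqNgt; apply/negP => ms.
  have sK : {in s, forall w, adj es v w} by move=> w /Hs/sub.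
  have sm : size s = m.+2 by apply/eqP; rewrite eqn_leq ms andbT; apply: dm us sK.
  (* A vertex with [m + 2] remaining edges would see all [m + 2] colors, among them 0, whose edge
     was removed. *)
  suff /mapP[w ws cw] : 0 \in map (c0 v) s.
    have /es'P[Kvw] := Hs _ ws; apply; split=> //; split=> //.
    by left; exists s.
  have ucs : uniq (map (c0 v) s).
    by rewrite map_inj_in_uniq// => w z /sK Kw /sK Kz; exact: c0inj.
  have [||_ ->] := uniq_min_size ucs (s2 := iota 0 m.+2).
  - by move=> _ /mapP[w /sK/c0m cw ->]; rewrite mem_iota.
  - by rewrite size_iota size_map sm.
  - by rewrite mem_iota.
- by move=> u v /sub; exact: lip.
pose c' u v := if `[< M u v >] then m.+1 else c u v.
have c'P u v : adj es u v -> M u v /\ c' u v = m.+1 \/ adj es' u v /\ c' u v = c u v.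
  by move=> Kuv; rewrite /c'; case: asboolP => [|nM]; [left|right; split=> //; apply/es'P].
exists c'; last first.
  move=> u v /c'P[[[Kuv [_ H]] ->]|[/cm[? ? /leqW ?] -> //]].
  (* The full endpoint has capacity at least [m + 2], so the other one has at least [m + 1], and
     color [m + 1] respects both. *)
  have vu := lip _ _ Kuv; have uv := lip _ _ (adj_sym Kuv).
  by case: H => -[s [us sm /(dk _ _ us)]]; rewrite sm => ?; split; lia.
split=> [u v Kuv|u v w /c'P[[[Kuv [e _]] ->]|[Kuv ->]] /c'P[[[Kuw [e' _]] ->]|[Kuw ->]]].
- case: (c'P _ _ Kuv) => [[Muv ->]|[Kuv' ->]]; rewrite /c'.
    by rewrite asboolT//; exact: Msym.
  by rewrite asboolF; [exact: csym|move=> /Msym; case/es'P: Kuv'].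
- by move=> _; apply: c0inj Kuv Kuw _; rewrite e e'.
- by move=> e2; have [_ _] := cm _ _ Kuw; rewrite -e2 ltnn.
- by move=> e2; have [_ _] := cm _ _ Kuv; rewrite e2 ltnn.
- exact: cinj.
Qed.

End finite_edge_colorings.

(** * Borel colorings of graphs generated by countably many maps *)

Section least.
Implicit Types P : nat -> Prop.

Definition least P : nat :=
  if pselect (exists n, `[< P n >]) is left ex then ex_minn ex else 0.

Lemma least_spec P : (exists n, P n) -> P (least P).
Proof.
move=> [n Pn]; rewrite /least; case: pselect => [ex|[]].
  by case: ex_minnP => m /asboolP.
by exists n; apply/asboolP.
Qed.

Lemma leastE P i : least P = i <->
  (P i /\ forall j, j < i -> ~ P j) \/ (i = 0 /\ forall j, ~ P j).
Proof.
rewrite /least; case: pselect => [ex|nex].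
  case: ex_minnP => m /asboolP Pm mmin; split=> [<-|[[Pi imin]|[_ /(_ m)]//]].
    left; split=> // j jm Pj; have /mmin : `[< P j >] by apply/asboolP.
    by rewrite leqNgt jm.
  apply/eqP; rewrite eqn_leq mmin /=; last exact/asboolP.
  by rewrite leqNgt; apply/negP => /imin.
have nP j : ~ P j by move=> Pj; apply: nex; exists j; apply/asboolP.
by split=> [<-|[[/nP]//|[]//]]; right.
Qed.

Lemma least_le P n : P n -> least P <= n.
Proof.
move=> Pn; have /leastE[[_ H]|[-> //]] := erefl (least P).
by rewrite leqNgt; apply/negP => /H.
Qed.

Lemma sal_least (T : Type) (B : set (set T)) (P : T -> nat -> Prop) i :
  sigma_algebra setT B -> (forall j, B [set x | P x j]) -> B [set x | least (P x) = i].
Proof.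
move=> sB BP; apply: (@sal_iff _ B (fun x =>
    (P x i /\ forall j, j < i -> ~ P x j) \/ (i = 0 /\ forall j, ~ P x j))).
  by move=> x; split=> /leastE.
apply: (sal_or sB); apply: (sal_and sB) => //; try exact: (sal_cst sB).
  by apply: (sal_all sB) => j; apply: (sal_imp sB); [exact: (sal_cst sB)|exact: (sal_not sB)].
by apply: (sal_all sB) => j; exact: (sal_not sB).
Qed.

End least.

Section paths.
Variable X : Type.
Implicit Types (Q : X -> X -> Prop).

Fixpoint steps Q n x y := if n is m.+1 then exists z, Q x z /\ steps Q m z y else x = y.

Definition reach Q x y := exists n, steps Q n x y.

Lemma steps_cat Q m n x y z : steps Q m x y -> steps Q n y z -> steps Q (m + n) x z.
Proof.
elim: m x => [x ->//|m IH x [t [xt ty]] yz].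
by exists t; split=> //; exact: IH.
Qed.

Lemma steps_sym Q n x y : (forall u v, Q u v -> Q v u) -> steps Q n x y -> steps Q n y x.
Proof.
move=> Qs; elim: n x y => [x y ->//|n IH x y [t [xt ty]]].
rewrite -addn1; apply: (steps_cat (IH _ _ ty)); exists x; split=> //; exact: Qs.
Qed.

Lemma reach_refl Q x : reach Q x x. Proof. by exists 0. Qed.

Lemma reach1 Q x y : Q x y -> reach Q x y.
Proof. by move=> H; exists 1, y. Qed.

Lemma reach_trans Q y x z : reach Q x y -> reach Q y z -> reach Q x z.
Proof. by move=> [m xy] [n yz]; exists (m + n); exact: steps_cat xy yz. Qed.

Lemma reach_sym Q x y : (forall u v, Q u v -> Q v u) -> reach Q x y -> reach Q y x.
Proof. by move=> Qs [n xy]; exists n; exact: steps_sym. Qed.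

Lemma reach_ind Q (P : X -> Prop) x y : reach Q x y -> P x ->
  (forall u v, reach Q x u -> P u -> Q u v -> P v) -> P y.
Proof.
move=> [n xy] Px H; have := reach_refl Q x.
elim: n {-3}x xy Px => [z <-//|n IH z [t [zt ty]] Pz xz].
apply: (IH t) => //; first exact: H zt.
exact: reach_trans xz (reach1 zt).
Qed.

Lemma reach_mono Q Q' x y : (forall u v, Q u v -> Q' u v) -> reach Q x y -> reach Q' x y.
Proof.
move=> QQ xy; apply: (reach_ind xy); first exact: reach_refl.
by move=> u v _ xu /QQ uv; exact: reach_trans xu (reach1 uv).
Qed.

End paths.

Section countable_borel_graph.
Variables (X : eqType) (B : set (set X)) (g : nat -> X -> X) (E : X -> X -> Prop)
  (h : X -> baire).
Hypotheses (sB : sigma_algebra setT B) (gB : forall n A, B A -> B (g n @^-1` A))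
  (Esym : forall x y, E x y -> E y x)
  (Eg : forall x y, E x y <-> x <> y /\ exists n, y = g n x)
  (h_inj : injective h) (hB : forall k a, B [set x | h x k = a]).

Definition act (w : seq nat) x := foldr g x w.

Lemma act_cat u v x : act (u ++ v) x = act u (act v x).
Proof. by rewrite /act foldr_cat. Qed.

Definition conn x y := exists w, y = act w x.

Lemma conn_act w x : conn x (act w x). Proof. by exists w. Qed.

Lemma conn_refl x : conn x x. Proof. by exists [::]. Qed.

Lemma conn_trans y x z : conn x y -> conn y z -> conn x z.
Proof. by move=> [u ->] [v ->]; exists (v ++ u); rewrite act_cat. Qed.

Lemma E_conn x y : E x y -> conn x y.
Proof. by move=> /Eg[_ [n ->]]; exists [:: n]. Qed.

(** A generator either fixes a point or moves it along an edge, and edges can be walked back. *)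
Lemma conn_sym x y : conn x y -> conn y x.
Proof.
move=> [w ->] {y}; elim: w => [|n w IH] /=; first exact: conn_refl.
apply: conn_trans IH; have [e|ne] := eqVneq (act w x) (g n (act w x)).
  by rewrite -e; exact: conn_refl.
by apply/E_conn/Esym/Eg; split; [exact/eqP|exists n].
Qed.

Lemma connP x y : conn x y <-> reach E x y.
Proof.
split=> [[w ->] {y}|H]; last first.
  apply: (reach_ind H); first exact: conn_refl.
  by move=> u v _ xu /E_conn; exact: conn_trans.
elim: w => [|n w IH] /=; first exact: reach_refl.
have [<-//|ne] := eqVneq (act w x) (g n (act w x)).
by apply: reach_trans IH _; apply: reach1; apply/Eg; split; [exact/eqP|exists n].
Qed.

Lemma B_act w A : B A -> B (act w @^-1` A).
Proof. by elim: w A => //= n w IH A BA; apply: (IH (g n @^-1` A)); exact: gB. Qed.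

Lemma B_eq u v : B [set x | act u x = act v x].
Proof.
apply: (@sal_iff _ B (fun x => forall k, exists a, h (act u x) k = a /\ h (act v x) k = a)).
  move=> x; split=> [H|-> k]; last by exists (h (act v x) k).
  by apply: h_inj; apply/funext => k; have [a [-> ->]] := H k.
apply: (sal_all sB) => k; apply: (sal_ex sB) => a.
by apply: (sal_and sB); exact: (B_act _ (hB k a)).
Qed.

Lemma B_E u v : B [set x | E (act u x) (act v x)].
Proof.
apply: (@sal_iff _ B (fun x => act u x <> act v x /\ exists n, act v x = act (n :: u) x)).
  by move=> x; rewrite Eg.
apply: (sal_and sB); first exact: (sal_not sB (B_eq u v)).
by apply: (sal_ex sB) => n; exact: B_eq.
Qed.

(** The points related to [x] lie in its component, which the countably many words enumerate, so the
    quantifier is a countable union. *)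
Lemma B_ex (P : X -> X -> Prop) : (forall x y, P x y -> conn x y) ->
  (forall w, B [set x | P x (act w x)]) -> B [set x | exists y, P x y].
Proof.
move=> Pc BP; apply: (@sal_iff _ B (fun x => exists w, P x (act w x))).
  move=> x; split=> [[w Pw]|[y Py]]; first by exists (act w x).
  by have [w e] := Pc _ _ Py; exists w; rewrite -e.
exact: (sal_exc sB).
Qed.

Lemma B_all (P : X -> X -> Prop) : (forall x y, ~ P x y -> conn x y) ->
  (forall w, B [set x | P x (act w x)]) -> B [set x | forall y, P x y].
Proof.
move=> Pc BP; apply: (@sal_iff _ B (fun x => ~ exists y, ~ P x y)).
  by move=> x; split=> [/forallNP H n|H [n]]; [apply: contrapT; exact: H|].
by apply/(sal_not sB)/B_ex => // w; exact: (sal_not sB).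
Qed.

Lemma B_steps (Q : X -> X -> X -> Prop) : (forall x y z, Q x y z -> conn y z) ->
  (forall u v, B [set x | Q x (act u x) (act v x)]) ->
  forall n u v, B [set x | steps (Q x) n (act u x) (act v x)].
Proof.
move=> Qc BQ; elim=> [|n IH] u v; first exact: B_eq.
apply: (B_ex (P := fun x z => Q x (act u x) z /\ steps (Q x) n z (act v x))).
  by move=> x y [/Qc + _]; apply: conn_trans; exact: conn_act.
by move=> w; apply: (sal_and sB).
Qed.

Lemma B_reach (Q : X -> X -> X -> Prop) : (forall x y z, Q x y z -> conn y z) ->
  (forall u v, B [set x | Q x (act u x) (act v x)]) ->
  forall u v, B [set x | reach (Q x) (act u x) (act v x)].
Proof. by move=> Qc BQ u v; apply: (sal_ex sB) => n; exact: B_steps. Qed.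

(** * Coloring a graph whose components have Borel roots *)

Section smooth.
Variables (H Rt : X -> X -> Prop) (al : nat -> X -> X -> Prop) (k : nat).
Hypotheses (Hsym : forall x y, H x y -> H y x) (Hconn : forall x y, H x y -> conn x y)
  (HB : forall u v, B [set x | H (act u x) (act v x)])
  (RtB : forall u v, B [set x | Rt (act u x) (act v x)])
  (Rtconn : forall x r, Rt x r -> conn x r)
  (RtH : forall x y r, H x y -> Rt x r -> Rt y r)
  (Rtex : forall x y, H x y -> exists r, Rt x r)
  (Rtinj : forall x r r', Rt x r -> Rt x r' -> r = r')
  (alB : forall i u v, B [set x | al i (act u x) (act v x)])
  (fin : forall es, (forall u v, adj es u v -> H u v) -> exists2 c, proper_on (adj es) c &
     forall u v, adj es u v -> c u v < k /\ al (c u v) u v).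

Let w1 n := (odflt ([::], [::]) (unpickle n : option (seq nat * seq nat))).1.
Let w2 n := (odflt ([::], [::]) (unpickle n : option (seq nat * seq nat))).2.
Let e1 n r := act (w1 n) r.
Let e2 n r := act (w2 n) r.
Let Er n r := H (e1 n r) (e2 n r) /\ Rt (e1 n r) r.

Let ok r n m (i j : nat) := Er n r -> Er m r ->
  [/\ i < k /\ al i (e1 n r) (e2 n r),
      e1 n r = e2 m r -> e2 n r = e1 m r -> i = j &
      e1 n r = e1 m r -> (e2 n r = e2 m r <-> i = j)].

Let valid r (s : seq nat) :=
  forall n m, n < size s -> m < size s -> ok r n m (nth 0 s n) (nth 0 s m).

(** Extendibility to every finite length stands for an infinite valid extension. Indices naming no
    edge carry free labels; the bound makes the tree finitely branching, and it is [k] included so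
    that the default label 0 is allowed even when [k] is 0. *)
Let ext r (s : seq nat) := forall m, exists t,
  [/\ size t = size s + m, prefix s t, all (fun i => i <= k) t & valid r t].

Let edge_ex x y r : H x y -> Rt x r -> exists n, [/\ e1 n r = x, e2 n r = y & Er n r].
Proof.
move=> Hxy xr; have /conn_sym rx := Rtconn xr.
have ry : conn r y := conn_trans rx (Hconn Hxy).
case: rx ry => u xu [v yv]; exists (pickle (u, v)).
by rewrite /Er /e1 /e2 /w1 /w2 pickleK /= -xu -yv.
Qed.

Let ext_nil r : ext r [::].
Proof.
move=> m; pose es := [seq (e1 n r, e2 n r) | n <- iota 0 m & `[< Er n r >]].
have esP n : n < m -> Er n r -> adj es (e1 n r) (e2 n r).
  move=> nm En; apply/orP; left; apply/mapP; exists n => //.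
  by rewrite mem_filter mem_iota /= add0n nm andbT; apply/asboolP.
have esH u v : adj es u v -> H u v.
  move=> /orP[] /mapP[n]; rewrite mem_filter => /andP[/asboolP[Hn _] _] [-> ->] //.
  exact: Hsym.
have [c [csym cinj] ck] := fin esH.
pose l n := if `[< Er n r >] then c (e1 n r) (e2 n r) else 0.
have lE n : Er n r -> l n = c (e1 n r) (e2 n r) by move=> En; rewrite /l asboolT.
exists (mkseq l m); rewrite size_mkseq prefix0s; split=> //.
  apply/allP => i /mapP[n]; rewrite mem_iota /= => nm ->.
  by rewrite /l; case: asboolP => // /(esP _ nm)/ck[/ltnW].
move=> n n'; rewrite size_mkseq => nm nm'; rewrite !nth_mkseq// => En En'.
have Kn := esP _ nm En; have Kn' := esP _ nm' En'; rewrite !lE//; split.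
- exact: ck.
- by move=> -> ->; apply/esym/csym.
move=> e; rewrite e in Kn *; split=> [-> //|]; exact: cinj.
Qed.

Let valid_prefix r s t : prefix s t -> valid r t -> valid r s.
Proof.
move=> /prefixP[u ->] vt n m ns ms.
have := vt n m; rewrite !nth_cat ns ms size_cat; apply.
  by rewrite (leq_trans ns) ?leq_addr.
by rewrite (leq_trans ms) ?leq_addr.
Qed.

(** Koenig's lemma: if each label [i] failed at some length [m i], an extension of [s] beyond the
    largest of these lengths could not exist. *)
Let ext_rcons r s : ext r s -> exists i, ext r (rcons s i).
Proof.
move=> es; apply: contrapT => nex.
have /choice[m Hm] : forall i, exists m, ~ exists t,
    [/\ size t = size (rcons s i) + m, prefix (rcons s i) t, all (fun i => i <= k) t & valid r t].
  by move=> i; apply/existsNP => H'; apply: nex; exists i.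
pose M := \max_(i < k.+1) m i.
have [t [st /prefixP[u tu] allt vt]] := es M.+1.
have [i u' uE] : exists2 i, exists u', u = i :: u' & i <= k.
  case: u tu => [|i u'] tu.
    by move/eqP: st; rewrite tu size_cat /= eqn_add2l.
  exists i; first by exists u'.
  by move/allP: allt; apply; rewrite tu mem_cat mem_head orbT.
case: u' => u' u'E in uE tu; rewrite u'E in tu.
have miM : m i <= M by have := @leq_bigmax _ (fun i : 'I_k.+1 => m i) (Ordinal (uE : i < k.+1)).
apply: (Hm i); exists (take (size (rcons s i) + m i) t).
have tE : t = rcons s i ++ u' by rewrite tu cat_rcons.
have le : size (rcons s i) + m i <= size t.
  by rewrite st size_rcons addSn -addnS leq_add2l.
split.
- by rewrite size_takel.
- apply/prefixP; exists (take (m i) u'); rewrite tE take_cat.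
  by rewrite ltnNge leq_addr /= addnC addnK.
- by apply/allP => j /mem_take jt; move/allP: allt; apply.
- by apply: valid_prefix vt; exact: prefix_take.
Qed.

Let lft r := fix lft n : seq nat :=
  if n is m.+1 then rcons (lft m) (least (fun i => ext r (rcons (lft m) i))) else [::].

Let lft_ext r n : ext r (lft r n).
Proof. by elim: n => [|n /ext_rcons /least_spec]; first exact: ext_nil. Qed.

Let size_lft r n : size (lft r n) = n.
Proof. by elim: n => //= n IH; rewrite size_rcons IH. Qed.

Let lab r n := nth 0 (lft r n.+1) n.

Let labE r n N : n < N -> nth 0 (lft r N) n = lab r n.
Proof.
elim: N => // N IH; rewrite ltnS leq_eqVlt => /predU1P[->//|nN].
by rewrite /= nth_rcons size_lft nN IH.
Qed.

Let lab_ok r n m : ok r n m (lab r n) (lab r m).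
Proof.
have [t [_ pt _ /(valid_prefix pt) vt]] := lft_ext r (maxn n m).+1 0.
by have := vt n m; rewrite size_lft !ltnS leq_maxl leq_maxr !labE ?ltnS ?leq_maxl ?leq_maxr//; apply.
Qed.

Let B_Er n : B [set r | Er n r].
Proof. by apply: (sal_and sB); [exact: HB|exact: (RtB (w1 n) [::])]. Qed.

Let B_ext s : B [set r | ext r s].
Proof.
apply: (sal_all sB) => m; apply: (sal_exc sB) => t.
apply: (@sal_iff _ B (fun r => (size t = size s + m /\ prefix s t /\ all (fun i => i <= k) t)
    /\ valid r t)); first by move=> r; split=> [[[? []]]|[]].
apply: (sal_and sB); first exact: (sal_cst sB).
apply: (sal_all sB) => n; apply: (sal_all sB) => n'.
do 2 (apply: (sal_imp sB); first exact: (sal_cst sB)).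
do 2 (apply: (sal_imp sB); first exact: B_Er).
set i := nth 0 t n; set j := nth 0 t n'.
apply: (@sal_iff _ B (fun r => (i < k /\ al i (e1 n r) (e2 n r)) /\
    (e1 n r = e2 n' r -> e2 n r = e1 n' r -> i = j) /\
    (e1 n r = e1 n' r -> (e2 n r = e2 n' r <-> i = j)))).
  by move=> r; split=> [[? []]|[]].
apply: (sal_and sB); first by apply: (sal_and sB); [exact: (sal_cst sB)|exact: alB].
apply: (sal_and sB).
  by do 2 (apply: (sal_imp sB); first exact: B_eq); exact: (sal_cst sB).
apply: (sal_imp sB); first exact: B_eq.
by apply: (sal_equiv sB); [exact: B_eq|exact: (sal_cst sB)].
Qed.

Let B_lft n s : B [set r | lft r n = s].
Proof.
elim: n s => [|n IH] s; first exact: (sal_cst sB ([::] = s)).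
case/lastP: s => [|s i].
  apply: (@sal_iff _ B (fun=> False)); last exact: (sal_cst sB).
  by move=> r; split=> // /(congr1 size) /=; rewrite size_rcons.
apply: (@sal_iff _ B (fun r => lft r n = s /\ least (fun i => ext r (rcons s i)) = i)).
  move=> r /=; split=> [[<- <-]//|/rcons_inj[<- <-]//].
by apply: (sal_and sB) => //; apply: (sal_least _ sB) => j; exact: B_ext.
Qed.

Let B_lab n i : B [set r | lab r n = i].
Proof.
apply: (@sal_iff _ B (fun r => exists s, lft r n.+1 = s /\ nth 0 s n = i)).
  by move=> r; split=> [[s [<-]]|<-] //; exists (lft r n.+1).
by apply: (sal_exc sB) => s; apply: (sal_and sB); [exact: B_lft|exact: (sal_cst sB)].
Qed.

(* The root of a component selects its leftmost valid coloring along an enumeration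
   of its edges; existence of extensions is Borel by compactness. *)
Theorem smooth_coloring : exists c, [/\ proper_on H c,
  forall u v, H u v -> c u v < k /\ al (c u v) u v &
  forall i u v, B [set x | H (act u x) (act v x) /\ c (act u x) (act v x) = i]].
Proof.
(* An edge is colored by the label of any of its names; validity makes all names agree. *)
pose P x y i := exists r n, [/\ Rt x r, e1 n r = x, e2 n r = y & lab r n = i].
pose c x y := least (P x y).
have cE x y r n : H x y -> Rt x r -> e1 n r = x -> e2 n r = y -> c x y = lab r n.
  move=> Hxy xr e1n e2n.
  have [r' [m [xr' e1m e2m <-]]] : P x y (c x y).
    by apply: least_spec; exists (lab r n), r, n.
  have rr := Rtinj xr' xr; rewrite rr in e1m e2m *.
  have En : Er n r by rewrite /Er e1n e2n.
  have Em : Er m r by rewrite /Er e1m e2m.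
  by have [_ _] := @lab_ok r m n Em En; rewrite e1m e1n e2m e2n => /(_ erefl)[] ->.
exists c; split; first split.
- move=> u v Huv; have [r ur] := Rtex Huv; have vr := RtH Huv ur.
  have [n [e1n e2n En]] := edge_ex Huv ur.
  have [m [e1m e2m Em]] := edge_ex (Hsym Huv) vr.
  rewrite (cE _ _ _ _ Huv ur e1n e2n) (cE _ _ _ _ (Hsym Huv) vr e1m e2m).
  by have [_ + _] := @lab_ok r n m En Em; apply; rewrite ?e1n ?e2n ?e1m ?e2m.
- move=> u v w Huv Huw; have [r ur] := Rtex Huv.
  have [n [e1n e2n En]] := edge_ex Huv ur; have [m [e1m e2m Em]] := edge_ex Huw ur.
  rewrite (cE _ _ _ _ Huv ur e1n e2n) (cE _ _ _ _ Huw ur e1m e2m).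
  by have [_ _] := @lab_ok r n m En Em; rewrite e1n e1m e2n e2m => /(_ erefl)[].
- move=> u v Huv; have [r ur] := Rtex Huv.
  have [n [e1n e2n En]] := edge_ex Huv ur; rewrite (cE _ _ _ _ Huv ur e1n e2n).
  by have [+ _ _] := @lab_ok r n n En En; rewrite e1n e2n.
move=> i u v; apply: (@sal_iff _ B (fun x => H (act u x) (act v x) /\ exists r,
    Rt (act u x) r /\ exists n, e1 n r = act u x /\ e2 n r = act v x /\ lab r n = i)).
  move=> x; split=> [[Huv [r [ur [n [e1n [e2n li]]]]]]|[Huv ci]]; split=> //.
    by rewrite (cE _ _ _ _ Huv ur e1n e2n).
  have [r ur] := Rtex Huv; have [n [e1n e2n En]] := edge_ex Huv ur.
  exists r; split=> //; exists n; split=> //; split=> //.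
  by rewrite -(cE _ _ _ _ Huv ur e1n e2n).
apply: (sal_and sB) => //; apply: B_ex => [x r [/Rtconn + _]|w].
  by apply: conn_trans; exact: conn_act.
apply: (sal_and sB) => //; apply: (sal_ex sB) => n.
have E1 := B_eq (w1 n ++ w) u; have E2 := B_eq (w2 n ++ w) v.
apply: (sal_and sB); first by apply: (sal_iff _ E1) => x; rewrite act_cat.
apply: (sal_and sB); first by apply: (sal_iff _ E2) => x; rewrite act_cat.
exact: (B_act w (B_lab n i)).
Qed.

End smooth.

(** * Finite sets, the order of codes, and graphs with finite components *)

Definition listed (T : eqType) (A : T -> Prop) := exists s : seq T, forall y, A y -> y \in s.

Lemma listed_sub (T : eqType) (A A' : T -> Prop) :
  (forall y, A' y -> A y) -> listed A -> listed A'.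
Proof. by move=> AA [s Hs]; exists s => y /AA/Hs. Qed.

Lemma listed_bigU (T T' : eqType) (A : T -> Prop) (R : T -> T' -> Prop) :
  listed A -> (forall a, A a -> listed (R a)) -> listed (fun y => exists2 a, A a & R a y).
Proof.
move=> [s Hs] HR; have /choice[f Hf] : forall a, exists t : seq T', A a -> forall y, R a y -> y \in t.
  by move=> a; have [/HR[t Ht]|nA] := pselect (A a); [exists t|exists [::]].
exists (flatten [seq f a | a <- s]) => y [a Aa Ray]; apply/flatten_mapP.
by exists a; [exact: Hs|exact: Hf].
Qed.

Lemma listed_or (T : eqType) (A A' : T -> Prop) :
  listed A -> listed A' -> listed (fun y => A y \/ A' y).
Proof.
move=> [s Hs] [t Ht]; exists (s ++ t) => y; rewrite mem_cat.
by case=> [/Hs ->//|/Ht ->]; rewrite orbT.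
Qed.

Lemma listedP (T : eqType) (A : T -> Prop) : listed A ->
  exists s : seq T, A = (fun u => u \in s).
Proof.
move=> [s Hs]; exists [seq u <- s | `[< A u >]]; apply/funext => u; apply/propext.
by rewrite mem_filter; split=> [Au|/andP[/asboolP]//]; rewrite Hs// andbT; apply/asboolP.
Qed.

Definition lex x y := exists k, (forall j, j < k -> h x j = h y j) /\ h x k < h y k.

Lemma lex_trans y x z : lex x y -> lex y z -> lex x z.
Proof.
move=> [k [Hk xk]] [l [Hl yl]]; exists (minn k l); split.
  by move=> j; rewrite leq_min => /andP[/Hk -> /Hl ->].
case: (ltngtP k l) => [kl|lk|kl]; first by rewrite -(Hl _ kl).
  by rewrite (Hk _ lk).
by rewrite kl in xk *; exact: ltn_trans yl.
Qed.

Lemma lex_irr x : ~ lex x x.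
Proof. by move=> [k [_]]; rewrite ltnn. Qed.

Lemma lex_total x y : x <> y -> lex x y \/ lex y x.
Proof.
move=> xy; have ex : exists k, h x k != h y k.
  apply: contrapT => H; apply: xy; apply: h_inj; apply/funext => k.
  by apply/eqP/contraT => ne; case: H; exists k.
have agr j : j < ex_minn ex -> h x j = h y j.
  by case: ex_minnP => k _ kmin jk; apply/eqP/contraT => /kmin; rewrite leqNgt jk.
case: ex_minnP agr => k; rewrite neq_ltn => /orP[lt|lt] _ agr; first by left; exists k.
by right; exists k; split=> // j /agr.
Qed.

Definition lexmin (A : X -> Prop) r := A r /\ forall y, A y -> y = r \/ lex r y.

Lemma lexmin_inj A r r' : lexmin A r -> lexmin A r' -> r = r'.
Proof.
move=> [Ar Hr] [Ar' Hr']; have [//|rr'] := Hr' _ Ar; have [//|r'r] := Hr _ Ar'.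
by case: (@lex_irr r); exact: lex_trans rr'.
Qed.

Lemma lexmin_ex A x : listed A -> A x -> exists r, lexmin A r.
Proof.
move=> [s Hs] Ax; suff [r [Ar Hr]] : exists r, A r /\ forall y, y \in s -> A y -> y = r \/ lex r y.
  by exists r; split=> // y Ay; apply: Hr => //; exact: Hs.
elim: s {Hs} => [|z s [r [Ar Hr]]]; first by exists x.
have [[Az zr]|H] := pselect (A z /\ lex z r).
  exists z; split=> // y; rewrite inE => /predU1P[->|/Hr H /H[->|ry]]; first by left.
    by right.
  by right; exact: lex_trans ry.
exists r; split=> // y; rewrite inE => /predU1P[-> Az|]; last exact: Hr.
have [->|/lex_total[zr|]] := pselect (z = r); [by left|by case: H|by right].
Qed.

Lemma B_lex u v : B [set x | lex (act u x) (act v x)].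
Proof.
apply: (sal_ex sB) => k; apply: (sal_and sB).
  apply: (sal_all sB) => j; apply: (sal_imp sB); first exact: (sal_cst sB).
  apply: (@sal_iff _ B (fun x => exists a, h (act u x) j = a /\ h (act v x) j = a)).
    by move=> x; split=> [[a [-> ->]]|->] //; exists (h (act v x) j).
  by apply: (sal_ex sB) => a; apply: (sal_and sB); exact: (B_act _ (hB j a)).
apply: (@sal_iff _ B (fun x => exists a b, h (act u x) k = a /\ h (act v x) k = b /\ a < b)).
  move=> x; split=> [[a [b [-> [->]]]]|] // lt.
  by exists (h (act u x) k), (h (act v x) k).
apply: (sal_ex sB) => a; apply: (sal_ex sB) => b.
by do 2 (apply: (sal_and sB); first exact: (B_act _ (hB k _))); exact: (sal_cst sB).
Qed.

Lemma B_lexmin (A : X -> X -> Prop) : (forall x y, A x y -> conn x y) ->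
  (forall u v, B [set x | A (act u x) (act v x)]) ->
  forall u v, B [set x | lexmin (A (act u x)) (act v x)].
Proof.
move=> Ac BA u v; apply: (sal_and sB) => //.
apply: (B_all (P := fun x y => A (act u x) y -> y = act v x \/ lex (act v x) y)).
  move=> x y /not_implyP[/Ac + _]; apply: conn_trans; exact: conn_act.
by move=> w; apply: (sal_imp sB) => //; apply: (sal_or sB); [exact: B_eq|exact: B_lex].
Qed.

Lemma B_conn u v : B [set x | conn (act u x) (act v x)].
Proof.
apply: (@sal_iff _ B (fun=> True)); last exact: (sal_cst sB).
by move=> x; split=> // _; apply: conn_trans (conn_act v x); apply: conn_sym; exact: conn_act.
Qed.

(** The least point of a finite component in the order of codes serves as its root. *)
Lemma finite_components_coloring (H : X -> X -> Prop) (al : nat -> X -> X -> Prop) k :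
  (forall x y, H x y -> H y x) -> (forall x y, H x y -> conn x y) ->
  (forall u v, B [set x | H (act u x) (act v x)]) ->
  (forall x, listed (reach H x)) ->
  (forall i u v, B [set x | al i (act u x) (act v x)]) ->
  (forall es, (forall u v, adj es u v -> H u v) -> exists2 c, proper_on (adj es) c &
     forall u v, adj es u v -> c u v < k /\ al (c u v) u v) ->
  exists c, [/\ proper_on H c, forall u v, H u v -> c u v < k /\ al (c u v) u v &
  forall i u v, B [set x | H (act u x) (act v x) /\ c (act u x) (act v x) = i]].
Proof.
move=> Hsym Hconn HB fH alB.
have Rconn x y : reach H x y -> conn x y.
  move=> xy; apply: (reach_ind xy); first exact: conn_refl.
  by move=> u v _ xu /Hconn; exact: conn_trans.
apply: (smooth_coloring (Rt := fun x => lexmin (reach H x))) => //.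
- by apply: B_lexmin => //; apply: (B_reach (Q := fun=> H)) => // _; exact: Hconn.
- by move=> x r [/Rconn].
- move=> x y r xy; suff -> : reach H x = reach H y by [].
  apply/funext => z; apply/propext; split; apply: reach_trans; last exact: reach1.
  exact/reach1/Hsym.
- by move=> x y _; exact: lexmin_ex (fH x) (reach_refl _ _).
- by move=> x r r'; exact: lexmin_inj.
Qed.

(** * Bipartite graphs of bounded degree with two-ended components *)

Section two_ended.
Variables (d : nat) (side : X -> bool).
Hypotheses (degE : forall v, deg_le E v d) (bip : forall u v, E u v -> side u <> side v).

Definition ball n x y := exists2 m, m <= n & steps E m x y.

Lemma ball_refl n x : ball n x x. Proof. by exists 0. Qed.

Lemma ball_le m n x y : m <= n -> ball m x y -> ball n x y.
Proof. by move=> mn [k km xy]; exists k => //; exact: leq_trans mn. Qed.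

Lemma ball_sym n x y : ball n x y -> ball n y x.
Proof. by move=> [m mn xy]; exists m => //; exact: steps_sym. Qed.

Lemma ball_trans y m n x z : ball m x y -> ball n y z -> ball (m + n) x z.
Proof. by move=> [i im xy] [j jn yz]; exists (i + j); [exact: leq_add|exact: steps_cat yz]. Qed.

Lemma ball1 x y : E x y -> ball 1 x y.
Proof. by exists 1 => //; exists y. Qed.

Lemma ball_conn n x y : ball n x y -> conn x y.
Proof. by move=> [m _ xy]; apply/connP; exists m. Qed.

Lemma conn_ball x y : conn x y -> exists n, ball n x y.
Proof. by move=> /connP[n xy]; exists n; exists n. Qed.

Lemma B_ball n u v : B [set x | ball n (act u x) (act v x)].
Proof.
apply: (@sal_iff _ B (fun x => exists m, m <= n /\ steps E m (act u x) (act v x))).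
  by move=> x; split=> [[m []]|[m]]; exists m.
apply: (sal_ex sB) => m; apply: (sal_and sB); first exact: (sal_cst sB).
by apply: (B_steps (Q := fun=> E)) => [_|]; [exact: E_conn|exact: B_E].
Qed.

Lemma nbr_listed v : listed (E v).
Proof.
apply: contrapT => nl.
have H n : exists s, [/\ uniq s, size s = n & {in s, forall w, E v w}].
  elim: n => [|n [s [us sn sE]]]; first by exists [::].
  have /existsNP[w /not_implyP[vw /negP ws]] : ~ forall y, E v y -> y \in s.
    by move=> Hs; apply: nl; exists s.
  exists (w :: s); split=> /=; [by rewrite ws|by rewrite sn|].
  by move=> z; rewrite inE => /predU1P[->//|/sE].
by have [s [us sd /(degE us)]] := H d.+1; rewrite sd ltnn.
Qed.

Lemma ball_listed n x : listed (ball n x).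
Proof.
have H m y : listed (steps E m y).
  elim: m y => [|m IH] y; first by exists [:: y] => z <-; rewrite mem_head.
  apply: (listed_sub _ (listed_bigU (nbr_listed y) (fun z _ => IH z))).
  by move=> z [t [yt tz]]; exists t.
have ln : listed (fun m => m <= n) by exists (iota 0 n.+1) => m; rewrite mem_iota.
exact: listed_bigU ln (fun m _ => H m x).
Qed.

Definition avoid (F : X -> Prop) u v := [/\ E u v, ~ F u & ~ F v].

Lemma avoid_sym F u v : avoid F u v -> avoid F v u.
Proof. by case=> /Esym. Qed.

(** Components of the complement of [F]; a point of [F] is related only to itself. *)
Definition cc F := reach (avoid F).

Lemma cc_sym F x y : cc F x y -> cc F y x.
Proof. by apply: reach_sym => u v; exact: avoid_sym. Qed.

Lemma cc_conn F x y : cc F x y -> conn x y.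
Proof. by move=> xy; apply/connP; apply: reach_mono xy => u v []. Qed.

Lemma cc_notin F x y : ~ F x -> cc F x y -> ~ F y.
Proof. by move=> Fx xy; apply: (reach_ind (P := fun u => ~ F u) xy) => // u v _ _ []. Qed.

Lemma cc_mono (F F' : X -> Prop) x y : (forall u, F u -> F' u) -> cc F' x y -> cc F x y.
Proof. by move=> FF; apply: reach_mono => u v [uv Fu Fv]; split=> // /FF. Qed.

Definition big F y := forall s : seq X, exists2 z, z \notin s & cc F y z.

(** For [y] in the component of [x] this is [big], by local finiteness; quantifying over radii
    instead of lists of points makes it visibly Borel. *)
Definition unbounded F x y := forall m, exists2 z, cc F y z & ~ ball m x z.

Lemma bigP F x y : conn x y -> big F y <-> unbounded F x y.
Proof.
move=> xy; split=> [bF m|uF s].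
  have [s Hs] := ball_listed m x; have [z zs yz] := bF s; exists z => //.
  by move=> /Hs; apply/negP.
have /choice[f Hf] : forall z, exists n, conn x z -> ball n x z.
  by move=> z; have [/conn_ball[n Hn]|nc] := pselect (conn x z); [exists n|exists 0].
have [z yz nb] := uF (\max_(z <- s) f z); exists z => //; apply/negP => zs; apply: nb.
apply: ball_le (Hf z (conn_trans xy (cc_conn yz))).
by rewrite (big_rem z zs) /= leq_maxl.
Qed.

Lemma bigNP F y : ~ big F y -> listed (cc F y).
Proof.
move=> /existsNP[s Hs]; exists s => z yz; apply/negPn/negP => zs.
by apply: Hs; exists z.
Qed.

Lemma big_mono (F F' : X -> Prop) y : (forall u, F u -> F' u) -> big F' y -> big F y.
Proof. by move=> FF bF s; have [z zs yz] := bF s; exists z => //; exact: cc_mono yz. Qed.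

(* Only finitely many components touch the removed finite part. *)
Lemma big_refine (F F' : X -> Prop) y : (forall u, F u -> F' u) -> listed F' ->
  ~ F y -> big F y -> exists z, [/\ cc F y z, ~ F' z & big F' z].
Proof.
move=> FF lF' nFy bF; apply: contrapT => H.
have nb z : cc F y z -> ~ F' z -> ~ big F' z by move=> yz nz bz; apply: H; exists z.
have [[p [yp F'p]]|np] := pselect (exists p, cc F y p /\ F' p); last first.
  have nF' z : cc F y z -> ~ F' z by move=> yz Fz; apply: np; exists z.
  apply: (nb y (reach_refl _ _) (nF' _ (reach_refl _ _))) => s.
  have [z zs yz] := bF s; exists z => //.
  apply: (reach_ind yz); first exact: reach_refl.
  move=> u v yu yu' uv; apply: reach_trans yu' _; apply: reach1.
  have [Euv _ _] := uv; split=> //; first exact: nF'.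
  exact: nF' (reach_trans yu (reach1 uv)).
pose N n := [/\ cc F y n, ~ F' n & exists2 q, F' q & E q n].
have lN : listed N.
  apply: (listed_sub _ (listed_bigU lF' (fun q _ => nbr_listed q))).
  by move=> n [_ _ [q F'q qn]]; exists q.
have lc : listed (fun z => exists2 n, N n & cc F' n z).
  by apply: listed_bigU lN _ => n [yn nn _]; exact/bigNP/nb.
have [s Hs] := listed_or lF' lc; have [z zs yz] := bF s; case/negP: zs; apply: Hs.
have [F'z|nF'z] := pselect (F' z); [by left|right].
have zp : cc F z p by apply: reach_trans yp; exact: cc_sym.
have : cc F' z p \/ exists2 n, N n & cc F' n z.
  apply: (reach_ind (P := fun u => cc F' z u \/ _) zp).
    by left; exact: reach_refl.
  move=> u v zu [zu'|?] uv; last by right.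
  have nu := cc_notin nF'z zu'; have [Euv _ _] := uv.
  have [F'v|nF'v] := pselect (F' v); last first.
    by left; apply: reach_trans zu' (reach1 _).
  right; exists u; last exact: cc_sym.
  by split=> //; [exact: reach_trans yz zu|exists v => //; exact: Esym].
by case=> // zp'; case: (cc_notin nF'z zp').
Qed.

Definition inseq (s : seq X) : X -> Prop := fun u => u \in s.

Hypothesis not_three_ended : forall (s : seq X) (F := inseq s) y1 y2 y3,
  conn y1 y2 -> conn y1 y3 -> ~ F y1 -> ~ F y2 -> ~ F y3 ->
  big F y1 -> big F y2 -> big F y3 ->
  ~ cc F y1 y2 -> ~ cc F y1 y3 -> ~ cc F y2 y3 -> False.

Hypothesis has_two_ends : forall x, exists (s : seq X) y1 y2,
  [/\ forall z, z \in s -> conn x z, conn x y1 /\ conn x y2, ~ inseq s y1 /\ ~ inseq s y2,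
      big (inseq s) y1 /\ big (inseq s) y2 & ~ cc (inseq s) y1 y2].

Lemma not_three (F : X -> Prop) y1 y2 y3 : listed F ->
  conn y1 y2 -> conn y1 y3 -> ~ F y1 -> ~ F y2 -> ~ F y3 ->
  big F y1 -> big F y2 -> big F y3 ->
  ~ cc F y1 y2 -> ~ cc F y1 y3 -> ~ cc F y2 y3 -> False.
Proof. by move=> /listedP[s ->]; exact: not_three_ended. Qed.

(** * Balls separating the ends and their canonical choice *)

Definition cut r x := exists y1, [/\ conn x y1, ~ ball r x y1, unbounded (ball r x) x y1 &
  exists y2, [/\ conn x y2, ~ ball r x y2, unbounded (ball r x) x y2 & ~ cc (ball r x) y1 y2]].

(** A ball around [x] that contains a finite set separating two infinite components separates
    infinite parts of them. *)
Lemma cut_ex x : exists r, cut r x.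
Proof.
have [s [y1 [y2 [sx [xy1 xy2] [ny1 ny2] [b1 b2] ncc]]]] := has_two_ends x.
have /choice[f Hf] : forall z, exists n, conn x z -> ball n x z.
  by move=> z; have [/conn_ball[n Hn]|nc] := pselect (conn x z); [exists n|exists 0].
pose r := \max_(z <- s) f z; exists r.
have sr z : z \in s -> ball r x z.
  move=> zs; apply: ball_le (Hf z (sx z zs)).
  by rewrite /r (big_rem z zs) /= leq_maxl.
have [z1 [c1 n1 /bigP u1]] := big_refine sr (ball_listed r x) ny1 b1.
have [z2 [c2 n2 /bigP u2]] := big_refine sr (ball_listed r x) ny2 b2.
have xz1 := conn_trans xy1 (cc_conn c1); have xz2 := conn_trans xy2 (cc_conn c2).
exists z1; split=> //; first exact: u1.
exists z2; split=> //; first exact: u2.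
move=> /(cc_mono sr) z12; apply: ncc.
exact: reach_trans c1 (reach_trans z12 (cc_sym c2)).
Qed.

Lemma B_cc_ball r u v : B [set x | cc (ball r x) (act u x) (act v x)].
Proof.
apply: (B_reach (Q := fun x => avoid (ball r x))) => [x y z [/E_conn]//|{}u {}v].
apply: (@sal_iff _ B (fun x => E (act u x) (act v x) /\ ~ ball r x (act u x) /\
  ~ ball r x (act v x))); first by move=> x; split=> [[? []]|[]].
apply: (sal_and sB); first exact: B_E.
by apply: (sal_and sB); apply: (sal_not sB); [exact: (B_ball r [::] u)|exact: (B_ball r [::] v)].
Qed.

Lemma B_unbounded (F : X -> X -> Prop) u :
  (forall v w, B [set x | cc (F x) (act v x) (act w x)]) ->
  B [set x | unbounded (F x) x (act u x)].
Proof.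
move=> BF; apply: (sal_all sB) => m.
apply: (@sal_iff _ B (fun x => exists z, cc (F x) (act u x) z /\ ~ ball m x z)).
  by move=> x; split=> [[z []]|[z]]; exists z.
apply: B_ex => [x y [/cc_conn + _]|w]; first by apply: conn_trans; exact: conn_act.
by apply: (sal_and sB) => //; apply: (sal_not sB); exact: (B_ball m [::] w).
Qed.

Lemma B_cut r : B [set x | cut r x].
Proof.
apply: B_ex => [x y []//|u].
apply: (@sal_iff _ B (fun x => (conn x (act u x) /\ ~ ball r x (act u x)) /\
   unbounded (ball r x) x (act u x) /\ exists y2, (conn x y2 /\ ~ ball r x y2) /\
   (unbounded (ball r x) x y2 /\ ~ cc (ball r x) (act u x) y2))).
  move=> x; split=> [[[? ?] [? [y [[? ?] [? ?]]]]]|[? ? ? [y [? ? ? ?]]]].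
    by split=> //; exists y.
  by do 2 split=> //; exists y.
have Bb v : B [set x | conn x (act v x) /\ ~ ball r x (act v x)].
  by apply: (sal_and sB); [exact: (B_conn [::] v)|apply: (sal_not sB); exact: (B_ball r [::] v)].
apply: (sal_and sB) => //; apply: (sal_and sB); first by apply: B_unbounded; exact: B_cc_ball.
apply: B_ex => [x y [[]]//|w]; apply: (sal_and sB) => //.
apply: (sal_and sB); first by apply: B_unbounded; exact: B_cc_ball.
by apply: (sal_not sB); exact: B_cc_ball.
Qed.

(** An index codes a radius together with a finite word, which stands for a basic neighborhood in
    the space of codes. *)
Let rad n : nat := (odflt (0, [::]) (unpickle n : option (nat * seq nat))).1.
Let nbh n : seq nat := (odflt (0, [::]) (unpickle n : option (nat * seq nat))).2.

Let cand n x := cyl (nbh n) (h x) /\ cut (rad n) x.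

(* [rad n + d.*2] is the radius of the region around a cut on which a coloring
   is prescribed. *)
Let lonely n x := cand n x /\
  forall y, cand n y -> ball ((rad n + d.*2) + 1 + (rad n + d.*2)) x y -> y = x.

(** Taking the first index with a lonely point in the component makes the family canonical and gives
    all its balls one radius. *)
Definition sel n x := lonely n x /\ forall m, m < n -> forall y, conn x y -> ~ lonely m y.

(** The relevant ball around [x] is finite, so a long enough initial segment of the code of [x]
    excludes its other points. *)
Lemma lonely_ex x : exists n, lonely n x.
Proof.
have [r xr] := cut_ex x; have [t Ht] := ball_listed ((r + d.*2) + 1 + (r + d.*2)) x.
have [l Hl] : exists l, forall y, y \in t -> agree l (h x) (h y) -> y = x.
  elim: t {Ht} => [|z t [l Hl]]; first by exists 0.
  have [k Hk] : exists k, agree k (h x) (h z) -> z = x.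
    have [->|zx] := eqVneq z x; first by exists 0.
    apply: contrapT => nk; case/eqP: zx; apply: h_inj; apply/esym/eq_agree => k.
    by apply: contrapT => na; apply: nk; exists k.
  exists (maxn k l) => y; rewrite inE => /predU1P[->|yt] a.
    by apply/Hk/agree_le/a; exact: leq_maxl.
  by apply: Hl => //; apply/agree_le/a; exact: leq_maxr.
exists (pickle (r, mkseq (h x) l)); rewrite /lonely /cand /rad /nbh pickleK /=; split.
  by split=> //; apply/cyl_mkseq.
by move=> y [/cyl_mkseq hxy _] /Ht yt; exact: Hl.
Qed.

Lemma sel_ex x : exists n y, conn x y /\ sel n y.
Proof.
have [n0 xn0] := lonely_ex x; pose P n := exists y, conn x y /\ lonely n y.
have [y [xy ly]] : P (least P) by apply: least_spec; exists n0, x; split=> //; exact: conn_refl.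
exists (least P), y; split=> //; split=> // m ml z yz lz.
have /least_le : P m by exists z; split=> //; exact: conn_trans yz.
by rewrite leqNgt ml.
Qed.

Lemma sel_uniq n m x y : sel n x -> sel m y -> conn x y -> n = m.
Proof.
move=> [lx Hx] [ly Hy] xy; case: (ltngtP n m) => // nm; first by case: (Hy _ nm _ (conn_sym xy)).
by case: (Hx _ nm _ xy).
Qed.

Lemma sel_sep n m x y : sel n x -> sel m y ->
  ball ((rad n + d.*2) + 1 + (rad n + d.*2)) x y -> x = y.
Proof.
move=> sx sy xy; have nm := sel_uniq sx sy (ball_conn xy); rewrite -nm in sy.
by case: sx => -[_ Hx] _; case: sy => -[cy _] _; rewrite (Hx y).
Qed.

Lemma sel_cut n x : sel n x -> cut (rad n) x.
Proof. by case=> -[[]]. Qed.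

Lemma B_sel n u : B [set x | sel n (act u x)].
Proof.
have Bcand m w : B [set x | cand m (act w x)].
  apply: (B_act w); apply: (sal_and sB); last exact: B_cut.
  by apply: (sal_preimage sB hB); exact: BN_cyl.
have Bl m w : B [set x | lonely m (act w x)].
  apply: (B_act w (A := [set x | lonely m x])); apply: (sal_and sB).
    exact: (Bcand m [::]).
  apply: B_all => [x y /not_implyP[_ /not_implyP[/ball_conn]]//|v].
  apply: (sal_imp sB) => //; apply: (sal_imp sB); first exact: (B_ball _ [::] v).
  exact: (B_eq v [::]).
apply: (B_act u (A := [set x | sel n x])); apply: (sal_and sB); first exact: (Bl n [::]).
apply: (sal_all sB) => m; apply: (sal_imp sB); first exact: (sal_cst sB).
apply: B_all => [x y /not_implyP[]//|v]; apply: (sal_imp sB); first exact: (B_conn [::] v).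
exact: (sal_not sB).
Qed.

Definition near j z := exists n x, sel n x /\ ball (rad n + j) x z.

Definition core := near 0.

Lemma B_near j u : B [set x | near j (act u x)].
Proof.
apply: (B_act u (A := [set x | near j x])); apply: (sal_ex sB) => n.
apply: B_ex => [x y [_ /ball_conn/conn_sym]//|w].
by apply: (sal_and sB); [exact: B_sel|exact: (B_ball _ w [::])].
Qed.

Lemma near_step j u v : near j u -> E u v -> near j.+1 v.
Proof.
move=> [n [x [sx xu]]] uv; exists n, x; split=> //.
by have := ball_trans xu (ball1 uv); rewrite addn1 addnS.
Qed.

Lemma sel_core n x : sel n x -> core x.
Proof. by move=> sx; exists n, x; split=> //; exact: ball_refl. Qed.

Lemma ball_core n x u : sel n x -> ball (rad n) x u -> core u.
Proof. by move=> sx xu; exists n, x; rewrite addn0. Qed.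

Lemma ball_cc r x u (F : X -> Prop) : (forall v, ball r x v -> ~ F v) -> ball r x u -> cc F x u.
Proof.
move=> xF [m mr xu]; elim: m u mr xu => [|m IH] u mr xu.
  by rewrite -xu; exact: reach_refl.
have [v [uv vx]] := steps_sym Esym xu.
have xv : steps E m x v by exact: steps_sym.
apply: reach_trans (IH v (ltnW mr) xv) (reach1 _); split; first exact: Esym.
  by apply: xF; exists m => //; exact: ltnW.
by apply: xF; exists m.+1.
Qed.

(* If an infinite component of the complement of the balls touched two balls, these
   balls would cut off two further infinite components. *)
Lemma touch_one n x1 x2 y1 y2 z1 z2 : sel n x1 -> sel n x2 -> conn x1 x2 ->
  ball (rad n) x1 z1 -> E z1 y1 -> ball (rad n) x2 z2 -> E z2 y2 ->
  ~ core y1 -> cc core y1 y2 -> big core y1 -> x1 = x2.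
Proof.
move=> s1 s2 x12 xz1 zy1 xz2 zy2 ny1 y12 b1; apply: contrapT => ne.
set r := rad n in xz1 xz2 *; set F1 := ball r x1; set F2 := ball r x2.
have dis u : F1 u -> ~ F2 u.
  move=> u1 u2; apply: ne; apply: (sel_sep s1 s2).
  by apply: ball_le (ball_trans u1 (ball_sym u2)); rewrite -/r; lia.
have dis' u : F2 u -> ~ F1 u by move=> u2 u1; exact: dis u1 u2.
have F1core u : F1 u -> core u by exact: ball_core s1.
have F2core u : F2 u -> core u by exact: ball_core s2.
have ny2 := cc_notin ny1 y12.
have toW1 u : F1 u -> cc F2 u y1.
  move=> u1; apply: reach_trans (cc_sym (ball_cc dis u1)) _.
  apply: reach_trans (ball_cc dis xz1) (reach1 _); split=> //; first exact: dis.
  by move=> /F2core.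
have toW2 u : F2 u -> cc F1 u y1.
  move=> u2; apply: reach_trans (cc_sym (ball_cc dis' u2)) _.
  apply: reach_trans (ball_cc dis' xz2) _; apply: (reach_trans (y := y2)).
    by apply: reach1; split=> //; [exact: dis'|move=> /F1core].
  exact: cc_mono F1core (cc_sym y12).
(* A cut leaves at least two infinite components, so one of them does not contain [y1]. *)
have other x : sel n x -> exists p, [/\ conn x p, ~ ball r x p, big (ball r x) p & ~ cc (ball r x) p y1].
  move=> /sel_cut[p [xp np /(bigP _ xp) bp [q [xq nq /(bigP _ xq) bq pq]]]].
  have [py|npy] := pselect (cc (ball r x) p y1); last by exists p.
  by exists q; split=> // qy; apply: pq; apply: reach_trans py (cc_sym qy).
have [p [xp np bp npy]] := other _ s1; have [q [xq nq bq nqy]] := other _ s2.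
pose F u := F1 u \/ F2 u.
have lF : listed F by apply: listed_or; exact: ball_listed.
have p2 u : cc F1 p u -> ~ F2 u by move=> pu /toW2 uy; apply: npy; exact: reach_trans uy.
have q1 u : cc F2 q u -> ~ F1 u by move=> qu /toW1 uy; apply: nqy; exact: reach_trans uy.
(* The side of [p] never meets the second ball, which is joined to [y1] off [F1]; so removing that
   ball as well leaves this side infinite. Likewise for [q]. *)
have bFp : big F p.
  move=> s; have [u us pu] := bp s; exists u => //; apply: (reach_ind pu); first exact: reach_refl.
  move=> v w pv pv' vw; apply: reach_trans pv' (reach1 _).
  have [Evw nv nw] := vw; have pw := reach_trans pv (reach1 vw).
  by split=> // -[//|]; exact: p2.
have bFq : big F q.
  move=> s; have [u us pu] := bq s; exists u => //; apply: (reach_ind pu); first exact: reach_refl.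
  move=> v w pv pv' vw; apply: reach_trans pv' (reach1 _).
  have [Evw nv nw] := vw; have pw := reach_trans pv (reach1 vw).
  by split=> // -[|//]; exact: q1.
have FF1 u : F1 u -> F u by left.
have FF2 u : F2 u -> F u by right.
have nFp : ~ F p by case=> [//|]; exact: p2 (reach_refl _ _).
have nFq : ~ F q by case=> [|//]; exact: q1 (reach_refl _ _).
have cxy : conn x1 y1 := conn_trans (ball_conn xz1) (E_conn zy1).
have cpx := conn_sym xp.
apply: (not_three lF (y1 := p) (y2 := q) (y3 := y1)) => //.
- exact: conn_trans cpx (conn_trans x12 xq).
- exact: conn_trans cpx cxy.
- by case=> [/F1core|/F2core].
- by apply: big_mono b1 => u [/F1core|/F2core].
(* A walk from [p] to the center [x1] has to enter [F]. Entering the second ball contradicts [p2];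
   entering the first contradicts [q1], as [q] is joined to [p]. *)
- move=> pq; have : cc F p x1.
    have /connP px := cpx.
    apply: (reach_ind px); first exact: reach_refl.
    move=> u v _ pu uv; have nu := cc_notin nFp pu.
    have [Fv|nFv] := pselect (F v); last by apply: reach_trans pu (reach1 _).
    case: Fv => [v1|v2].
      case: (q1 v) => //; apply: (reach_trans (y := u)).
        exact: cc_mono FF2 (reach_trans (cc_sym pq) pu).
      by apply: reach1; split=> //; [move=> /FF2|exact: dis].
    case: (p2 v) => //; apply: (reach_trans (y := u)); first exact: cc_mono FF1 pu.
    by apply: reach1; split=> //; [move=> /FF1|exact: dis'].
  by move=> /(cc_notin nFp); apply; left; exact: ball_refl.
- by move=> /(cc_mono FF1).
- by move=> /(cc_mono FF2).
Qed.

Definition extremal x := exists n, sel n x /\ exists y, [/\ exists2 z, ball (rad n) x z & E z y,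
  ~ core y & unbounded core x y].

(** By [touch_one] the infinite component at an extremal ball touches no other ball, so three such
    balls would give three infinite components off their union. *)
Lemma extremal_two x1 x2 x3 : extremal x1 -> extremal x2 -> extremal x3 ->
  conn x1 x2 -> conn x1 x3 -> [\/ x1 = x2, x1 = x3 | x2 = x3].
Proof.
move=> [n [s1 [y1 [[z1 xz1 zy1] ny1 u1]]]] [n2 [s2 [y2 [[z2 xz2 zy2] ny2 u2]]]].
move=> [n3 [s3 [y3 [[z3 xz3 zy3] ny3 u3]]]] x12 x13.
have e2 := sel_uniq s1 s2 x12; have e3 := sel_uniq s1 s3 x13; subst n2 n3.
apply: contrapT => H; set r := rad n in xz1 xz2 xz3 *.
pose F u := ball r x1 u \/ ball r x2 u \/ ball r x3 u.
have lF : listed F by do 2 (apply: listed_or; first exact: ball_listed); exact: ball_listed.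
have Fcore u : F u -> core u by move=> [|[]]; [move: s1|move: s2|move: s3] => /ball_core; apply.
have c1 := conn_trans (ball_conn xz1) (E_conn zy1).
have c2 := conn_trans (ball_conn xz2) (E_conn zy2).
have c3 := conn_trans (ball_conn xz3) (E_conn zy3).
have b1 := (bigP core c1).2 u1; have b2 := (bigP core c2).2 u2; have b3 := (bigP core c3).2 u3.
(* A walk leaving the component of [y] off all balls enters one of them, by [touch_one] the ball of
   [x], which lies in [F]. So removing only the three balls yields no larger component. *)
have comp x y z : sel n x -> (forall u, ball r x u -> F u) -> ball r x z -> E z y ->
    ~ core y -> big core y -> forall u, cc F y u -> cc core y u.
  move=> sx xF xz zy ny bY u yu; apply: (reach_ind yu); first exact: reach_refl.
  move=> v w _ yv [vw nv nw]; apply: (reach_trans yv (reach1 _)).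
  have nv' := cc_notin ny yv; split=> // -[m [x' [s' ]]]; rewrite addn0 => x'w.
  have cxx' : conn x x'.
    apply: conn_trans (conn_trans (ball_conn xz) (E_conn zy)) _.
    apply: conn_trans (cc_conn yv) (conn_trans (E_conn vw) _).
    exact/conn_sym/ball_conn/x'w.
  have e := sel_uniq sx s' cxx'; subst m; apply: nw; apply: xF.
  by rewrite (touch_one sx s' cxx' xz zy x'w (Esym vw) ny yv bY).
have touch x x' y y' z z' : sel n x -> sel n x' -> conn x x' -> ball r x z -> E z y ->
    ball r x' z' -> E z' y' -> (forall u, ball r x u -> F u) -> ~ core y ->
    big core y -> cc F y y' -> x = x'.
  move=> sx sx' xx' xz zy xz' zy' xF ny bY /(comp _ _ _ sx xF xz zy ny bY) yy'.
  exact: touch_one sx sx' xx' xz zy xz' zy' ny yy' bY.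
have F1 u : ball r x1 u -> F u by left.
have F2 u : ball r x2 u -> F u by right; left.
have x23 := conn_trans (conn_sym x12) x13.
apply: (not_three lF (y1 := y1) (y2 := y2) (y3 := y3)).
- exact: conn_trans (conn_sym c1) (conn_trans x12 c2).
- exact: conn_trans (conn_sym c1) (conn_trans x13 c3).
- by move=> /Fcore.
- by move=> /Fcore.
- by move=> /Fcore.
- exact: big_mono Fcore b1.
- exact: big_mono Fcore b2.
- exact: big_mono Fcore b3.
- by move=> c; apply: H; constructor 1; exact: touch s1 s2 x12 xz1 zy1 xz2 zy2 F1 ny1 b1 c.
- by move=> c; apply: H; constructor 2; exact: touch s1 s3 x13 xz1 zy1 xz3 zy3 F1 ny1 b1 c.
- by move=> c; apply: H; constructor 3; exact: touch s2 s3 x23 xz2 zy2 xz3 zy3 F2 ny2 b2 c.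
Qed.

Lemma B_cc_core u v : B [set x | cc core (act u x) (act v x)].
Proof.
apply: (B_reach (Q := fun _ => avoid core)) => [_ y z [/E_conn]//|{}u {}v].
apply: (@sal_iff _ B (fun x => E (act u x) (act v x) /\ ~ core (act u x) /\
  ~ core (act v x))); first by move=> x; split=> [[? []]|[]].
apply: (sal_and sB); first exact: B_E.
by apply: (sal_and sB); apply: (sal_not sB); exact: B_near.
Qed.

Lemma B_extremal u : B [set x | extremal (act u x)].
Proof.
apply: (B_act u (A := [set x | extremal x])); apply: (sal_ex sB) => n.
apply: (sal_and sB); first exact: (B_sel n [::]).
apply: B_ex => [x y [[z /ball_conn xz /E_conn zy] _ _]|w]; first exact: conn_trans xz zy.
apply: (@sal_iff _ B (fun x => (exists z, ball (rad n) x z /\ E z (act w x)) /\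
   ~ core (act w x) /\ unbounded core x (act w x))).
  by move=> x; split=> [[[z [? ?]] [? ?]]|[[z ? ?] ? ?]]; split=> //; exists z.
apply: (sal_and sB).
  apply: B_ex => [x z [/ball_conn]//|v].
  by apply: (sal_and sB); [exact: (B_ball _ [::] v)|exact: B_E].
apply: (sal_and sB); first by apply: (sal_not sB); exact: B_near.
by apply: (B_unbounded (F := fun=> core)); exact: B_cc_core.
Qed.

(** * Components with an extremal ball *)

Definition smooth_part x := exists r, conn x r /\ extremal r.

Lemma smooth_part_conn x y : conn x y -> smooth_part y -> smooth_part x.
Proof. by move=> xy [r [yr er]]; exists r; split=> //; exact: conn_trans yr. Qed.

Lemma smooth_part_E x y : E x y -> smooth_part x <-> smooth_part y.
Proof.
by move=> xy; split; apply: smooth_part_conn; apply: E_conn => //; exact: Esym.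
Qed.

Lemma B_smooth_part u : B [set x | smooth_part (act u x)].
Proof.
apply: (B_act u (A := [set x | smooth_part x])); apply: B_ex => [x y []//|w].
by apply: (sal_and sB); [exact: (B_conn [::] w)|exact: B_extremal].
Qed.

Lemma extremal_listed x : listed (fun r => conn x r /\ extremal r).
Proof.
have [[a [xa ea]]|nex] := pselect (exists r, conn x r /\ extremal r); last first.
  by exists [::] => y Hy; case: nex; exists y.
have [[b [[xb eb] ab]]|nb] := pselect (exists b, (conn x b /\ extremal b) /\ a <> b); last first.
  exists [:: a] => y Hy; rewrite inE; apply/eqP/esym; apply: contrapT => ay.
  by apply: nb; exists y.
exists [:: a; b] => y [xy ey]; rewrite !inE.
have ca z : conn x z -> conn a z by apply: conn_trans; exact: conn_sym.
by have [/ab//|->|->] := extremal_two ea eb ey (ca _ xb) (ca _ xy); rewrite eqxx ?orbT.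
Qed.

Lemma konig_sub es : (forall u v, adj es u v -> E u v) ->
  exists2 c, proper_on (adj es) c & forall u v, adj es u v -> c u v < d.
Proof.
move=> esE; apply: (@konig_edge_coloring _ side) => [u v /esE|v]; first exact: bip.
exact: (deg_le_sub (esE v) (degE (v := v))).
Qed.

Lemma smooth_part_coloring : exists c, [/\ proper_on (fun u v => E u v /\ smooth_part u) c,
  forall u v, E u v -> smooth_part u -> c u v < d &
  forall i u v, B [set x | (E (act u x) (act v x) /\ smooth_part (act u x)) /\
     c (act u x) (act v x) = i]].
Proof.
have [|||||||||es esH|c [pc cd Bc]] := @smooth_coloring (fun u v => E u v /\ smooth_part u)
  (fun x => lexmin (fun r => conn x r /\ extremal r)) (fun _ _ _ => True) d.
- by move=> x y [xy sx]; split; [exact: Esym|exact/(smooth_part_E xy)].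
- by move=> x y [/E_conn].
- by move=> u v; apply: (sal_and sB); [exact: B_E|exact: B_smooth_part].
- apply: (B_lexmin (A := fun x r => conn x r /\ extremal r)) => [x y []//|u v].
  by apply: (sal_and sB); [exact: B_conn|exact: B_extremal].
- by move=> x r [[]].
- move=> x y r [/E_conn xy _]; suff -> : conn x = conn y by [].
  apply/funext => z; apply/propext; split; apply: conn_trans => //; exact: conn_sym.
- by move=> x y [_ [r Hr]]; apply: (lexmin_ex (extremal_listed x) (x := r)).
- by move=> x r r'; exact: lexmin_inj.
- by move=> i u v; exact: (sal_cst sB).
- have [u v /esH[]//|c pc cd] := @konig_sub es.
  by exists c => // u v /cd.
by exists c; split=> // u v uv su; case: (cd u v).
Qed.

(** The connected component of [y] contains a selected center, so a walk towards it enters some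
    ball; an infinite component off the balls would make that ball extremal. *)
Lemma core_complement_listed y : ~ smooth_part y -> ~ core y -> listed (cc core y).
Proof.
move=> nsm ncy; apply: bigNP => bY; apply: nsm.
have [n [x [yx sx]]] := sel_ex y.
have : cc core y x \/ exists n' x', [/\ sel n' x', conn y x' & extremal x'].
  have /connP yx' := yx.
  apply: (reach_ind (P := fun u => cc core y u \/ _) yx'); first by left; exact: reach_refl.
  move=> u v _ [yu|?] uv; last by right.
  have nu := cc_notin ncy yu.
  have [cv|ncv] := pselect (core v); last by left; apply: (reach_trans yu (reach1 _)).
  right; have [n' [x' [sx' x'v]]] := cv; rewrite addn0 in x'v.
  have cx'u := conn_trans (ball_conn x'v) (E_conn (Esym uv)).
  exists n', x'; split=> //; first exact: conn_trans (cc_conn yu) (conn_sym cx'u).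
  exists n'; split=> //; exists u; split=> //; first by exists v => //; exact: Esym.
  apply/bigP => // s; have [z zs yz] := bY s; exists z => //.
  exact: reach_trans (cc_sym yu) yz.
case=> [/(cc_notin ncy) ncx|[n' [x' [_ yx' ex']]]]; last by exists x'.
by case: ncx; exact: sel_core sx.
Qed.

(** * Distance to the balls, truncated at 2d, and the edges near the balls *)

Definition rho v := least (fun j => j = d.*2 \/ near j v).

Lemma rhoP v : rho v = d.*2 \/ near (rho v) v.
Proof. by apply: (least_spec (P := fun j => j = d.*2 \/ near j v)); exists d.*2; left. Qed.

Lemma rho_le v : rho v <= d.*2.
Proof. by apply: least_le; left. Qed.

Lemma near_rho j v : near j v -> rho v <= j.
Proof. by move=> jv; apply: least_le; right. Qed.

Lemma rho_lip u v : E u v -> rho u <= (rho v).+1.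
Proof.
move=> uv; have [->|nv] := rhoP v; first exact/leqW/rho_le.
by apply: near_rho; apply: near_step nv (Esym uv).
Qed.

Lemma near_le i j v : i <= j -> near i v -> near j v.
Proof.
move=> ij [n [x [sx xv]]]; exists n, x; split=> //.
by apply: ball_le xv; rewrite leq_add2l.
Qed.

Lemma B_rho u j : B [set x | rho (act u x) = j].
Proof.
apply: (sal_least _ sB) => i.
by apply: (sal_or sB); [exact: (sal_cst sB)|exact: B_near].
Qed.

Definition inner u v := [/\ E u v, ~ smooth_part u & rho u < d.*2 \/ rho v < d.*2].

Lemma inner_sym u v : inner u v -> inner v u.
Proof.
by case=> uv nu H; split; [exact: Esym|move=> /(smooth_part_E uv)|case: H; [right|left]].
Qed.

Lemma inner_near u v : inner u v -> near d.*2 v.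
Proof.
case=> uv _ H.
have [e|nv] := rhoP v; last by apply: near_le nv; exact: rho_le.
case: H => lt; last by rewrite e ltnn in lt.
have [e'|nu] := rhoP u; first by rewrite e' ltnn in lt.
by apply: near_le lt _; exact: near_step nu uv.
Qed.

(** Both ends of such an edge are within 2d of a ball, and the neighborhoods of two different balls
    cannot be joined by one edge: this is the distance demanded in [lonely]. So a component of
    [inner] stays around one ball. *)
Lemma inner_listed u : listed (reach inner u).
Proof.
have [[w uw]|nex] := pselect (exists w, inner u w); last first.
  exists [:: u] => y uy; rewrite inE; apply/eqP.
  apply: (reach_ind (P := fun y => y = u) uy) => // v w _ -> uw.
  by case: nex; exists w.
have [n [x [sx xu]]] := inner_near (inner_sym uw).
apply: listed_sub (ball_listed (rad n + d.*2) x) => y uy.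
apply: (reach_ind (P := ball (rad n + d.*2) x) uy) => // v z _ xv vz.
have [n' [x' [sx' x'z]]] := inner_near vz.
have [Evz _ _] := vz.
have xx' : conn x x'.
  exact: conn_trans (ball_conn xv) (conn_trans (E_conn Evz) (conn_sym (ball_conn x'z))).
have e := sel_uniq sx sx' xx'; rewrite -e in sx' x'z.
suff -> : x = x' by [].
apply: (sel_sep sx sx'); apply: ball_trans (ball_sym x'z).
exact: ball_trans (ball1 Evz).
Qed.

Lemma B_inner u v : B [set x | inner (act u x) (act v x)].
Proof.
apply: (@sal_iff _ B (fun x => E (act u x) (act v x) /\ ~ smooth_part (act u x) /\
   exists a b, rho (act u x) = a /\ rho (act v x) = b /\ (a < d.*2 \/ b < d.*2))).
  move=> x; split=> [[? [? [a [b [<- [<-]]]]]]|[? ? ?]] //.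
  by split=> //; split=> //; do 2 eexists.
apply: (sal_and sB); first exact: B_E.
apply: (sal_and sB); first by apply: (sal_not sB); exact: B_smooth_part.
apply: (sal_ex sB) => a; apply: (sal_ex sB) => b.
by do 2 (apply: (sal_and sB); first exact: B_rho); exact: (sal_cst sB).
Qed.

(** * Releasing colors away from the balls *)

Section interpolation.
Variable phi : X -> X -> nat.
Hypotheses (phi_proper : proper_on inner phi)
  (B_phi : forall i u v, B [set x | inner (act u x) (act v x) /\ phi (act u x) (act v x) = i]).

(** The number of colors of [phi] to be released at [v]; an edge obeys the smaller value at its two
    ends. *)
Let t v := (rho v)./2.

(* Near the core all colors of phi are kept; color class [i] is released at
   distance about 2i, the final color being phi + 1. *)
Definition kept u v := inner u v /\ minn (t u) (t v) <= phi u v.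

Definition free u v := [/\ E u v, ~ smooth_part u & ~ kept u v].

(** An edge at [v] can be kept with color [t v - 1] of [phi] when its other end is nearer to the
    balls. Its final color [t v] is then lost to the free edges at [v], so [kap] drops by one. *)
Definition capped v := exists w, kept v w /\ (phi v w).+1 = t v.

Definition kap v := t v - `[< capped v >].

Lemma rho_lip2 u v : E u v -> rho u <= (rho v).+1 /\ rho v <= (rho u).+1.
Proof. by move=> uv; split; apply: rho_lip => //; exact: Esym. Qed.

Lemma kept_sym u v : kept u v -> kept v u.
Proof.
case: phi_proper => psym _ [uv le]; split; first exact: inner_sym.
by rewrite -psym// minnC.
Qed.

Lemma free_sym u v : free u v -> free v u.
Proof.
move=> [uv su nk]; split; [exact: Esym|by move=> /(smooth_part_E uv)|].
by move=> /kept_sym.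
Qed.

(** Free edges at [u] use colors up to [kap u], so they never clash with kept ones. *)
Lemma kept_gt_kap u v : kept u v -> kap u < (phi u v).+1.
Proof.
move=> k; have [[Euv _ _] le] := k; rewrite ltnS /kap.
have [l1 l2] := rho_lip2 Euv; move: le; rewrite /t => le.
case: asboolP => [_|nc]; first by move: le l1 l2; lia.
have ne : (phi u v).+1 != (rho u)./2 by apply/eqP => e; apply: nc; exists v.
by move: ne le l1 l2; lia.
Qed.

(** If [v] is capped, a kept edge leads to a point with smaller [t]; hence [rho v] is even and every
    neighbor [u] has [t u <= t v]. The two possible losses never add up, which is the reason for
    halving the distance. *)
Lemma kap_lip u v : free u v -> kap u <= (kap v).+1.
Proof.
move=> [uv _ _]; have [l1 l2] := rho_lip2 uv; rewrite /kap /t.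
case: (asboolP (capped v)) => [[w [[[vw _ _] le] e]]|_].
  have [l3 l4] := rho_lip2 vw; move: e le; rewrite /t => e le.
  by case: asboolP => _; lia.
by case: asboolP => _; lia.
Qed.

(** Below distance 2d the free edges at [v] have distinct colors of [phi] below [t v], and [t v - 1]
    is not among them when [v] is capped. At distance 2d, [t v = d] and the degree bound suffices, a
    kept edge accounting for the cap. *)
Lemma deg_free v : deg_le free v (kap v).
Proof.
have [psym pinj] := phi_proper => s us sf.
have sE : {in s, forall w, E v w} by move=> w /sf[].
have [far|near_v] := leqP d.*2 (rho v).
  have td : t v = d by have := rho_le v; rewrite /t; lia.
  rewrite /kap td; case: asboolP => [[w [kw _]]|_]; last by rewrite subn0; exact: degE us sE.
  suff : size (w :: s) <= d by rewrite /= subn1; lia.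
  apply: (degE (v := v)) => /=.
    by rewrite us andbT; apply/negP => /sf[].
  by move=> z; rewrite inE => /predU1P[->|/sE//]; case: kw => -[].
have si : {in s, forall w, inner v w}.
  by move=> w /sf[vw sv _]; split=> //; left.
have st w : w \in s -> phi v w < t v.
  move=> ws; have [_ _ nk] := sf _ ws; rewrite ltnNge; apply/negP => le; apply: nk.
  by split; [exact: si|rewrite geq_min le].
have up : uniq (map (phi v) s).
  by rewrite map_inj_in_uniq// => w z /si vw /si vz; exact: pinj.
rewrite -(size_map (phi v) s) -(size_iota 0 (kap v)); apply: uniq_leq_size => //.
move=> _ /mapP[w ws ->]; rewrite mem_iota /= add0n /kap.
case: asboolP => [[w' [kw' e]]|_]; last by rewrite subn0; exact: st.
suff : phi v w <> phi v w' by have := st w ws; rewrite -e /= => ? ?; lia.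
move=> /(pinj _ _ _ (si _ ws) (proj1 kw')) ww'.
by have [_ _] := sf _ ws; rewrite ww'.
Qed.

(** At a point of a ball [t] is 0, so nothing is released there and every edge is kept. *)
Lemma free_ncore u v : free u v -> ~ core u.
Proof.
move=> [uv su nk] /near_rho; rewrite leqn0 => /eqP r0; apply: nk.
have d0 : 0 < d.
  by have := degE (v := u) (s := [:: v]); apply => // z; rewrite inE => /eqP ->.
by split; [split=> //; left; rewrite r0 double_gt0|rewrite /t r0 min0n].
Qed.

(** Free edges avoid the balls, whose complement has finite components outside the smooth part. *)
Lemma free_listed u : listed (reach free u).
Proof.
have [[w uw]|nex] := pselect (exists w, free u w); last first.
  exists [:: u] => y uy; rewrite inE; apply/eqP.
  apply: (reach_ind (P := fun y => y = u) uy) => // v w _ -> uw.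
  by case: nex; exists w.
have [_ su _] := uw; apply: listed_sub (core_complement_listed su (free_ncore uw)) => y.
apply: reach_mono => a b ab; split; [by case: ab|exact: free_ncore ab|].
exact: free_ncore (free_sym ab).
Qed.

Lemma B_kept u v : B [set x | kept (act u x) (act v x)].
Proof.
apply: (@sal_iff _ B (fun x => exists i a b, (inner (act u x) (act v x) /\
   phi (act u x) (act v x) = i) /\ rho (act u x) = a /\ rho (act v x) = b /\
   minn a./2 b./2 <= i)).
  move=> x; split=> [[i [a [b [[? <-] [<- [<-]]]]]]|[? ?]] //.
  by do 3 eexists; split; [split|split].
do 3 apply: (sal_ex sB) => ?.
apply: (sal_and sB) => //.
by do 2 (apply: (sal_and sB); first exact: B_rho); exact: (sal_cst sB).
Qed.

Lemma B_free u v : B [set x | free (act u x) (act v x)].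
Proof.
apply: (@sal_iff _ B (fun x => E (act u x) (act v x) /\ ~ smooth_part (act u x) /\
   ~ kept (act u x) (act v x))); first by move=> x; split=> [[? []]|[]].
apply: (sal_and sB); first exact: B_E.
by apply: (sal_and sB); apply: (sal_not sB); [exact: B_smooth_part|exact: B_kept].
Qed.

Lemma B_kap i u : B [set x | i <= kap (act u x)].
Proof.
have Bc : B [set x | capped (act u x)].
  apply: B_ex => [x y [[[/E_conn + _ _] _] _]|w].
    by apply: conn_trans; exact: conn_act.
  apply: (@sal_iff _ B (fun x => kept (act u x) (act w x) /\
     exists i a, (inner (act u x) (act w x) /\ phi (act u x) (act w x) = i) /\
       rho (act u x) = a /\ i.+1 = a./2)).
    move=> x; split=> [[? [j [a [[_ <-] [<-]]]]]|[k e]] //.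
    by split=> //; do 2 eexists; split=> //; split=> //; case: k.
  apply: (sal_and sB); first exact: B_kept.
  do 2 apply: (sal_ex sB) => ?; apply: (sal_and sB) => //.
  by apply: (sal_and sB); [exact: B_rho|exact: (sal_cst sB)].
apply: (@sal_iff _ B (fun x => exists a, rho (act u x) = a /\
   (capped (act u x) /\ i <= a./2 - 1 \/ ~ capped (act u x) /\ i <= a./2))).
  move=> x; rewrite /kap /t; split=> [[a [<-]]|].
    by case: asboolP => [c [[]|[]]|nc [[]|[]]] //; rewrite subn0.
  by case: asboolP => [c|nc]; exists (rho (act u x)); split=> //; [left|right; rewrite -(subn0 _./2)].
apply: (sal_ex sB) => a; apply: (sal_and sB); first exact: B_rho.
apply: (sal_or sB); apply: (sal_and sB); try exact: (sal_cst sB); first exact: Bc.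
exact: (sal_not sB Bc).
Qed.

Lemma free_coloring : exists c, [/\ proper_on free c,
  forall u v, free u v -> c u v < d.+1 /\ (c u v <= kap u /\ c u v <= kap v) &
  forall i u v, B [set x | free (act u x) (act v x) /\ c (act u x) (act v x) = i]].
Proof.
apply: (finite_components_coloring (al := fun i u v => i <= kap u /\ i <= kap v)).
- exact: free_sym.
- by move=> x y [/E_conn].
- exact: B_free.
- exact: free_listed.
- by move=> i u v; apply: (sal_and sB); exact: B_kap.
move=> es esf; have [||||c pc Hc] := @capacity_edge_coloring _ side kap d es.
- by move=> u v /esf[/bip].
- move=> v; exact: (deg_le_sub (esf v) (@deg_free v)).
- move=> v s us Hs; apply: leqW; apply: (degE (v := v) us) => w /Hs/esf[] //.
- by move=> u v /esf; exact: kap_lip.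
by exists c => // u v /Hc[].
Qed.

End interpolation.

Theorem two_ended_borel_coloring : exists c, [/\ proper_on E c,
  forall u v, E u v -> c u v <= d &
  forall i u v, B [set x | E (act u x) (act v x) /\ c (act u x) (act v x) = i]].
Proof.
have [cb [[cbsym cbinj] cbd Bcb]] := smooth_part_coloring.
have [||||||phi [pphi phid Bphi]] := @finite_components_coloring inner (fun _ _ _ => True) d.
- exact: inner_sym.
- by move=> x y [/E_conn].
- exact: B_inner.
- exact: inner_listed.
- by move=> i u v; exact: (sal_cst sB).
- move=> es esH; have [u v /esH[]//|c pc cd] := @konig_sub es.
  by exists c => // u v /cd.
have [phisym phiinj] := pphi.
have phid' u v : inner u v -> phi u v < d by move=> /phid[].
have [psi [[psisym psiinj] psid Bpsi]] := free_coloring pphi Bphi.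
(* Off the smooth part, kept colors are raised by one into 1, ..., d, which leaves 0 to the free
   edges. *)
pose c u v := if `[< smooth_part u >] then cb u v
  else if `[< kept phi u v >] then (phi u v).+1 else psi u v.
have cP u v : E u v -> [\/ smooth_part u /\ c u v = cb u v,
    ~ smooth_part u /\ kept phi u v /\ c u v = (phi u v).+1 |
    ~ smooth_part u /\ free phi u v /\ c u v = psi u v].
  move=> uv; rewrite /c; case: asboolP => su; first by constructor 1.
  by case: asboolP => k; [constructor 2|constructor 3].
exists c; split; first split.
- move=> u v uv; have vu := Esym uv.
  case: (cP _ _ uv) (cP _ _ vu) => [[su ->]|[su [k ->]]|[su [f ->]]] [[sv ->]|[sv [k' ->]]|[sv [f' ->]]].
  + exact: cbsym.
  + by case: sv; apply/(smooth_part_E uv).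
  + by case: sv; apply/(smooth_part_E uv).
  + by case: su; apply/(smooth_part_E uv).
  + by rewrite phisym//; case: k.
  + by case: f' => _ _ []; exact: kept_sym.
  + by case: su; apply/(smooth_part_E uv).
  + by case: f => _ _ []; exact: kept_sym.
  + exact: psisym.
- move=> u v w uv uw.
  case: (cP _ _ uv) (cP _ _ uw) => [[su ->]|[su [k ->]]|[su [f ->]]] [[sv ->]|[sv [k' ->]]|[sv [f' ->]]] //.
  + exact: cbinj.
  + by case=> e; apply: phiinj e; [case: k|case: k'].
  + have [_ [+ _]] := psid _ _ f'; have := kept_gt_kap k => lt le e.
    by move: lt; rewrite ltnNge e le.
  + have [_ [+ _]] := psid _ _ f; have := kept_gt_kap k' => lt le e.
    by move: lt; rewrite ltnNge -e le.
  + exact: psiinj.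
- move=> u v uv; case: (cP _ _ uv) => [[su ->]|[su [k ->]]|[su [f ->]]].
  + exact/ltnW/cbd.
  + by apply: phid'; case: k.
  + by have [] := psid _ _ f.
move=> i u v; apply: (@sal_iff _ B (fun x =>
   ((E (act u x) (act v x) /\ smooth_part (act u x)) /\ cb (act u x) (act v x) = i) \/
   (~ smooth_part (act u x) /\ kept phi (act u x) (act v x) /\
     exists j, (inner (act u x) (act v x) /\ phi (act u x) (act v x) = j) /\ j.+1 = i) \/
   (free phi (act u x) (act v x) /\ psi (act u x) (act v x) = i))).
  move=> x; split.
    case=> [[[uv su]]|[[su [k [j [[[uv _ _] <-] ji]]]]|[f]]].
    - by case: (cP _ _ uv) => [[_ ->]|[[]]|[[]]].
    - by case: (cP _ _ uv) => [[]//|[_ [_ ->]]|[_ [[_ _ []]]]].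
    - have [uv nsu nk] := f; case: (cP _ _ uv) => [[]//|[_ [/nk]]//|[_ [_ ->]]] //.
  case=> uv; case: (cP _ _ uv) => [[su ->]|[su [k ->]]|[su [f ->]]] ci; [by left| |by right; right].
  by right; left; split=> //; split=> //; exists (phi (act u x) (act v x)); split=> //; split=> //; case: k.
apply: (sal_or sB) => //; apply: (sal_or sB) => //.
apply: (sal_and sB); first by apply: (sal_not sB); exact: B_smooth_part.
apply: (sal_and sB); first exact: B_kept.
apply: (sal_ex sB) => j; apply: (sal_and sB) => //; exact: (sal_cst sB).
Qed.

End two_ended.

End countable_borel_graph.

(** * Coding Polish spaces in the Baire space *)

Section polish_coding.
Local Open Scope ring_scope.
Import Order.TTheory GRing.Theory Num.Theory.
Variables (R : realType) (X : topologicalType) (S : set X) (d : X -> X -> R) (num : X -> nat).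
Hypotheses (S_dense : dense S) (d_metric : metric_on d) (d_nbhs : metric_induces d)
  (d_complete : metric_complete d) (num_inj : {in S &, injective num}).

Let d_ge0 x y : 0 <= d x y. Proof. by case: d_metric. Qed.
Let d_sym x y : d x y = d y x. Proof. by case: d_metric. Qed.
Let d_xx x : d x x = 0. Proof. by case: d_metric => _ H _ _; apply/H. Qed.
Let d_tri y x z : d x z <= d x y + d y z. Proof. by case: d_metric. Qed.

Let eps j : R := j.+1%:R^-1.

Let eps_gt0 j : 0 < eps j. Proof. by rewrite invr_gt0 ltr0Sn. Qed.

Let eps_small (e : R) : 0 < e -> exists j, eps j + eps j < e.
Proof.
move=> e0; have [|j Hj] := @ltr_add_invr R 0 (e / 2); first exact: divr_gt0.
exists j; have {}Hj : eps j < e / 2 by move: Hj; rewrite add0r.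
by rewrite [ltRHS]splitr ltrD.
Qed.

Let dball_open x e : open [set y | d x y < e].
Proof.
rewrite openE => y /= xy; apply/d_nbhs; exists (e - d x y); first by rewrite subr_gt0.
by move=> z /= yz; have := d_tri y x z; lra.
Qed.

Let dense_ball x e : 0 < e -> exists2 s, S s & d s x < e.
Proof.
move=> e0; have [||s [/= xs Ss]] := S_dense (O := [set y | d x y < e]).
- by exists x; rewrite /= d_xx.
- exact: dball_open.
by exists s => //; rewrite d_sym.
Qed.

Definition center n s := S s /\ num s = n.

Let center_inj n s s' : center n s -> center n s' -> s = s'.
Proof. by move=> [Ss sn] [Ss' sn']; apply: num_inj; rewrite ?inE// sn. Qed.

Definition cell n j x := exists s, center n s /\ d s x < eps j.

Definition code x : baire := fun k => `[< cell (decode2 k).1 (decode2 k).2 x >].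

Let codeE n j x : code x (code2 (n, j)) = 1%N <-> cell n j x.
Proof. by rewrite /code code2K /=; split=> [|H]; [case: asboolP|rewrite asboolT]. Qed.

Lemma code_le1 x k : (code x k <= 1)%N.
Proof. by rewrite /code; case: (`[< _ >]). Qed.

Lemma code_open k : open [set x | code x k = 1%N].
Proof.
have -> : [set x | code x k = 1%N] = [set x | cell (decode2 k).1 (decode2 k).2 x].
  by apply/seteqP; split=> x /=; rewrite -codeE -surjective_pairing decode2K.
rewrite openE => x [s [cs sx]].
apply: (filterS (P := [set y | d s y < eps (decode2 k).2])); first by move=> y sy; exists s.
exact: open_nbhs_nbhs.
Qed.

Lemma code_base O x : open O -> O x ->
  exists k, code x k = 1%N /\ [set y | code y k = 1%N] `<=` O.
Proof.
rewrite openE => H /H /d_nbhs[e e0 eO]; have [j Hj] := eps_small e0.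
have [s Ss sx] := dense_ball x (eps_gt0 j).
exists (code2 (num s, j)); split; first by apply/codeE; exists s.
move=> y /codeE[s' [cs' sy]]; have es : s' = s by apply: center_inj cs' _.
rewrite es in sy; apply: eO => /=; have := d_tri s x y; rewrite (d_sym x s); lra.
Qed.

Lemma code_inj : injective code.
Proof.
move=> x y xy; apply: contrapT => ne.
have e0 : 0 < d x y.
  rewrite lt0r d_ge0 andbT; apply/eqP => H; apply: ne.
  by case: d_metric => _ /(_ x y)[+ _] _ _; apply.
have [k [xk sub]] := code_base (dball_open x (d x y)) (x := x) ltac:(by rewrite /= d_xx).
by have /= := sub y; rewrite -xy xk ltxx => /(_ erefl).
Qed.

Definition inside n' j' n j := exists s s', [/\ center n s, center n' s' &
  d s s' + eps j' < eps j].

(** Rounded filters of formal balls: values 0 and 1, arbitrarily small balls, refinement, pairwise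
    consistency, upward closure. Only the countably many centers are mentioned, which makes the
    range of [code] Borel. *)
Definition filter_code (c : baire) := (forall k, c k = 0%N \/ c k = 1%N) /\
  (forall j, exists n, c (code2 (n, j)) = 1%N) /\
  (forall n j, c (code2 (n, j)) = 1%N ->
     exists n' j', c (code2 (n', j')) = 1%N /\ inside n' j' n j) /\
  (forall n j n' j', c (code2 (n, j)) = 1%N -> c (code2 (n', j')) = 1%N ->
     exists s s', [/\ center n s, center n' s' & d s s' < eps j + eps j']) /\
  (forall n' j' n j, inside n' j' n j -> c (code2 (n', j')) = 1%N -> c (code2 (n, j)) = 1%N).

Lemma filter_code_code x : filter_code (code x).
Proof.
split; first by move=> k; rewrite /code; case: asboolP; [right|left].
split.
  move=> j; have [s Ss sx] := dense_ball x (eps_gt0 j).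
  by exists (num s); apply/codeE; exists s.
split.
  move=> n j /codeE[s [cs sx]].
  have [|j' Hj'] := @eps_small (eps j - d s x); first by rewrite subr_gt0.
  have [s' Ss' s'x] := dense_ball x (eps_gt0 j').
  exists (num s'), j'; split; first by apply/codeE; exists s'.
  by exists s, s'; split=> //; have := d_tri x s s'; rewrite (d_sym x s'); lra.
split.
  move=> n j n' j' /codeE[s [cs sx]] /codeE[s' [cs' s'x]]; exists s, s'; split=> //.
  by have := d_tri x s s'; rewrite (d_sym x s'); lra.
move=> n' j' n j [s [s' [cs cs' ss']]] /codeE[s'' [cs'' sx]].
rewrite (center_inj cs'' cs') in sx.
by apply/codeE; exists s; split=> //; have := d_tri s' s x; lra.
Qed.

(** Centers of shrinking balls of the filter form a Cauchy sequence. Its limit is in the closed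
    version of every ball of the filter, and refinement puts it in the open one. *)
Lemma filter_code_range c : filter_code c -> exists x, code x = c.
Proof.
move=> [c01 [/choice[n Hn] [Cin [Cclose Cup]]]].
have /choice[s Hs] : forall j, exists s, center (n j) s.
  by move=> j; have [s [_ [cs _ _]]] := Cclose _ _ _ _ (Hn j) (Hn j); exists s.
have close m j k s' : c (code2 (m, j)) = 1%N -> center m s' -> d s' (s k) < eps j + eps k.
  move=> cm cs'; have [t [t' [ct ct']]] := Cclose _ _ _ _ cm (Hn k).
  by rewrite (center_inj ct cs') (center_inj ct' (Hs k)).
have [l /= sl] : exists l : X, s @ \oo --> l.
  apply: d_complete => e e0; have [N HN] := eps_small e0; exists N => i j Ni Nj.
  have le k : (N <= k)%N -> eps k <= eps N.
    by move=> Nk; rewrite lef_pV2 ?posrE ?ltr0Sn// ler_nat ltnS.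
  apply: lt_trans HN; apply: lt_le_trans (close _ _ _ _ (Hn i) (Hs i)) _.
  by apply: lerD; exact: le.
have lim m j s' : c (code2 (m, j)) = 1%N -> center m s' -> d s' l <= eps j.
  move=> cm cs'; rewrite leNgt; apply/negP => lt.
  have [|N HN] := @eps_small (d s' l - eps j); first by rewrite subr_gt0.
  have /sl[M _ HM] : nbhs l [set y | d l y < eps N].
    by apply: open_nbhs_nbhs; split; [exact: dball_open|rewrite /= d_xx].
  pose k := maxn M N; have /= lk := HM k (leq_maxl _ _).
  have lek : eps k <= eps N by rewrite lef_pV2 ?posrE ?ltr0Sn// ler_nat ltnS leq_maxr.
  by have := close _ _ k _ cm cs'; have := d_tri (s k) s' l; rewrite (d_sym (s k) l); lra.
exists l; apply/funext => k; rewrite -(decode2K k); case: (decode2 k) => m j.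
have H : code l (code2 (m, j)) = 1%N <-> c (code2 (m, j)) = 1%N.
  rewrite codeE; split=> [[s' [cs' sl']]|cm].
    have [|j' Hj'] := @eps_small (eps j - d s' l); first by rewrite subr_gt0.
    apply: Cup (Hn j'); exists s', (s j'); split=> //.
    have := lim _ _ _ (Hn j') (Hs j'); have := d_tri l s' (s j').
    by rewrite (d_sym l (s j')); lra.
  have [m' [j' [cm' [s0 [s1 [cs0 cs1 lt]]]]]] := Cin _ _ cm; exists s0; split=> //.
  by have := lim _ _ _ cm' cs1; have := d_tri s1 s0 l; lra.
case: (c01 (code2 (m, j))) => e; last by rewrite e; apply/H.
rewrite e; have := code_le1 l (code2 (m, j)); rewrite leq_eqVlt ltnS leqn0.
by case/orP => /eqP // /H; rewrite e.
Qed.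

Lemma BN_filter_code : BN [set c | filter_code c].
Proof.
have cst P := sal_cst sBN P.
apply: (sal_and sBN).
  by apply: (sal_all sBN) => k; apply: (sal_or sBN); exact: BN_coord.
apply: (sal_and sBN).
  by apply: (sal_all sBN) => j; apply: (sal_ex sBN) => n; exact: BN_coord.
apply: (sal_and sBN).
  apply: (sal_all sBN) => n; apply: (sal_all sBN) => j; apply: (sal_imp sBN); first exact: BN_coord.
  apply: (sal_ex sBN) => n'; apply: (sal_ex sBN) => j'.
  by apply: (sal_and sBN); [exact: BN_coord|exact: cst].
apply: (sal_and sBN); do 4 apply: (sal_all sBN) => ?.
  by do 2 (apply: (sal_imp sBN); first exact: BN_coord); exact: cst.
by apply: (sal_imp sBN); first exact: cst; apply: (sal_imp sBN); exact: BN_coord.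
Qed.

End polish_coding.

Theorem polish_coding (R : realType) (X : topologicalType) : polish R X ->
  exists h : X -> baire, [/\ injective h, forall x k, h x k <= 1,
    forall k, open [set x | h x k = 1],
    forall O x, open O -> O x -> exists k, h x k = 1 /\ [set y | h y k = 1] `<=` O &
    BN (range h)].
Proof.
move=> [[S /countable_injP[num num_inj] S_dense] [d [dm dn dc]]].
exists (code S d num); split.
- exact: code_inj.
- exact: code_le1.
- exact: code_open.
- exact: code_base.
suff -> : range (code S d num) = [set c | filter_code S d num c] by exact: BN_filter_code.
apply/seteqP; split=> [_ [x _ <-]|c /(filter_code_range dm dn dc num_inj)[x <-]]; last by exists x.
exact: filter_code_code.
Qed.

(** * Bipartite and two-ended graphs *)

Lemma inj_card T U (A : set T) (B : set U) (f : T -> U) :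
  {in A &, injective f} -> (forall x, A x -> B (f x)) -> A #<= B.
Proof.
move=> injf AB; have /card_eqPle[_ +] := inj_card_eq injf.
by move=> /card_le_trans; apply; apply: subset_card_le => _ [x /AB ? <-].
Qed.

Lemma seq_card (T : eqType) (A : set T) (s : seq T) :
  uniq s -> {in s, forall x, A x} -> `I_(size s) #<= A.
Proof.
case: s => [|x0 s] us sA; first by rewrite II0 card_ge0.
apply: (inj_card (f := nth x0 (x0 :: s))) => [i j|i /= im]; last exact/sA/mem_nth.
by rewrite !inE => im jm /eqP; rewrite nth_uniq// => /eqP.
Qed.

Lemma reach_rt (X : Type) (Q : X -> X -> Prop) x y : reach Q x y <-> clos_refl_trans X Q x y.
Proof.
split=> [xy|]; last first.
  elim=> [u v|u|u v w _ uv _ vw]; [exact: reach1|exact: reach_refl|exact: reach_trans uv vw].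
apply: (reach_ind xy); first exact: rt_refl.
by move=> u v _ xu uv; apply: rt_trans xu _; exact: rt_step.
Qed.

Section graph_translation.
Variables (X : topologicalType) (G : borelGraph X).

Definition Ed x y := edge G (x, y).

Lemma Ed_sym x y : Ed x y -> Ed y x. Proof. exact: edge_sym. Qed.

Lemma steps_walk n x y : steps Ed n x y -> exists p : nat -> X,
  [/\ p 0 = x, p n = y & forall i, i < n -> Ed (p i) (p i.+1)].
Proof.
elim: n x => [x ->|n IH x [z [xz /IH[p [p0 pn Hp]]]]]; first by exists (fun=> y).
exists (fun i => if i is j.+1 then p j else x); split=> // -[_|i /Hp//].
by rewrite p0.
Qed.

Lemma walk_steps (p : nat -> X) i k : (forall j, i <= j -> j < i + k -> Ed (p j) (p j.+1)) ->
  steps Ed k (p i) (p (i + k)).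
Proof.
elim: k i => [|k IH] i Hp; first by rewrite addn0.
exists (p i.+1); split; first by apply: Hp; lia.
by rewrite addnS -addSn; apply: IH => j ij jk; apply: Hp; lia.
Qed.

(** An odd closed walk without repetition is an odd cycle; one with a repetition splits there into
    two shorter closed walks, one of them odd. *)
Lemma bipartite_no_odd_walk n x : bipartite G -> odd n -> ~ steps Ed n x x.
Proof.
move=> bip; elim/ltn_ind: n x => n IH x on /steps_walk[p [p0 pn Hp]].
have [inj|ninj] := pselect (forall i j, i < j -> j < n -> p i <> p j).
  have n0 : 0 < n by case: n on {IH pn Hp inj}.
  have cyc : is_cycle G (fun i : 'I_n => p i).
    split=> [i j pij|i].
      apply/val_inj; case: (ltngtP i j) => // ij.
        by case: (inj _ _ ij (ltn_ord j) pij).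
      by case: (inj _ _ ij (ltn_ord i) (esym pij)).
    have -> : p (ordS i) = p i.+1; last exact: Hp.
    rewrite /=; have [lt|] := ltnP i.+1 n; first by rewrite modn_small.
    move=> le; have -> : i.+1 = n by have := ltn_ord i; lia.
    by rewrite modnn p0 pn.
  by have := bip _ _ cyc; rewrite on.
have [i [j [ij jn pij]]] : exists i j, [/\ i < j, j < n & p i = p j].
  apply: contrapT => H; apply: ninj => i j ij jn pij; apply: H; by exists i, j.
have s1 : steps Ed (j - i) (p i) (p i).
  have := @walk_steps p i (j - i); rewrite subnKC ?(ltnW ij)// -pij; apply=> k _ kj.
  by apply: Hp; lia.
have s2 : steps Ed (i + (n - j)) x x.
  apply: (steps_cat (y := p i)).
    by rewrite -p0; apply: (@walk_steps p 0 i) => k _ ki; apply: Hp; lia.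
  have := @walk_steps p j (n - j); rewrite subnKC ?(ltnW jn)// pij pn; apply=> k _ kj.
  by apply: Hp; lia.
have [d1|d1] := boolP (odd (j - i)); first by apply: IH d1 s1; lia.
by apply: IH _ s2; move: on d1; lia.
Qed.

Lemma bipartition : bipartite G -> exists side : X -> bool, forall u v, Ed u v -> side u <> side v.
Proof.
move=> bip; have [[x0 _]|nX] := pselect (exists x : X, True); last first.
  by exists (fun=> true) => u; case: nX; exists u.
(* The base point is chosen from the component as a set, so adjacent vertices share it; the side is
   the parity of a walk from it. *)
have /choice[r Hr] : forall A : set X, exists y, A !=set0 -> A y.
  move=> A; have [[y Ay]|nA] := pselect (A !=set0); first by exists y.
  by exists x0 => /nA.
pose P x n := steps Ed n (r (reach Ed x)) x.
exists (fun x => `[< exists2 n, odd n & P x n >]) => u v uv.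
have rE : reach Ed u = reach Ed v.
  apply/funext => z; apply/propext; split; apply: reach_trans; apply: reach1 => //.
  exact: Ed_sym.
have [n Pn] : exists n, P u n.
  have [n un] : reach Ed u (r (reach Ed u)).
    by apply: Hr; exists u; exact: reach_refl.
  by exists n; apply: steps_sym => //; exact: Ed_sym.
have Pv m : P u m -> P v m.+1.
  by move=> Pm; rewrite /P -rE -addn1; apply: steps_cat Pm _; exists v.
case: asboolP => [[m om Pm]|nu]; case: asboolP => [[k ok Pk]|nv] // _.
  have Pk' : steps Ed k v (r (reach Ed u)).
    by rewrite rE; apply: steps_sym Pk; exact: Ed_sym.
  apply: (@bipartite_no_odd_walk (m.+1 + k) (r (reach Ed u)) bip).
    by rewrite oddD /= om ok.
  have vu := steps_sym Ed_sym Pk'; have := Pv _ Pm; rewrite /P -rE => H.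
  exact: steps_cat H Pk'.
have [dn|dn] := boolP (odd n); first by apply: nu; exists n.
by apply: nv; exists n.+1 => //; exact: Pv.
Qed.

Lemma componentE (F : set X) x y : F `<=` component G setT x -> component G setT x y -> ~ F y ->
  component G (component G setT x `\` F) y = cc Ed F y.
Proof.
move=> FC Cy nFy; apply/seteqP; split=> z.
  move=> /reach_rt; apply: reach_mono => u v [[_ Fu] [_ Fv] uv]; exact: And3.
move=> yz; apply/reach_rt.
have step u v : component G setT x u -> Ed u v -> component G setT x v.
  by move=> Cu uv; apply: rt_trans Cu (rt_step _ _ _ _ _).
have [] // : component G setT x z /\ reach (fun u v => [/\ (component G setT x `\` F) u,
   (component G setT x `\` F) v & edge G (u, v)]) y z.
apply: (reach_ind (P := fun z => component G setT x z /\ reach _ y z) yz).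
  by split=> //; exact: reach_refl.
move=> u v _ [Cu yu] [uv Fu Fv]; have Cv := step _ _ Cu uv; split=> //.
by apply: (reach_trans yu (reach1 _)).
Qed.

Lemma bigE (F : X -> Prop) y : big Ed F y <-> infinite_set (cc Ed F y).
Proof.
split=> [bF /finite_seqP[s Hs]|iF s].
  have [z zs yz] := bF s; have : [set` s] z by rewrite -Hs.
  by move=> /= zs'; rewrite zs' in zs.
apply: contrapT => H; apply: iF; apply: (@sub_finite_set _ _ [set` s]); last first.
  by apply/finite_seqP; exists s.
by move=> z yz /=; apply/negPn/negP => zs; apply: H; exists z.
Qed.

Lemma componentT x y : component G setT x y <-> reach Ed x y.
Proof.
split=> [/reach_rt|H]; last apply/reach_rt; first by apply: reach_mono => u v [].
by apply: reach_mono H.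
Qed.

Lemma component_big (F : set X) x y : F `<=` component G setT x ->
  component G setT x y -> ~ F y -> big Ed F y ->
  infinite_components G (component G setT x `\` F) (cc Ed F y).
Proof.
move=> FC Cy nFy /bigE bF; split=> //; exists y; first by split.
by rewrite componentE.
Qed.

Hypothesis ends : components_two_ended G.

Lemma two_ended_not_three (s : seq X) (F := inseq s) y1 y2 y3 :
  reach Ed y1 y2 -> reach Ed y1 y3 -> ~ F y1 -> ~ F y2 -> ~ F y3 ->
  big Ed F y1 -> big Ed F y2 -> big Ed F y3 ->
  ~ cc Ed F y1 y2 -> ~ cc Ed F y1 y3 -> ~ cc Ed F y2 y3 -> False.
Proof.
move=> c12 c13 n1 n2 n3 b1 b2 b3 n12 n13 n23.
(* Ends are counted with finite sets inside the component, so [F] is cut down to [C], which changes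
   no component within [C]. *)
pose C := component G setT y1; pose F' : set X := [set u | F u /\ C u].
have ccE y : C y -> cc Ed F y = cc Ed F' y.
  move=> Cy; apply/funext => z; apply/propext; split.
    by apply: cc_mono => u [].
  move=> yz; have [] // : C z /\ cc Ed F y z.
  apply: (reach_ind (P := fun z => C z /\ cc Ed F y z) yz); first by split=> //; exact: reach_refl.
  move=> u v _ [Cu yu] [uv nu nv].
  have Cv : C v by apply/componentT; apply: (reach_trans _ (reach1 uv)); exact/componentT.
  split=> //; apply: (reach_trans yu (reach1 _)).
  by split=> // H; [apply: nu|apply: nv].
have C1 : C y1 by apply/componentT; exact: reach_refl.
have C2 : C y2 by exact/componentT.
have C3 : C y3 by exact/componentT.
have FC : F' `<=` C by move=> u [].
have fF : finite_set F'.
  by apply: (@sub_finite_set _ _ [set` s]) => [u []//|]; apply/finite_seqP; exists s.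
have nF' y : ~ F y -> ~ F' y by move=> n [].
have [/(_ F' (conj fF FC)) + _] := ends y1; rewrite -/C.
have bE y : C y -> big Ed F y -> big Ed F' y by move=> Cy /bigE; rewrite ccE// => /bigE.
have I1 := component_big FC C1 (nF' _ n1) (bE _ C1 b1).
have I2 := component_big FC C2 (nF' _ n2) (bE _ C2 b2).
have I3 := component_big FC C3 (nF' _ n3) (bE _ C3 b3).
move=> le2; suff : `I_3 #<= `I_2 by rewrite card_le_II.
apply: card_le_trans le2.
rewrite !ccE// in n12 n13 n23.
apply: (@seq_card (set X) _ [:: cc Ed F' y1; cc Ed F' y2; cc Ed F' y3]).
  have ne y y' : C y -> ~ cc Ed F' y y' -> cc Ed F' y != cc Ed F' y'.
    move=> _ nyy'; apply/eqP => e; apply: nyy'; rewrite e; exact: reach_refl.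
  by rewrite /= !inE negb_or !ne.
by move=> A; rewrite !inE => /or3P[]/eqP ->.
Qed.

Lemma two_ended_has_two x : exists (s : seq X) y1 y2,
  [/\ forall z, z \in s -> reach Ed x z, reach Ed x y1 /\ reach Ed x y2,
      ~ inseq s y1 /\ ~ inseq s y2, big Ed (inseq s) y1 /\ big Ed (inseq s) y2 &
      ~ cc Ed (inseq s) y1 y2].
Proof.
have [_ least2] := ends x; set C := component G setT x in least2.
(* If every finite set left at most one infinite component, 1 would be an upper bound and the
   supremum could not be 2. *)
have [F [fF FC] nF] : exists2 F, finite_set F /\ F `<=` C &
    ~ (infinite_components G (C `\` F) #<= `I_1).
  apply: contrapT => H; have : `I_2 #<= `I_1; last by rewrite card_le_II.
  by apply: least2 => F HF; apply: contrapT => nF; apply: H; exists F.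
have [s Fs] := (finite_seqP F).1 fF.
have FE : inseq s = F by rewrite Fs.
have [A [A' [IA IA' AA']]] : exists A A', [/\ infinite_components G (C `\` F) A,
    infinite_components G (C `\` F) A' & A <> A'].
  have [[A IA]|nA] := pselect (exists A, infinite_components G (C `\` F) A); last first.
    case: nF; suff -> : infinite_components G (C `\` F) = set0 by exact: card_ge0.
    by apply/seteqP; split=> // A IA; case: nA; exists A.
  apply: contrapT => H; apply: nF; apply: (@card_le_trans _ _ _ [set A]).
    apply: subset_card_le => A' IA' /=; apply/esym; apply: contrapT => AA'; apply: H.
    by exists A, A'.
  by have /card_eqPle[] := @card_set1 _ A.
case: IA IA' => iA [y [Cy Fy] Ey] [iA' [y' [Cy' Fy'] Ey']].
rewrite componentE// in Ey; rewrite componentE// in Ey'.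
exists s, y, y'; rewrite FE; split=> //.
- by move=> z zs; apply/componentT; apply: FC; rewrite Fs.
- by split; exact/componentT.
- by split; apply/bigE; rewrite -?Ey -?Ey'.
move=> yy'; apply: AA'; rewrite Ey Ey'; apply/funext => z; apply/propext.
by split; apply: reach_trans => //; exact: (cc_sym Ed_sym).
Qed.

End graph_translation.

(** * Borel colorings of graphs on Polish spaces *)

Lemma sborel (T : topologicalType) : sigma_algebra setT (@borel T).
Proof. exact: smallest_sigma_algebra. Qed.

Lemma open_borel (T : topologicalType) (O : set T) : open O -> borel O.
Proof. exact: sub_sigma_algebra. Qed.

Lemma borel_preimage (T U : topologicalType) (f : T -> U) (A : set U) :
  (forall O, open O -> open (f @^-1` O)) -> borel A -> borel (f @^-1` A).
Proof.
move=> fO; apply: (sal_gen_preimage (sborel T)) => O oO; exact: (open_borel (fO O oO)).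
Qed.

Lemma borel_from_code (T : topologicalType) (f : T -> baire) :
  (forall O, open O -> exists B, BN B /\ O = f @^-1` B) ->
  forall A, borel A -> exists B, BN B /\ A = f @^-1` B.
Proof.
move=> fO; suff : @borel T `<=` [set A | exists B, BN B /\ A = f @^-1` B] by [].
apply: smallest_sub => [|O]; last exact: fO.
split=> [|_ [B [BB ->]]|A HA].
- exists set0; split; [by case: sBN|by rewrite preimage_set0].
- by exists (~` B); split; [exact: (sal_not sBN BB)|rewrite setTD preimage_setC].
- have [B HB] := choice HA; exists (\bigcup_n B n); split.
    by case: sBN => _ _; apply=> n; case: (HB n).
  by rewrite preimage_bigcup; apply: eq_bigcupr => n _; case: (HB n).
Qed.

Lemma fst_open_preimage (T : topologicalType) (O : set T) : open O -> open (@fst T T @^-1` O).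
Proof.
rewrite !openE => oO [x y] /= Ox; exists (O, setT) => /=; last by move=> [u v] [].
by split; [exact: oO|exact: filterT].
Qed.

Lemma snd_open_preimage (T : topologicalType) (O : set T) : open O -> open (@snd T T @^-1` O).
Proof.
rewrite !openE => oO [x y] /= Oy; exists (setT, O) => /=; last by move=> [u v] [].
by split; [exact: filterT|exact: oO].
Qed.

Section coded_space.
Variables (X : topologicalType) (h : X -> baire).
Hypotheses (h_inj : injective h) (h01 : forall x k, h x k <= 1)
  (h_open : forall k, open [set x | h x k = 1])
  (h_base : forall O x, open O -> O x -> exists k, h x k = 1 /\ [set y | h y k = 1] `<=` O)
  (h_range : BN (range h)).

Lemma borel_coord k a : borel [set x | h x k = a].
Proof.
have sb := sborel X; case: a => [|[|a]]; last 2 first.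
- exact: open_borel.
- apply: (@sal_iff _ (@borel X) (fun=> False)); last exact: (sal_cst sb).
  by move=> x; split=> // e; have := h01 x k; rewrite e.
apply: (@sal_iff _ (@borel X) (fun x => ~ h x k = 1)); last exact: (sal_not sb (open_borel (h_open k))).
by move=> x; have := h01 x k; case: (h x k) => [|[]].
Qed.

Definition h2 (e : X * X) := bpair (h e.1) (h e.2).

Lemma h2_inj : injective h2.
Proof.
move=> [x y] [x' y'] e; congr (_, _); apply: h_inj.
  by have := congr1 bfst e; rewrite !bpairK1.
by have := congr1 bsnd e; rewrite !bpairK2.
Qed.

Lemma borel_fst A : borel A -> borel [set e : X * X | A e.1].
Proof. by apply: borel_preimage; exact: fst_open_preimage. Qed.

Lemma borel_snd A : borel A -> borel [set e : X * X | A e.2].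
Proof. by apply: borel_preimage; exact: snd_open_preimage. Qed.

Lemma borel_h2 B : BN B -> borel (h2 @^-1` B).
Proof.
apply: sal_preimage => [|k a]; first exact: sborel.
rewrite /h2 /bpair; case: (odd k).
  exact: (borel_snd (borel_coord _ _)).
exact: (borel_fst (borel_coord _ _)).
Qed.

Lemma borel_h2_flip B : BN B -> borel [set e | B (h2 (flip e))].
Proof.
apply: (sal_preimage (h := h2 \o (@flip X))) => [|k a]; first exact: sborel.
rewrite /h2 /bpair /=; case: (odd k).
  exact: (borel_fst (borel_coord _ _)).
exact: (borel_snd (borel_coord _ _)).
Qed.

(** An open set of the square is a countable union of boxes of basic sets, and membership in a box
    is decided by two coordinates of the code. *)
Lemma borel2_code A : borel A -> exists B, BN B /\ A = h2 @^-1` B.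
Proof.
apply: borel_from_code => O; rewrite openE => oO.
exists [set p | exists k l, (forall y z, h y k = 1 -> h z l = 1 -> O (y, z)) /\
  bfst p k = 1 /\ bsnd p l = 1]; split.
  apply: (sal_ex sBN) => k; apply: (sal_ex sBN) => l.
  apply: (sal_and sBN); first exact: (sal_cst sBN).
  by apply: (sal_and sBN); exact: BN_preimage_reidx (BN_coord _ _).
apply/seteqP; split=> [[x y]|[x y] [k [l [H]]]]; last first.
  by rewrite bpairK1 bpairK2 => -[]; exact: H.
move=> /oO[[P Q] /= [xP yQ] PQ].
have [k [xk kP]] := h_base (open_interior P) xP.
have [l [yl lQ]] := h_base (open_interior Q) yQ.
exists k, l; rewrite bpairK1 bpairK2; split=> // u v uk vl; apply: PQ; split => /=.
  exact: (interior_subset (kP _ uk)).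
exact: (interior_subset (lQ _ vl)).
Qed.

(** The image is the trace of a Borel set on the square of the range of [h], and that range is
    Borel. *)
Lemma BN_image2 A : borel A -> BN (h2 @` A).
Proof.
move=> /borel2_code[B [BB ->]].
have -> : h2 @` (h2 @^-1` B) = [set p | B p /\ (range h (bfst p) /\ range h (bsnd p))].
  apply/seteqP; split=> [_ [[x y] /= Bxy <-]|p [Bp [[x _ xp] [y _ yp]]]].
    by split=> //; rewrite bpairK1 bpairK2; split; [exists x|exists y].
  by exists (x, y); rewrite /= /h2 /= xp yp bpair_surj.
apply: (sal_and sBN) => //.
by apply: (sal_and sBN); exact: BN_preimage_reidx h_range.
Qed.

Lemma borel_proj (A : set (X * X)) : borel A ->
  (forall x y y', A (x, y) -> A (x, y') -> y = y') -> borel [set x | exists y, A (x, y)].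
Proof.
move=> /BN_image2 BA funA.
have /BN_proj : funlike (h2 @` A).
  move=> _ _ [[x y] Axy <-] [[x' y'] Axy' <-]; rewrite !bpairK1 /= => /h_inj xx'.
  by rewrite xx' in Axy *; rewrite (funA _ _ _ Axy Axy').
move=> /(_ BA) /(sal_preimage (sborel X) borel_coord); congr borel.
apply/seteqP; split=> [x [_ [[x' y] Axy <-]]|x [y Axy]].
  by rewrite bpairK1 /= => /h_inj <-; exists y.
by exists (h2 (x, y)); [exists (x, y)|rewrite bpairK1].
Qed.

Lemma borel_lex : borel [set e : X * X | lex h e.1 e.2].
Proof.
have sb := sborel (X * X)%type.
have b1 k a : borel [set e : X * X | h e.1 k = a] := borel_fst (borel_coord k a).
have b2 k a : borel [set e : X * X | h e.2 k = a] := borel_snd (borel_coord k a).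
apply: (sal_ex sb) => k; apply: (sal_and sb).
  apply: (sal_all sb) => j; apply: (sal_imp sb); first exact: (sal_cst sb).
  apply: (@sal_iff _ (@borel (X * X)%type) (fun e : X * X => exists a, h e.1 j = a /\ h e.2 j = a)).
    by move=> e; split=> [[a [-> ->]]|->] //; exists (h e.2 j).
  by apply: (sal_ex sb) => a; apply: (sal_and sb).
apply: (@sal_iff _ (@borel (X * X)%type) (fun e : X * X => exists a b, h e.1 k = a /\ h e.2 k = b /\ a < b)).
  by move=> e; split=> [[a [b [-> [->]]]]|lt] //; exists (h e.1 k), (h e.2 k).
apply: (sal_ex sb) => a; apply: (sal_ex sb) => b.
by do 2 (apply: (sal_and sb) => //); exact: (sal_cst sb).
Qed.

(* A thin set meets a set of pairs with a common first coordinate in a countable set. *)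
Lemma countable_or_perfect :
  countable [set: X] \/ [set: nat -> bool] #<= [set: X].
Proof.
pose z : baire := fun=> 0.
have /BN_param[C [f [cC cf CE _]]] : BN [set p | bfst p = z /\ range h (bsnd p)].
  apply: (sal_and sBN); last exact: BN_preimage_reidx h_range.
  apply: (@sal_iff _ BN (fun p => forall k, bfst p k = z k)).
    by move=> p; split=> [/funext|-> ].
  by apply: (sal_all sBN) => k; exact: BN_preimage_reidx (BN_coord _ _).
have inC x : (f @` C) (bpair z (h x)) by rewrite -CE /= bpairK1 bpairK2; split=> //; exists x.
have [[Z [D [HD ->]] CZ]|[x [io [injio Hio _]]]] := thin_or_perfect cC cf.
  left; apply/countable_injP; pose n x := least (fun n => D n (bpair z (h x))).
  exists n => x y _ _ nxy; apply: h_inj.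
  have Dn t : D (n t) (bpair z (h t)).
    by apply: (least_spec (P := fun n => D n (bpair z (h t)))); exact: CZ.
  have [_ fD] := HD (n y).
  have /(congr1 bsnd) : bpair z (h x) = bpair z (h y).
    by apply: fD => //; [rewrite -nxy|rewrite !bpairK1].
  by rewrite !bpairK2.
right; have /choice[g Hg] : forall b, exists x, h x = bsnd (io b).
  by move=> b; have := Hio b; rewrite -CE => -[_ [y _ <-]]; exists y.
apply: (inj_card (f := g)) => // b b' _ _ gb; apply: injio.
rewrite -(bpair_surj (io b)) -(bpair_surj (io b')) -!Hg gb.
by have := Hio b; have := Hio b'; rewrite -CE => -[-> _] [-> _].
Qed.

Lemma card_le_cantor : [set: X] #<= [set: nat -> bool].
Proof.
apply: (inj_card (f := fun x k => h x k == 1)) => // x y _ _ e; apply: h_inj.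
apply/funext => k; have := congr1 (@^~ k) e => /=.
by have := h01 x k; have := h01 y k; case: (h x k) (h y k) => [|[|?]] [|[|?]].
Qed.

Lemma card2_le_cantor : [set: X * X] #<= [set: nat -> bool].
Proof.
apply: (inj_card (f := fun x k => h2 x k == 1)) => // x y _ _ e; apply: h2_inj.
apply/funext => k; have := congr1 (@^~ k) e => /=.
have H z : h2 z k <= 1 by rewrite /h2 /bpair; case: ifP => _; exact: h01.
by have := H x; have := H y; case: (h2 x k) (h2 y k) => [|[|?]] [|[|?]].
Qed.

End coded_space.

Section colorability.
Local Open Scope ring_scope.
Import Order.TTheory GRing.Theory Num.Theory.
Variables (R : realType).

Lemma discrete_polish (T : countType) : polish R (discrete_topology T).
Proof.
split.
  exists setT; last by move=> O [x Ox] _; exists x.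
  by apply/countable_injP; exists (@pickle T) => x y _ _ /(pcan_inj pickleK).
exists (fun x y : T => (x != y)%:R); split.
- split=> [x y|x y|x y|x y z]; first exact: ler0n.
  + by case: eqVneq => [->|/eqP ne]; split=> // /eqP; rewrite oner_eq0.
  + by rewrite eq_sym.
  + rewrite -natrD ler_nat; case: (eqVneq x y) => [->|_]; first by rewrite add0n.
    exact: leq_trans (leq_b1 _) (leq_addr _ _).
- move=> x A; rewrite nbhs_principalE; split=> [/principal_filterP Ax|[e e0 He]].
    exists 1 => // y /=; case: eqVneq => [<-//|_]; by rewrite ltxx.
  by apply/principal_filterP; apply: He; rewrite /= eqxx.
move=> u /(_ 1 ltr01)[N HN]; exists (u N) => A; rewrite nbhs_principalE => /principal_filterP AN.
exists N => // n /= Nn; have := HN N n (leqnn _) Nn.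
by case: eqVneq => [<-//|_]; rewrite ltxx.
Qed.

Lemma prod_polish (X : topologicalType) : polish R X -> polish R (X * X)%type.
Proof.
move=> [[S cS dS] [d [[d0 deq dsym dtri] dn dc]]].
have prodE x y (A : set (X * X)) : nbhs (x, y) A <->
    exists2 e : R, 0 < e & forall u v, d x u < e -> d y v < e -> A (u, v).
  split=> [[[P Q] /= [/dn[e e0 eP] /dn[e' e'0 e'Q] PQ]]|[e e0 He]].
    exists (Num.min e e'); first by rewrite lt_min e0.
    move=> u v; rewrite !lt_min => /andP[xu _] /andP[_ yv].
    by apply: PQ; split; [exact: eP|exact: e'Q].
  exists ([set u | d x u < e], [set v | d y v < e]) => /=.
    by split; apply/dn; exists e.
  by move=> [u v] [/=]; exact: He.
split.
  exists (S `*` S).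
    have /countable_injP[f finj] := cS; apply/countable_injP.
    exists (fun e => pickle (f e.1, f e.2)) => -[x y] [x' y'].
    rewrite !inE => -[/= Sx Sy] [/= Sx' Sy'] /(pcan_inj pickleK)[e e'].
    by congr (_, _); apply: finj; rewrite ?inE.
  move=> O [[x y] Oxy]; rewrite openE => /(_ _ Oxy) [[P Q] /= [xP yQ] PQ].
  have dense_nbhs (z : X) (A : set X) : nbhs z A -> exists2 s, S s & A s.
    move=> zA; have [||s [As Ss]] := dS A°; [by exists z|exact: open_interior|].
    by exists s => //; exact: interior_subset.
  have [s Ss Ps] := dense_nbhs _ _ xP; have [t St Qt] := dense_nbhs _ _ yQ.
  by exists (s, t); split=> //; apply: PQ.
exists (fun e f => Num.max (d e.1 f.1) (d e.2 f.2)); split.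
- split=> [e f|[x y] [x' y']|e f|e f i].
  + by rewrite le_max d0.
  + split=> [H|[-> ->]] /=; last by rewrite !(proj2 (deq _ _)) ?maxxx.
    have z u v : d u v <= 0 -> u = v by move=> le; apply/deq/le_anti; rewrite le d0.
    have le1 : d x x' <= 0 by rewrite -H /= le_max lexx.
    have le2 : d y y' <= 0 by rewrite -H /= le_max lexx orbT.
    by rewrite (z _ _ le1) (z _ _ le2).
  + by rewrite (dsym e.1) (dsym e.2).
  + rewrite ge_max; apply/andP; split.
      by apply: le_trans (dtri _ f.1 _) _; apply: lerD; rewrite le_max lexx.
    by apply: le_trans (dtri _ f.2 _) _; apply: lerD; rewrite le_max lexx orbT.
- move=> [x y] A; split=> [/prodE[e e0 He]|[e e0 He]].
    by exists e => // -[u v] /=; rewrite gt_max => /andP[]; exact: He.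
  by apply/prodE; exists e => // u v xu yv; apply: He; rewrite /= gt_max xu.
move=> u Hu; have H (p : X * X -> X) :
    (forall e f, d (p e) (p f) <= Num.max (d e.1 f.1) (d e.2 f.2)) ->
    exists l : X, (fun n => p (u n)) @ \oo --> l.
  move=> Hp; apply: dc => e /Hu[N HN]; exists N => m n Nm Nn.
  exact: le_lt_trans (Hp _ _) (HN _ _ Nm Nn).
have [|l1 H1] := H fst; first by move=> e f; rewrite le_max lexx.
have [|l2 H2] := H snd; first by move=> e f; rewrite le_max lexx orbT.
exists (l1, l2) => A [[P Q] /= [/H1[N _ HN] /H2[M _ HM]] PQ].
exists (maxn N M) => // n /=; rewrite geq_max => /andP[Nn Mn].
by rewrite (surjective_pairing (u n)); apply: PQ; split; [exact: HN|exact: HM].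
Qed.

Variables (X : topologicalType) (G : borelGraph X).

Lemma discrete_colorable (T : countType) (c : X -> X -> T) :
  (forall x y, Ed G x y -> c x y = c y x) ->
  (forall x y z, Ed G x y -> Ed G x z -> c x y = c x z -> y = z) ->
  (forall i, borel [set e | edge G e /\ c e.1 e.2 = i]) ->
  borel_edge_colorable G R T.
Proof.
move=> csym cinj Bc; exists (discrete_topology T); split; first exact: discrete_polish.
  exact: card_eqxx.
pose ce (e : edge G) : discrete_topology T := c (val e).1 (val e).2.
have edgeP (e : edge G) : Ed G (val e).1 (val e).2.
  by rewrite /Ed -surjective_pairing; exact: set_valP.
exists ce; split; first split.
- by move=> e f ef; rewrite /ce ef /=; apply: csym; exact: edgeP.
- move=> e f; move: (edgeP e) (edgeP f); rewrite /ce /share_vertex.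
  case: (val e) (val f) => [x y] [u v] /= xy uv ne nf H cc.
  have yx := Ed_sym xy; have vu := Ed_sym uv.
  case: H => [xu|[xv|[yu|yv]]].
  + by subst u; apply: ne; rewrite (cinj _ _ _ xy uv cc).
  + subst v; rewrite (csym _ _ uv) in cc; apply: nf; rewrite /flip /=.
    by rewrite (cinj _ _ _ xy vu cc).
  + subst u; rewrite (csym _ _ xy) in cc; apply: nf; rewrite /flip /=.
    by rewrite (cinj _ _ _ yx uv cc).
  + subst v; rewrite (csym _ _ xy) (csym _ _ uv) in cc; apply: ne.
    by rewrite (cinj _ _ _ yx vu cc).
move=> B _.
apply: (@sal_iff _ (@borel (X * X)%type) (fun e => exists i : T, B i /\ (edge G e /\ c e.1 e.2 = i))).
  move=> e; split=> [[i [Bi [Ge ci]]]|[e' Be' <-]].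
    exists (SigSub (mem_set Ge)) => //=; by rewrite /ce /= ci.
  exists (ce e'); split=> //; split=> //; exact: set_valP.
have sb := sborel (X * X)%type; apply: (sal_exc sb) => i.
by apply: (sal_and sb); [exact: (sal_cst sb)|exact: Bc].
Qed.

End colorability.

Lemma flip_open_preimage (X : topologicalType) (O : set (X * X)) :
  open O -> open (@flip X @^-1` O).
Proof.
rewrite !openE => oO [x y] /oO[[P Q] /= [yP xQ] PQ].
by exists (Q, P) => // -[u v] [/= Qu Pv]; exact: (PQ (v, u)).
Qed.

Lemma card_inj T U : [set: T] #<= [set: U] -> exists f : T -> U, injective f.
Proof.
move=> /card_leP[f]; exists (fun x => val (f (SigSub (mem_set (I : [set: T] x))))).
move=> x y /val_inj /'inj_f; rewrite !inE => /(_ I I) /(congr1 val).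
exact.
Qed.

Section borel_edge_colorings.
Variables (R : realType) (X : topologicalType) (G : borelGraph X) (h : X -> baire).
Hypotheses (h_inj : injective h) (h01 : forall x k, h x k <= 1)
  (h_open : forall k, open [set x | h x k = 1])
  (h_base : forall O x, open O -> O x -> exists k, h x k = 1 /\ [set y | h y k = 1] `<=` O)
  (h_range : BN (range h)).

Let sb2 := sborel (X * X)%type.

(** Each edge is its own color, represented by the orientation with the smaller code first; the
    order of codes makes this choice Borel. *)
Lemma square_colorable : polish R X -> borel_edge_colorable G R (X * X)%type.
Proof.
move=> pX; exists (X * X)%type; split; [exact: prod_polish|exact: card_eqxx|].
pose c (e : edge G) := if `[< lex h (val e).1 (val e).2 >] then val e else flip (val e).
have cE e : c e = val e \/ c e = flip (val e) by rewrite /c; case: asboolP; [left|right].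
have flipK (e : X * X) : flip (flip e) = e by case: e.
exists c; split; first split.
- move=> e f; have : edge G (val e) by exact: set_valP.
  rewrite /c => + ->; case: (val e) => x y /= xy.
  have ne : x <> y by move=> e'; rewrite e' in xy; case: (edge_irr xy).
  case: asboolP => l1; case: asboolP => l2 //.
    by case: (lex_irr (lex_trans l1 l2)).
  by case: (lex_total h_inj ne).
- move=> e f ne nf _ cc; case: (cE e) (cE f) => [ce|ce] [cf|cf]; rewrite ce cf in cc.
  + exact: ne.
  + by apply: nf; rewrite cc flipK.
  + exact: nf.
  + by apply: ne; rewrite -[RHS]flipK cc flipK.
move=> B BB; apply: (@sal_iff _ (@borel (X * X)%type) (fun e => edge G e /\
   ((lex h e.1 e.2 /\ B e) \/ (~ lex h e.1 e.2 /\ B (flip e))))).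
  move=> e; split=> [[Ge H]|[e' Be' <-]].
    exists (SigSub (mem_set Ge)) => //=; rewrite /c /=.
    by case: H => -[l Be]; [rewrite asboolT|rewrite asboolF].
  split; first exact: set_valP.
  by move: Be'; rewrite /= /c; case: asboolP => l Be; [left|right].
have Bl := borel_lex h01 h_open.
apply: (sal_and sb2); first exact: edge_borel.
apply: (sal_or sb2); apply: (sal_and sb2) => //; first exact: (sal_not sb2 Bl).
by apply: borel_preimage => //; exact: flip_open_preimage.
Qed.

Section thin_edges.
Variable D : nat -> set baire.
Hypotheses (D_BN : forall n, BN (D n)) (D_fun : forall n, funlike (D n))
  (cover : forall x y, Ed G x y -> exists n, D n (h2 h (x, y))).

Lemma D_inj n x y y' : D n (h2 h (x, y)) -> D n (h2 h (x, y')) -> y = y'.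
Proof.
move=> Dy Dy'; have := D_fun Dy Dy'; rewrite !bpairK1 => /(_ erefl).
by move=> /(h2_inj h_inj)[].
Qed.

(* Orienting edges by the order of codes, a color records the thin pieces containing
   the edge in both directions and the first place where the codes differ; there the
   lower end has 0 and the upper end 1, so no vertex is both. *)
Lemma countably_colorable : borel_edge_colorable G R nat.
Proof.
pose M n m k (e : X * X) := D n (h2 h e) /\ D m (h2 h (flip e)) /\
  (forall j, j < k -> h e.1 j = h e.2 j) /\ h e.1 k < h e.2 k.
pose P x y i := let: (n, (m, k)) := odflt (0, (0, 0)) (unpickle i : option (nat * (nat * nat))) in
  M n m k (x, y) \/ M n m k (y, x).
have Psym x y : P x y = P y x.
  apply/funext => i; rewrite /P; case: (odflt _ _) => n [m k]; apply/propext.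
  by split=> -[]; [right|left|right|left].
have ex x y : Ed G x y -> exists i, P x y i.
  move=> xy; have [n Dn] := cover xy; have [m Dm] := cover (Ed_sym xy).
  have ne : x <> y by move=> e; rewrite e in xy; case: (edge_irr xy).
  have [[k [Hk lt]]|[k [Hk lt]]] := lex_total h_inj ne.
    by exists (pickle (n, (m, k))); rewrite /P pickleK /=; left.
  by exists (pickle (m, (n, k))); rewrite /P pickleK /=; right.
have not_both n m k n' m' u v w : M n m k (v, u) -> M n' m' k (u, w) -> False.
  move=> [_ [_ [_ /= lt]]] [_ [_ [_ /= lt']]].
  by have := h01 w k; have := h01 u k; move: lt lt'; lia.
apply: (@discrete_colorable R X G nat (fun x y => least (P x y))).
- by move=> x y _; rewrite Psym.
- move=> u v w /ex/least_spec + /ex/least_spec + e; rewrite -e /P.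
  case: (odflt _ _) => n [m k] [Muv|Mvu] [Muw|Mwu].
  + by case: Muv Muw => D1 _ [D2 _]; exact: D_inj D1 D2.
  + by case: (not_both _ _ _ _ _ _ _ _ Mwu Muv).
  + by case: (not_both _ _ _ _ _ _ _ _ Mvu Muw).
  + by case: Mvu Mwu => _ [D1 _] [_ [D2 _]]; exact: D_inj D1 D2.
move=> i; apply: (sal_and sb2); first exact: edge_borel.
apply: (sal_least (P := fun e : X * X => P e.1 e.2) _ sb2) => j; rewrite /P.
case: (odflt _ _) => n [m k].
have b1 t a : borel [set e : X * X | h e.1 t = a] := borel_fst (borel_coord h01 h_open t a).
have b2 t a : borel [set e : X * X | h e.2 t = a] := borel_snd (borel_coord h01 h_open t a).
have BM : borel [set e | M n m k e].
  apply: (sal_and sb2); first exact: borel_h2.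
  apply: (sal_and sb2); first exact: borel_h2_flip.
  apply: (sal_and sb2).
    apply: (sal_all sb2) => t; apply: (sal_imp sb2); first exact: (sal_cst sb2).
    apply: (@sal_iff _ (@borel (X * X)%type) (fun e : X * X => exists a, h e.1 t = a /\ h e.2 t = a)).
      by move=> e; split=> [[a [-> ->]]|->] //; exists (h e.2 t).
    by apply: (sal_ex sb2) => a; apply: (sal_and sb2).
  apply: (@sal_iff _ (@borel (X * X)%type) (fun e : X * X => exists a b, h e.1 k = a /\ h e.2 k = b /\ a < b)).
    by move=> e; split=> [[a [b [-> [->]]]]|lt] //; exists (h e.1 k), (h e.2 k).
  apply: (sal_ex sb2) => a; apply: (sal_ex sb2) => b.
  by do 2 (apply: (sal_and sb2) => //); exact: (sal_cst sb2).
apply: (sal_or sb2); first by apply: (sal_iff _ BM) => -[].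
exact: (borel_preimage (@flip_open_preimage X) BM).
Qed.

(** Within the edge set the covering pieces are partial functions. Extended by the identity, which
    adds no edge, they are the required generators, and they are Borel because function-like Borel
    sets have Borel projections. *)
Lemma finitely_colorable d : bipartite G -> components_two_ended G ->
  (forall v, deg_le (Ed G) v d) -> borel_edge_colorable G R 'I_d.+1.
Proof.
move=> bip ends deg; pose Q n : set (X * X) := [set e | edge G e /\ D n (h2 h e)].
have BQ n : borel (Q n) by apply: (sal_and sb2); [exact: edge_borel|exact: borel_h2].
have Qinj n x y y' : Q n (x, y) -> Q n (x, y') -> y = y'.
  by move=> [_ H] [_]; exact: D_inj.
have /choice[g0 Hg0] : forall nx : nat * X, exists z,
    Q nx.1 (nx.2, z) \/ z = nx.2 /\ forall y, ~ Q nx.1 (nx.2, y).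
  move=> [n x] /=.
  have [[y Qy]|nQ] := pselect (exists y, Q n (x, y)); first by exists y; left.
  by exists x; right; split=> // y Qy; apply: nQ; exists y.
pose g n x := g0 (n, x).
have Hg n x : Q n (x, g n x) \/ g n x = x /\ forall y, ~ Q n (x, y) := Hg0 (n, x).
have gQ n x y : Q n (x, y) -> g n x = y.
  by move=> Qy; case: (Hg n x) => [Qg|[_ /(_ y)]//]; exact: Qinj Qg Qy.
have gB n A : borel A -> borel (g n @^-1` A).
  have sb := sborel X; move=> BA.
  apply: (@sal_iff _ (@borel X) (fun x => (exists y, Q n (x, y) /\ A y) \/
     ~ (exists y, Q n (x, y)) /\ A x)).
    move=> x; split=> [[[y [/gQ <-]]//|[nQ Ax]]|Ag].
      by case: (Hg n x) => [Qg|[/= -> //]]; case: nQ; exists (g n x).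
    case: (Hg n x) => [Qg|[e nQ]]; first by left; exists (g n x).
    by right; split=> [[y]|]; [exact: nQ|rewrite -e].
  have proj := borel_proj h_inj h01 h_open h_base h_range.
  apply: (sal_or sb).
    apply: (proj (fun e => Q n e /\ A e.2)) => [|x y y' [Qy _] [Qy' _]]; last exact: Qinj Qy Qy'.
    by apply: (sal_and sb2); [exact: BQ|exact: borel_snd].
  apply: (sal_and sb) => //; apply: (sal_not sb).
  by apply: (proj (Q n)) => // x y y'; exact: Qinj.
have Eg x y : Ed G x y <-> x <> y /\ exists n, y = g n x.
  split=> [xy|[ne [n e]]].
    split; first by move=> e; rewrite e in xy; case: (edge_irr xy).
    by have [n Dn] := cover xy; exists n; rewrite (gQ n x y).
  by case: (Hg n x) => [[+ _]|[e' _]]; [rewrite e|case: ne; rewrite e e'].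
have [side Hside] := bipartition bip.
have cP := connP Eg.
have [|x|c [[csym cinj] cd Bc]] := @two_ended_borel_coloring X (@borel X) g (Ed G) h
    (sborel X) gB (@Ed_sym X G) Eg h_inj (borel_coord h01 h_open) d side deg Hside.
- move=> s F y1 y2 y3 /cP c12 /cP c13; exact: (two_ended_not_three ends c12 c13).
- have [s [y1 [y2 [sx [/cP ? /cP ?] ? ? ?]]]] := two_ended_has_two ends x.
  by exists s, y1, y2; split=> // z /sx/cP.
apply: (@discrete_colorable R X G _ (fun x y => inord (c x y))).
- by move=> x y xy; rewrite csym.
- move=> x y z xy xz /(congr1 (@nat_of_ord _)).
  by rewrite !inordK ?ltnS ?cd//; exact: cinj.
move=> i; apply: (@sal_iff _ (@borel (X * X)%type) (fun e => exists n, Q n e /\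
   (Ed G e.1 (g n e.1) /\ c e.1 (g n e.1) = i))).
  move=> [x y]; split=> [[n [Qn]]|[/= xy ci]].
    rewrite /= (gQ n x y) // => -[xy ci]; split=> //.
    by apply/val_inj; rewrite /= inordK ?ltnS ?cd.
  have [n Dn] := cover xy; have Qn : Q n (x, y) by [].
  by exists n; rewrite /= (gQ n x y) // -ci inordK ?ltnS ?cd.
apply: (sal_ex sb2) => n; apply: (sal_and sb2); first exact: BQ.
exact: (borel_fst (Bc i [::] [:: n])).
Qed.

End thin_edges.

End borel_edge_colorings.

Theorem theorem1p3 (R : realType) (X : topologicalType) (G : borelGraph X) (D : Type) :
  polish R X ->
  bipartite G ->
  components_two_ended G ->
  is_max_degree G D ->
  exists K : Type,
    is_borel_edge_chromatic_number G R K /\ [set: K] #<= [set: option D].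
Proof.
move=> pX bip ends [degD _].
have DoD : [set: D] #<= [set: option D] by apply: (inj_card (f := @Some D)) => // x y _ _ [].
have [K0 cK0 K0D] : exists2 K0, borel_edge_colorable G R K0 & [set: K0] #<= [set: option D].
  have [h [h_inj h01 h_open h_base h_range]] := polish_coding pX.
  have /BN_param[C [f [cC cf CE _]]] :=
    BN_image2 h_base h_range (@edge_borel X G).
  have [[Z [F [HF ->]] CZ]|[p [io [injio Hio iop]]]] := thin_or_perfect cC cf; last first.
    exists (X * X)%type; first exact: (@square_colorable R X G h h_inj h01 h_open pX).
    (* All edges of the perfect set start at one vertex [x], which thus has continuum many
       neighbors, while [X * X] has at most that many points. *)
    apply: card_le_trans (card2_le_cantor h_inj h01) (card_le_trans _ DoD).
    have /choice[e He] : forall b, exists e, edge G e /\ h2 h e = io b.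
      by move=> b; have := Hio b; rewrite -CE => -[e Ge <-]; exists e.
    pose x := (e (fun=> true)).1; apply: card_le_trans (degD x I).
    have ex b : (e b).1 = x.
      apply: h_inj; rewrite -(bpairK1 (h (e b).1) (h (e b).2)) -[bpair _ _]/(h2 h (e b)).
      have [_ ->] := He b; rewrite iop -(iop (fun=> true)).
      by have [_ <-] := He (fun=> true); rewrite bpairK1.
    apply: (inj_card (f := fun b => (e b).2)) => [b b' _ _ ee|b _].
      apply: injio; have [_ <-] := He b; have [_ <-] := He b'.
      by rewrite /h2 !ex ee.
    by have [+ _] := He b; rewrite /neighbors /= -(ex b) -surjective_pairing.
  have cover x y : Ed G x y -> exists n, F n (h2 h (x, y)).
    by move=> xy; apply: CZ; rewrite -CE; exists (x, y).
  have FB n : BN (F n) by case: (HF n).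
  have Ff n : funlike (F n) by case: (HF n).
  have [/finite_setP[d Dd]|/infiniteP iD] := pselect (finite_set [set: D]); last first.
    exists nat; last exact: card_le_trans iD DoD.
    exact: (countably_colorable R h_inj h01 h_open FB Ff cover).
  have [Dd1 Dd2] := (card_eqPle _ _).1 Dd.
  exists 'I_d.+1.
    apply: (finitely_colorable R h_inj h01 h_open h_base h_range FB Ff cover) => // v s us sE.
    rewrite -card_le_II; apply: card_le_trans Dd1; apply: card_le_trans (degD v I).
    exact: seq_card.
  have /card_inj[g ginj] : [set: 'I_d] #<= [set: D].
    by apply: card_le_trans Dd2; have /card_eqPle[] := @card_II d.
  apply: (inj_card (f := fun i => omap g (unlift ord_max i))) => // i j _ _.
  by case: unliftP => [i' ->|->]; case: unliftP => [j' ->|->] //= [/ginj ->].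
(* A Polish color space is countable or of size exactly continuum, so few cardinals compete for the
   least one. *)
have trich L : borel_edge_colorable G R L ->
    (countable [set: L] \/ [set: nat -> bool] #<= [set: L]) /\ [set: L] #<= [set: nat -> bool].
  move=> [Y [pY /card_eqPle[YL LY] _]].
  have [h [h_inj h01 h_open h_base h_range]] := polish_coding pY; split.
    have [cY|pfY] := countable_or_perfect h_inj h_range; last by right; exact: card_le_trans YL.
    by left; exact: card_le_trans cY.
  exact: card_le_trans LY (card_le_cantor h_inj h01).
suff [K cK Kmin] : exists2 K, borel_edge_colorable G R K &
    forall L, borel_edge_colorable G R L -> [set: K] #<= [set: L].
  by exists K; split=> //; exact: card_le_trans (Kmin _ cK0) K0D.
(* First the least finite number of colors; failing that a countable color space, necessarily
   infinite; failing that any, all being of size continuum. *)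
pose P n := exists2 L, borel_edge_colorable G R L & [set: L] #= `I_n.
have [/least_spec[K cK Kn]|nfin] := pselect (exists n, P n).
  exists K => // L cL; have [/finite_setP[m Lm]|/infiniteP iL] := pselect (finite_set [set: L]).
    have [_ mL] := (card_eqPle _ _).1 Lm; have [Kl _] := (card_eqPle _ _).1 Kn.
    apply: card_le_trans Kl (card_le_trans _ mL); rewrite card_le_II.
    by apply: least_le; exists L.
  apply: card_le_trans iL; apply/finite_set_countable/finite_setP.
  by exists (least P).
have inf L : borel_edge_colorable G R L -> [set: nat] #<= [set: L].
  move=> cL; apply/infiniteP => /finite_setP[n Ln]; apply: nfin.
  by exists n, L.
have [[K [cK Kc]]|nc] := pselect (exists K, borel_edge_colorable G R K /\ countable [set: K]).
  by exists K => // L /inf; exact: card_le_trans.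
exists K0 => // L cL; have [_ K0le] := trich _ cK0; apply: card_le_trans K0le _.
by have [[cntL|//] _] := trich _ cL; case: nc; exists L.
Qed.
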